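(* Let $(G,\cdot,\rhd_1)$ and $(G,\overline{\cdot},\rhd_2)$ be post-groups such that for all $x,y,z\in G$, $$x\rhd_1\big((S_1(x)\rhd_1 y)\rhd_2 z\big)=y\rhd_2\big((S_2(y)\rhd_2 x)\rhd_1 z\big),$$ where $S_1,S_2$ are the inverse maps for the Grossman--Larson laws $*_{\rhd_1}$ and $*_{\rhd_2}$ respectively. Assume that both post-groups are post-Lie groups, i.e. $(G,\cdot)$ is a Lie group and $\rhd_1,\rhd_2$ are smooth. Let $(\mathfrak g,[\cdot,\cdot],\blacktriangleright_1)$ and $(\mathfrak g,-[\cdot,\cdot],-\blacktriangleright_2)$ be their respective associated post-Lie algebras. Then for all $x,y,z\in\mathfrak g$, $$x\blacktriangleright_1(y\blacktriangleright_2 z)-(x\blacktriangleright_1 y)\blacktriangleright_2 z=y\blacktriangleright_2(x\blacktriangleright_1 z)-(y\blacktriangleright_2 x)\blacktriangleright_1 z,$$ giving rise to the post-Lie algebra $(\mathfrak g,[\cdot,\cdot],\blacktriangleright_3)$ with $x\blacktriangleright_3 y:=x\blacktriangleright_1 y+x\blacktriangleright_2 y$. Moreover, the post-group $(G,\cdot,\rhd_3)$ with action $x\rhd_3 y:=x\rhd_1(S_1(x)\rhd_2 y)$ is a post-Lie group, and its associated post-Lie algebra is $(\mathfrak g,[\cdot,\cdot],\blacktriangleright_3)$.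
   Context: For a group law $\cdot$, $a\,\overline{\cdot}\,b:=b\cdot a$ is the opposite law. A post-group $(G,\cdot,\rhd)$ is a group $(G,\cdot)$ with a map $\rhd:G\times G\to G$ such that for each $b\in G$ the map $a\mapsto b\rhd a$ is an automorphism of $(G,\cdot)$, and $(a*_\rhd b)\rhd c=a\rhd(b\rhd c)$ for all $a,b,c$, where $a*_\rhd b:=a\cdot(a\rhd b)$ is the Grossman--Larson law; it is a group law on $G$. (For $(G,\overline\cdot,\rhd_2)$ this reads $a*_{\rhd_2}b=a\,\overline\cdot\,(a\rhd_2 b)=(a\rhd_2 b)\cdot a$.) Under the displayed hypothesis on $\rhd_1,\rhd_2$, $(G,\cdot,\rhd_3)$ is known to be a post-group. A post-Lie group is a post-group $(G,\cdot,\rhd)$ with $(G,\cdot)$ a Lie group and $\rhd$ smooth. Its associated post-Lie algebra is the Lie algebra of $(G,\cdot)$ with product $x\blacktriangleright y=\frac{d^2}{ds\,dt}\big|_{s,t=0}\big(\exp(tx)\rhd\exp(sy)\big)$. The Lie algebra of $(G,\cdot)$ is denoted $(\mathfrak g,[\cdot,\cdot])$; that of $(G,\overline\cdot)$ is $(\mathfrak g,-[\cdot,\cdot])$. A post-Lie algebra $(\mathfrak g,[\cdot,\cdot],\blacktriangleright)$ is a Lie algebra with a bilinear product such that $z\blacktriangleright[x,y]=[z\blacktriangleright x,y]+[x,z\blacktriangleright y]$ and $[x,y]\blacktriangleright z=\mathrm a_\blacktriangleright(x,y,z)-\mathrm a_\blacktriangleright(y,x,z)$, where $\mathrm a_\blacktriangleright(x,y,z)=x\blacktriangleright(y\blacktriangleright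 z)-(x\blacktriangleright y)\blacktriangleright z$. *)

(* Defs.v *)
From HB Require Import structures.
From mathcomp Require Import all_boot all_order all_algebra.
From mathcomp Require Import all_classical.
From mathcomp Require Import reals topology normedtype derive.

Set Implicit Arguments.
Unset Strict Implicit.
Unset Printing Implicit Defensive.

Import Order.TTheory GRing.Theory Num.Theory.
Import numFieldNormedType.Exports.

Local Open Scope classical_set_scope.
Local Open Scope ring_scope.

(* Meant for finite-dimensional [E] and an open set [U]: there, [f] is
   C^(k+1) iff it is differentiable and all its directional derivatives
   are C^k. *)
Fixpoint class_C (R : realType) (E F : normedModType R) (k : nat)
    (U : set E) (f : E -> F) : Prop :=
  match k with
  | 0 => forall x, U x -> {for x, continuous f}
  | k'.+1 => (forall x, U x -> differentiable f x) /\
             (forall v, class_C k' U (fun x => 'd f x v))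
  end.

Definition smooth_on (R : realType) (E F : normedModType R)
    (U : set E) (f : E -> F) : Prop := forall k, class_C k U f.

(* [cfun] is only meaningful on [cdom], and [cinv] on [cfun @` cdom]. *)
Record chart (M E : Type) := Chart {
  cdom : set M;
  cfun : M -> E;
  cinv : E -> M }.

Definition cimg (M E : Type) (c : chart M E) : set E := cfun c @` cdom c.

Definition is_chart (R : realType) (M : topologicalType) (E : normedModType R)
    (c : chart M E) : Prop :=
  [/\ open (cdom c), open (cimg c),
      forall p, cdom c p -> {for p, continuous (cfun c)},
      forall u, cimg c u -> {for u, continuous (cinv c)} &
      forall p, cdom c p -> cinv c (cfun c p) = p].

Definition is_atlas (R : realType) (M : topologicalType) (E : normedModType R)
    (A : set (chart M E)) : Prop :=
  [/\ forall c, A c -> is_chart c,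
      forall p, exists2 c, A c & cdom c p &
      forall c d, A c -> A d ->
        smooth_on [set u | cimg c u /\ cdom d (cinv c u)]
          (fun u => cfun d (cinv c u))].

Definition is_manifold (R : realType) (n : nat) (M : topologicalType)
    (A : set (chart M 'rV[R]_n)) : Prop :=
  [/\ hausdorff_space M, @second_countable M & is_atlas A].

Definition prod_chart (M N E F : Type) (c : chart M E) (d : chart N F) :
    chart (M * N) (E * F) :=
  Chart (cdom c `*` cdom d)
        (fun p => (cfun c p.1, cfun d p.2))
        (fun u => (cinv c u.1, cinv d u.2)).

Definition prod_atlas (M N E F : Type)
    (A : set (chart M E)) (B : set (chart N F)) :
    set (chart (M * N) (E * F)) :=
  [set prod_chart c d | c in A & d in B].

Definition line_atlas (R : realType) : set (chart R^o R^o) :=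
  [set Chart setT id id].

Definition smooth_map (R : realType) (M N : topologicalType)
    (E F : normedModType R) (A : set (chart M E)) (B : set (chart N F))
    (f : M -> N) : Prop :=
  continuous f /\
  forall c d, A c -> B d ->
    smooth_on [set u | cimg c u /\ cdom d (f (cinv c u))]
      (fun u => cfun d (f (cinv c u))).

Definition is_group (G : Type) (mul : G -> G -> G) (e : G) (inv : G -> G) :
    Prop :=
  [/\ associative mul, left_id e mul, right_id e mul,
      left_inverse e inv mul & right_inverse e inv mul].

Definition opp_law (G : Type) (mul : G -> G -> G) : G -> G -> G :=
  fun a b => mul b a.

Definition GL_law (G : Type) (mul tri : G -> G -> G) : G -> G -> G :=
  fun a b => mul a (tri a b).

(* The identity of the Grossman-Larson law is that of the original law. *)
Definition GL_inv (G : choiceType) (mul : G -> G -> G) (e : G)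
    (tri : G -> G -> G) (a : G) : G :=
  xget e [set b | GL_law mul tri a b = e /\ GL_law mul tri b a = e].

Definition is_post_group (G : Type) (mul : G -> G -> G) (e : G)
    (inv : G -> G) (tri : G -> G -> G) : Prop :=
  [/\ is_group mul e inv,
      forall b, bijective (tri b),
      forall b, {morph tri b : x y / mul x y} &
      forall a b c, tri (GL_law mul tri a b) c = tri a (tri b c)].

Definition is_lie_group (R : realType) (n : nat) (G : topologicalType)
    (A : set (chart G 'rV[R]_n)) (mul : G -> G -> G) (e : G) (inv : G -> G) :
    Prop :=
  [/\ is_manifold A, is_group mul e inv,
      smooth_map (prod_atlas A A) A (fun p => mul p.1 p.2) &
      smooth_map A A inv].

Definition is_post_lie_group (R : realType) (n : nat) (G : topologicalType)
    (A : set (chart G 'rV[R]_n)) (mul : G -> G -> G) (e : G) (inv : G -> G)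
    (tri : G -> G -> G) : Prop :=
  [/\ is_lie_group A mul e inv, is_post_group mul e inv tri &
      smooth_map (prod_atlas A A) A (fun p => tri p.1 p.2)].

(* Below, the tangent space at [e] is ['rV[R]_n]: a tangent vector is given by
   its coordinates in a fixed chart [c] around [e], so that the velocity at 0
   of a curve [g] with [g 0 = e] is [derive1 (cfun c \o g) 0]. *)

(* The left-invariant vector field with value [x] at [e], read in [c]: its
   value at the point with coordinates [u] is the image of [x] under the
   differential at [e] of the left translation by [cinv c u]. *)
Definition left_inv_field (R : realType) (n : nat) (G : Type)
    (c : chart G 'rV[R]_n) (mul : G -> G -> G) (e : G) (x : 'rV[R]_n) :
    'rV[R]_n -> 'rV[R]_n :=
  fun u => 'D_x (fun w => cfun c (mul (cinv c u) (cinv c w))) (cfun c e).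

Definition field_bracket (R : realType) (n : nat)
    (X Y : 'rV[R]_n -> 'rV[R]_n) : 'rV[R]_n -> 'rV[R]_n :=
  fun u => 'D_(X u) Y u - 'D_(Y u) X u.

Definition lie_bracket (R : realType) (n : nat) (G : Type)
    (c : chart G 'rV[R]_n) (mul : G -> G -> G) (e : G) (x y : 'rV[R]_n) :
    'rV[R]_n :=
  field_bracket (left_inv_field c mul e x) (left_inv_field c mul e y)
    (cfun c e).

Definition one_param_subgroup (R : realType) (n : nat) (G : topologicalType)
    (A : set (chart G 'rV[R]_n)) (mul : G -> G -> G) (g : R^o -> G) : Prop :=
  smooth_map (@line_atlas R) A g /\ {morph g : s t / s + t >-> mul s t}.

Definition lie_exp (R : realType) (n : nat) (G : topologicalType)
    (A : set (chart G 'rV[R]_n)) (c : chart G 'rV[R]_n)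
    (mul : G -> G -> G) (e : G) (x : 'rV[R]_n) : G :=
  xget e [set p | exists g : R^o -> G,
    [/\ one_param_subgroup A mul g, derive1 (cfun c \o g) 0 = x & g 1 = p]].

Definition post_lie_product (R : realType) (n : nat) (G : topologicalType)
    (A : set (chart G 'rV[R]_n)) (c : chart G 'rV[R]_n)
    (mul : G -> G -> G) (e : G) (tri : G -> G -> G) (x y : 'rV[R]_n) :
    'rV[R]_n :=
  (* For a post-Lie group, [exp (t *: x)] fixes [e] under [tri], so the inner
     derivative is a tangent vector at [e] for every [t]. *)
  let exp := lie_exp A c mul e in
  derive1 (fun t : R =>
    derive1 (fun s : R => cfun c (tri (exp (t *: x)) (exp (s *: y)))) 0) 0.

Definition is_bilinear (K : fieldType) (V : lmodType K) (b : V -> V -> V) :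
    Prop :=
  (forall x, linear (b x)) /\ (forall y, linear (b^~ y)).

Definition is_lie_algebra (K : fieldType) (V : lmodType K)
    (br : V -> V -> V) : Prop :=
  [/\ is_bilinear br, forall x, br x x = 0 &
      forall x y z, br x (br y z) + br y (br z x) + br z (br x y) = 0].

Definition associator (V : zmodType) (prd : V -> V -> V) (x y z : V) : V :=
  prd x (prd y z) - prd (prd x y) z.

Definition is_post_lie_algebra (K : fieldType) (V : lmodType K)
    (br prd : V -> V -> V) : Prop :=
  [/\ is_lie_algebra br, is_bilinear prd,
      forall x y z, prd z (br x y) = br (prd z x) y + br x (prd z y) &
      forall x y z,
        prd (br x y) z = associator prd x y z - associator prd y x z].

Definition associated_post_lie_algebra (R : realType) (n : nat)
    (G : topologicalType) (A : set (chart G 'rV[R]_n))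
    (c : chart G 'rV[R]_n) (mul : G -> G -> G) (e : G) (tri : G -> G -> G)
    (br prd : 'rV[R]_n -> 'rV[R]_n -> 'rV[R]_n) : Prop :=
  (forall x y, br x y = lie_bracket c mul e x y) /\
  (forall x y, prd x y = post_lie_product A c mul e tri x y).

(* Main.v *)
Require Import Defs.
From HB Require Import structures.
From mathcomp Require Import all_boot all_order all_algebra.
From mathcomp Require Import all_classical.
From mathcomp Require Import reals topology prodnormedzmodule normedtype landau derive.
From mathcomp Require Import ereal measure lebesgue_measure lebesgue_integral ftc.
From mathcomp Require Import ring lra.
Set Implicit Arguments.
Unset Strict Implicit.
Unset Printing Implicit Defensive.

Import Order.TTheory GRing.Theory Num.Theory.
Import numFieldNormedType.Exports.

Local Open Scope classical_set_scope.
Local Open Scope ring_scope.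

(* In a chart around [e], with [p] the coordinates of [e], both structures become
   second-order data at [(p, p)]: the Lie bracket is the antisymmetrized mixed
   second derivative of the law and the post-Lie product is the mixed second
   derivative of the action. The latter needs [exp], hence the existence of
   one-parameter subgroups (Picard iteration). The Grossman-Larson law is a smooth
   group law, so its inverse [S1] is smooth with differential [-id] at [e];
   therefore [tri3] is smooth and its mixed derivative is that of [tri1] minus that
   of [tri2], i.e. [prd1 + prd2].

   Differentiating the law of an action in the last variable at [e] relates the
   mixed derivatives at nearby points. One more differentiation, together with the
   symmetry of second derivatives, gives the Jacobi identity, the derivation and
   curvature axioms for any post-Lie group, and the same argument applied to the
   hypothesis on [tri1] and [tri2] gives the first claim. *)

(** * Smooth maps on normed spaces *)

(** The post-Lie axioms of [prd3] are not computed from the commutation identity: [tri3] is shown to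
    be a post-Lie group whose product is [prd3], and the axioms are those of any post-Lie group.

    Differentiating a law twice or more leaves second derivatives of translations, of automorphisms
    or of vector fields, which have no algebraic meaning. They are never evaluated: they are
    symmetric, and antisymmetrizing or summing cyclically removes them. Identities are kept as
    germs, valid on a neighbourhood, because they are differentiated again.

    The data say nothing on the regularity of [S1], since [GL_inv] is a bare choice of inverse. Near
    [e] inversion is the fixed point of a contraction; its differential at [e] is computed by hand
    and carried to nearby points by translation. The resulting formula involves only the law and
    inversion itself, so regularity rises by induction.

    For one-parameter subgroups, the quotient of two group elements does not change when both are
    multiplied on the right by the same element. This one remark gives the uniqueness of integral
    curves of left-invariant fields and the homomorphism property. *)

Section ClassC.
Context {R : realType}.
Implicit Types E F H : normedModType R.

(** Finite dimension as a spanning family with continuous coordinate functionals: a form stable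
    under products, hence covering the line, row vectors and the products on which laws and actions
    live. It reduces a varying direction of differentiation to finitely many fixed ones. *)
Definition finite_coords E : Prop :=
  exists m (b : 'I_m -> E) (phi : 'I_m -> {linear E -> R^o}),
    (forall i, continuous (phi i)) /\
    forall w, w = \sum_i phi i w *: b i.

Lemma finite_coords_line : finite_coords (R^o : normedModType R).
Proof.
exists 1%N, (fun=> (1 : R^o)), (fun=> idfun); split; first by move=> i x.
by move=> w; rewrite big_ord1 /= /GRing.scale /= mulr1.
Qed.

Lemma finite_coords_rV n : finite_coords ('rV[R]_n : normedModType R).
Proof.
exists n, (fun i => delta_mx 0 i).
have lin i : linear (fun w : 'rV[R]_n => w 0 i : R^o).
  by move=> a u v; rewrite !mxE.
pose phi i : {linear 'rV[R]_n -> R^o} :=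
  HB.pack (fun w : 'rV[R]_n => w 0 i : R^o)
    (GRing.isLinear.Build R _ R^o _ _ (lin i)).
exists phi; split; first by move=> i; exact: coord_continuous.
by move=> w; rewrite {1}[w]row_sum_delta.
Qed.

Lemma finite_coords_prod E F :
  finite_coords E -> finite_coords F ->
  finite_coords ((E * F)%type : normedModType R).
Proof.
move=> [m [b [phi [cphi eb]]]] [n [d [psi [cpsi ed]]]].
exists (m + n)%N, (fun i => match fintype.split i with
   inl j => (b j, 0) | inr j => (0, d j) end).
have lin i : linear (fun w : E * F => match fintype.split i with
   inl j => phi j w.1 | inr j => psi j w.2 end : R^o).
  by move=> a u v; case: (fintype.split i) => j /=; rewrite linearP.
pose chi i : {linear (E * F)%type -> R^o} :=
  HB.pack (fun w : E * F => match fintype.split i with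
     inl j => phi j w.1 | inr j => psi j w.2 end : R^o)
    (GRing.isLinear.Build R _ R^o _ _ (lin i)).
exists chi; split.
  move=> i w; rewrite /chi /=; case: (fintype.split i) => j /=.
    by apply: (@continuous_comp _ _ _ fst (phi j)); [exact: cvg_fst|exact: cphi].
  by apply: (@continuous_comp _ _ _ snd (psi j)); [exact: cvg_snd|exact: cpsi].
move=> [u v]; rewrite big_split_ord /=.
under eq_bigr => i _ do rewrite /chi /= (unsplitK (inl i)) /=.
under [X in _ + X]eq_bigr => i _ do rewrite /chi /= (unsplitK (inr i)) /=.
rewrite [in LHS](eb u) [in LHS](ed v).
have -> : \sum_(i < m) phi i u *: (b i, 0 : F) = (\sum_(i < m) phi i u *: b i, 0).
  elim/big_rec2 : _ => // i y x _ ->.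
  by congr pair; rewrite /= scaler0 addr0.
have -> : \sum_(i < n) psi i v *: (0 : E, d i) = (0, \sum_(i < n) psi i v *: d i).
  elim/big_rec2 : _ => // i y x _ ->.
  by congr pair; rewrite /= scaler0 addr0.
by congr pair; rewrite /= ?addr0 ?add0r.
Qed.

Lemma continuous_linear_finite_coords E F (f : {linear E -> F}) :
  finite_coords E -> continuous f.
Proof.
move=> [m [b [phi [cphi eb]]]].
have -> : (f : E -> F) = (fun w => \sum_i phi i w *: f (b i)).
  apply/funext => w; rewrite {1}(eb w) linear_sum; apply: eq_bigr => i _.
  by rewrite linearZ.
apply: (@continuous_big F 'I_m +%R 0 xpredT (@add_continuous _) E _
  (fun i w => phi i w *: f (b i))) => i _ x.
apply: cvgZr_tmp; exact: cphi.
Qed.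

Lemma class_CS E F k (U : set E) (f : E -> F) :
  class_C k.+1 U f -> class_C k U f.
Proof.
elim: k f => [|k IH] f /= [df cf]; first by move=> x /df /differentiable_continuous.
by split=> // v; apply: IH; exact: cf.
Qed.

Lemma class_C_sub E F k (U V : set E) (f : E -> F) :
  U `<=` V -> class_C k V f -> class_C k U f.
Proof.
move=> UV; elim: k f => [|k IH] f /=; first by move=> + x /UV; apply.
by move=> [df cf]; split=> [x /UV|v]; [exact: df|exact: IH].
Qed.

(** [class_C] asks for conditions at the points of [U], with derivatives taken in the ambient space,
    so the sets [V] are glued point by point. *)
Lemma class_C_local E F k (U : set E) (f : E -> F) :
  (forall x, U x -> exists2 V, V x & class_C k V f) -> class_C k U f.
Proof.
elim: k f => [|k IH] f h; first by move=> x /h[V Vx]; exact.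
split=> [x /h[V Vx []]|v]; first by move=> + _; exact.
by apply: IH => x /h[V Vx [_ /(_ v)]]; exists V.
Qed.

(** Both maps have the same first-order expansion at [x]. Uniqueness of the differential identifies
    ['d g x] with ['d f x], and differentiability of [g] is read off from that. *)
Lemma near_eq_diff E F (f g : E -> F) x :
  (\forall y \near x, f y = g y) -> differentiable f x ->
  differentiable g x /\ 'd g x = 'd f x :> (E -> F).
Proof.
move=> fg df.
have fgx := nbhs_singleton fg.
have o : g \o shift x = cst (g x) + 'd f x +o_ 0 id.
  apply/eqaddoP => _/posnumP[e].
  have /eqaddoP/(_ e%:num (gt0 _)) h := diff_locally df.
  have h2 : \forall y \near 0, f (y + x) = g (y + x).
    have := fg; rewrite (near_shift (0 : E) x (fun y => f y = g y)) subr0.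
    by move/filterS; apply.
  near=> y; have : f (y + x) = g (y + x) by near: y.
  move=> fgy; have : `|(f \o shift x - (cst (f x) + 'd f x)) y| <= e%:num * `|y|.
    by near: y.
  by rewrite /= -![(_ - _) y]/(_ - _) /= -![(_ + _) y]/(_ + _) /= fgy -fgx.
have gd : 'd g x = 'd f x :> (E -> F).
  by apply: diff_unique => //; exact: diff_continuous.
by split=> //; apply/diff_locallyP; rewrite gd; split => //; exact: diff_continuous.
Unshelve. all: by end_near. Qed.

Lemma class_C_eq E F k (U : set E) (f g : E -> F) : open U ->
  {in U, f =1 g} -> class_C k U f -> class_C k U g.
Proof.
move=> oU; elim: k f g => [|k IH] f g fg /=.
  move=> cf x Ux; have fgn : \forall y \near x, f y = g y.
    by have := open_nbhs_nbhs (conj oU Ux); apply: filterS => y Uy; apply/fg/mem_set.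
  move: (cf x Ux); rewrite /prop_for /continuous_at -(fg x (mem_set Ux)).
  by move=> h; apply: cvg_trans h; exact: near_eq_cvg.
move=> [df cf].
have key x : U x -> differentiable g x /\ 'd g x = 'd f x :> (E -> F).
  move=> Ux; apply: near_eq_diff (df x Ux).
  by have := open_nbhs_nbhs (conj oU Ux); apply: filterS => y Uy; apply/fg/mem_set.
split=> [x Ux|v]; first by have [] := key x Ux.
apply: (IH (fun x => 'd f x v)); last exact: cf.
by move=> x /set_mem Ux; rewrite (key x Ux).2.
Qed.

Lemma class_C_cst E F k (U : set E) (a : F) : class_C k U (fun=> a).
Proof.
elim: k a => [|k IH] a /=; first by move=> x _; exact: cvg_cst.
split=> [x _|v]; first exact: differentiable_cst.
have -> : (fun x : E => 'd (fun=> a) x v) = (fun=> 0).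
  by apply/funext => x; have := congr1 (@^~ v) (diff_cst a x).
exact: IH.
Qed.

Lemma class_C_linear E F k (U : set E) (f : {linear E -> F}) :
  continuous f -> class_C k U f.
Proof.
move=> cf; case: k => [|k] /=; first by move=> x _; exact: cf.
split=> [x _|v]; first exact: linear_differentiable.
have -> : (fun x : E => 'd f x v) = (fun=> f v).
  by apply/funext => x; rewrite diff_lin.
exact: class_C_cst.
Qed.

Lemma class_CD E F k (U : set E) (f g : E -> F) :
  class_C k U f -> class_C k U g -> open U -> class_C k U (f \+ g).
Proof.
move=> + + oU; elim: k f g => [|k IH] f g /=.
  by move=> cf cg x Ux; apply: cvgD; [exact: cf|exact: cg].
move=> [df cf] [dg cg]; split=> [x Ux|v].
  by apply: differentiableD; [exact: df|exact: dg].
apply: (@class_C_eq _ _ _ _ ((fun x => 'd f x v) \+ (fun x => 'd g x v))) => //.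
  by move=> x /set_mem Ux /=; rewrite diffD //; [exact: df|exact: dg].
exact: IH.
Qed.

Lemma class_C_linear_comp E F H k (U : set E) (f : E -> F) (l : {linear F -> H}) :
  continuous l -> open U -> class_C k U f -> class_C k U (l \o f).
Proof.
move=> cl oU; elim: k f => [|k IH] f.
  by move=> cf x Ux; apply: continuous_comp; [exact: cf|exact: cl].
have dl y : differentiable l y by exact: linear_differentiable.
move=> [df cf]; split=> [x Ux|v].
  by apply: differentiable_comp => //; exact: df.
apply: (@class_C_eq _ _ _ _ (l \o (fun x => 'd f x v))) => //; last exact: (IH _ (cf v)).
by move=> x /set_mem/df dfx; rewrite (diff_comp dfx (dl _)) /comp diff_lin.
Qed.

Lemma class_C_sum E F k (U : set E) m (f : 'I_m -> E -> F) : open U ->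
  (forall i, class_C k U (f i)) -> class_C k U (fun x => \sum_i f i x).
Proof.
move=> oU; elim: m f => [|m IH] f cf.
  have -> : (fun x => \sum_(i < 0) f i x) = (fun=> 0).
    by apply/funext => x; rewrite big_ord0.
  exact: class_C_cst.
have -> : (fun x => \sum_(i < m.+1) f i x) =
    (f ord0) \+ (fun x => \sum_(i < m) f (lift ord0 i) x).
  by apply/funext => x; rewrite big_ord_recl.
by apply: class_CD => //; exact: IH.
Qed.

Lemma class_C_pair E F H k (U : set E) (f : E -> F) (g : E -> H) :
  class_C k U f -> class_C k U g -> open U ->
  class_C k U (fun x => (f x, g x) : (F * H)%type).
Proof.
move=> + + oU; elim: k f g => [|k IH] f g /=.
  by move=> cf cg x Ux; apply: cvg_pair; [exact: cf|exact: cg].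
move=> [df cf] [dg cg]; split=> [x Ux|v].
  by apply: differentiable_pair; [exact: df|exact: dg].
apply: (@class_C_eq _ _ _ _ (fun x => ('d f x v, 'd g x v))) => //.
  by move=> x /set_mem Ux /=; rewrite diff_pair //; [exact: df|exact: dg].
exact: IH.
Qed.

Lemma scale_bilinear F : bilinear_for
    (GRing.Scale.Law.clone _ _ *:%R _) (GRing.Scale.Law.clone _ _ *:%R _)
    (fun (a : R^o) (v : F) => a *: v).
Proof.
by split=> [v|a] b x y /=; rewrite ?scalerDl ?scalerDr // scalerA // mulrC -scalerA.
Qed.

Lemma diff_scale E F (f : E -> R^o) (g : E -> F) x :
  differentiable f x -> differentiable g x ->
  differentiable (fun y => f y *: g y) x /\
  forall v, 'd (fun y => f y *: g y) x v = f x *: 'd g x v + 'd f x v *: g x.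
Proof.
move=> df dg.
pose B : {bilinear R^o -> F -> F} := HB.pack (fun (a : R^o) (v : F) => a *: v)
  (bilinear_isBilinear.Build R R^o F F _ _ _ (scale_bilinear F)).
have cB : continuous (fun p : R^o * F => B p.1 p.2).
  by move=> p; exact: scale_continuous.
have dB p := differentiable_bilin p cB.
have dp := differentiable_pair df dg.
split; first exact: (@differentiable_comp _ _ _ _ _ (fun p : R^o * F => B p.1 p.2) _ dp).
move=> v.
have e1 := diff_bilin (f x, g x) cB.
have e2 := congr1 (@^~ v) (diff_pair df dg).
by apply: etrans (congr1 (@^~ v) (diff_comp dp (dB _))) _; rewrite /= e1 e2.
Qed.

Lemma class_CZ E F k (U : set E) (f : E -> R^o) (g : E -> F) :
  class_C k U f -> class_C k U g -> open U -> class_C k U (fun x => f x *: g x).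
Proof.
move=> + + oU; elim: k f g => [|k IH] f g.
  by move=> cf cg x Ux; apply: cvgZ; [exact: cf|exact: cg].
(* Each Leibniz term keeps one factor undifferentiated, which is needed at the lower order. *)
move=> cf1 cg1; have cf0 := class_CS cf1; have cg0 := class_CS cg1.
move: cf1 cg1 => [df cf] [dg cg]; split=> [x Ux|v].
  by apply: (diff_scale _ _).1; [exact: df|exact: dg].
apply: (@class_C_eq _ _ _ _
  ((fun x => f x *: 'd g x v) \+ (fun x => 'd f x v *: g x))) => //.
  by move=> x /set_mem Ux /=; rewrite (diff_scale _ _).2 //; [exact: df|exact: dg].
by apply: class_CD => //; [exact: (IH _ _ cf0 (cg v))|exact: (IH _ _ (cf v) cg0)].
Qed.

(** The derivative of the composite applies ['d g (f x)] to the moving vector ['d f x v]. Expanding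
    that vector in the family [b] gives products of scalar functions by derivatives of [g] in fixed
    directions, to which the induction hypothesis applies. *)
Lemma class_C_comp E F H k (U : set E) (V : set F) (f : E -> F) (g : F -> H) :
  finite_coords F -> open U -> open V -> (forall x, U x -> V (f x)) ->
  class_C k U f -> class_C k V g -> class_C k U (g \o f).
Proof.
move=> [m [b [phi [cphi eb]]]] oU oV fUV; elim: k f g fUV => [|k IH] f g fUV.
  move=> cf cg x Ux; apply: continuous_comp; [exact: cf|exact/cg/fUV].
move=> cf1 cg1; have cf0 := class_CS cf1; have cg0 := class_CS cg1.
move: cf1 cg1 => [df cf] [dg cg]; split=> [x Ux|v].
  by apply: differentiable_comp; [exact: df|exact/dg/fUV].
apply: (@class_C_eq _ _ _ _
  (fun x => \sum_i phi i ('d f x v) *: 'd g (f x) (b i))) => //.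
  move=> x /set_mem Ux; rewrite (diff_comp (df x Ux) (dg _ (fUV x Ux))) /=.
  rewrite [X in _ = 'd g _ X]eb linear_sum /=; apply: eq_bigr => i _.
  by rewrite linearZ.
apply: class_C_sum => // i; apply: class_CZ => //.
  exact: class_C_linear_comp (cphi i) oU (cf v).
exact: (IH f (fun y => 'd g y (b i)) fUV cf0 (cg (b i))).
Qed.
End ClassC.

(** * Germs of smooth maps *)

Section SmoothNear.
Context {R : realType}.
Implicit Types E F H : normedModType R.

Lemma near_normP E (p : E) (P : set E) :
  (\forall q \near p, P q) <-> exists2 r, 0 < r & forall q, `|q - p| < r -> P q.
Proof.
split=> [/nbhs_normP[r /= r0 h]|[r r0 h]].
  by exists r => // q qp; apply: h; rewrite /= distrC.
by apply/nbhs_normP; exists r => // q; rewrite /= distrC => /h.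
Qed.

Lemma continuous_normP E F (f : E -> F) (p : E) : {for p, continuous f} <->
  forall eps, 0 < eps -> exists2 r, 0 < r &
    forall q, `|q - p| < r -> `|f q - f p| < eps.
Proof.
split=> [cf eps eps0|h].
  move: cf => /cvgr_dist_lt /(_ _ eps0) /near_normP[r r0 h].
  by exists r => // q /h; rewrite distrC.
apply/cvgrPdist_lt => eps /h[r r0 hr].
by apply/near_normP; exists r => // q /hr; rewrite distrC.
Qed.

Lemma open_norm_ball E (p : E) r : open [set q | `|q - p| < r].
Proof.
rewrite openE => q /= qp; suff h : \forall x \near q, `|x - p| < r by exact: h.
apply/near_normP; exists (r - `|q - p|); first by rewrite subr_gt0.
move=> x xq; have -> : x - p = (x - q) + (q - p) by rewrite addrA subrK.
by apply: le_lt_trans (ler_normD _ _) _; rewrite -ltrBrDr.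
Qed.

Lemma norm_pair_lt E F (x y : ((E * F)%type : normedModType R)) r :
  `|x.1 - y.1| < r -> `|x.2 - y.2| < r -> `|x - y| < r.
Proof. by move=> h1 h2; rewrite prod_normE /= gt_max h1 h2. Qed.

Lemma norm_pair0 E F (x : ((E * F)%type : normedModType R)) :
  x.1 = 0 -> `|x| = `|x.2|.
Proof. by move=> h; rewrite prod_normE /= h normr0 max_r. Qed.

Lemma pair_subl E F (a : E) (b d : F) :
  (a, b) - (a, d) = (0, b - d) :> (E * F)%type.
Proof. by congr pair; rewrite /= subrr. Qed.

(** One neighbourhood serves all orders of differentiability, so the directional derivatives of a
    smooth germ are smooth germs. *)
Definition smooth_near E F (f : E -> F) (p : E) : Prop :=
  exists U, [/\ open U, U p & smooth_on U f].

Lemma smooth_on_near E F (U : set E) (f : E -> F) p :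
  open U -> smooth_on U f -> U p -> smooth_near f p.
Proof. by move=> oU cf Up; exists U. Qed.

Lemma smooth_near_nbhs E F (f : E -> F) p :
  smooth_near f p -> \forall q \near p, smooth_near f q.
Proof.
move=> [U [oU Up cf]]; have := open_nbhs_nbhs (conj oU Up).
by apply: filterS => q Uq; exists U.
Qed.

Lemma smooth_near_differentiable E F (f : E -> F) p :
  smooth_near f p -> differentiable f p.
Proof. by move=> [U [oU Up /(_ 1%N)[df _]]]; exact: df. Qed.

Lemma smooth_near_continuous E F (f : E -> F) p :
  smooth_near f p -> {for p, continuous f}.
Proof. by move/smooth_near_differentiable; exact: differentiable_continuous. Qed.

Lemma smooth_near_eq E F (f g : E -> F) p :
  (\forall q \near p, f q = g q) -> smooth_near f p -> smooth_near g p.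
Proof.
move=> fg; have := fg : nbhs p [set q | f q = g q].
rewrite nbhsE => -[V [oV Vp] {}fg] [U [oU Up cf]].
have oUV : open (U `&` V) by exact: openI.
exists (U `&` V); split=> // k; apply: (@class_C_eq _ _ _ _ _ f) => //.
  by move=> q /set_mem[_ Vq]; exact: fg.
exact: (class_C_sub (@subIsetl _ U V)).
Qed.

Lemma open_preimage_in (X Y : topologicalType) (f : X -> Y) (U : set X) (V : set Y) :
  open U -> open V -> (forall x, U x -> {for x, continuous f}) ->
  open [set x | U x /\ V (f x)].
Proof.
move=> oU oV cf; rewrite openE => x [Ux Vfx]; rewrite /interior.
have := cf x Ux V (open_nbhs_nbhs (conj oV Vfx)); rewrite nbhs_simpl /= => nV.
have := open_nbhs_nbhs (conj oU Ux) => nU.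
by apply: filterI.
Qed.

Lemma smooth_near_comp E F H (f : E -> F) (g : F -> H) p : finite_coords F ->
  smooth_near f p -> smooth_near g (f p) -> smooth_near (fun x => g (f x)) p.
Proof.
move=> fd [U [oU Up cf]] [V [oV Vp cg]].
have oW := open_preimage_in oU oV (cf 0%N).
exists [set x | U x /\ V (f x)]; split=> // k.
apply: (class_C_comp fd oW oV) (cg k); first by move=> x [].
by apply: class_C_sub (cf k) => x [].
Qed.

Lemma smooth_near_pair E F H (f : E -> F) (g : E -> H) p :
  smooth_near f p -> smooth_near g p -> smooth_near (fun x => (f x, g x)) p.
Proof.
move=> [U [oU Up cf]] [V [oV Vp cg]].
have oW : open (U `&` V) by exact: openI.
exists (U `&` V); split=> // k; apply: class_C_pair oW.
  exact: (class_C_sub (@subIsetl _ U V)).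
exact: (class_C_sub (@subIsetr _ U V)).
Qed.

Lemma smooth_near_cst E F (a : F) (p : E) : smooth_near (fun=> a) p.
Proof. by exists setT; split=> [||k]; [exact: openT|by []|exact: class_C_cst]. Qed.

Lemma smooth_near_linear E F (f : {linear E -> F}) (p : E) :
  continuous f -> smooth_near f p.
Proof.
by move=> cf; exists setT; split=> [||k]; [exact: openT|by []|exact: class_C_linear].
Qed.

Lemma smooth_near_id E (p : E) : smooth_near id p.
Proof. by apply: (@smooth_near_linear _ _ idfun) => x. Qed.

Lemma smooth_near_fst E F (p : E * F) : smooth_near fst p.
Proof.
have lin : linear (fst : E * F -> E) by [].
pose l : {linear (E * F)%type -> E} := HB.pack (fst : E * F -> E)
  (GRing.isLinear.Build R (E * F)%type E _ _ lin).
by apply: (@smooth_near_linear _ _ l) => x; exact: cvg_fst.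
Qed.

Lemma smooth_near_snd E F (p : E * F) : smooth_near snd p.
Proof.
have lin : linear (snd : E * F -> F) by [].
pose l : {linear (E * F)%type -> F} := HB.pack (snd : E * F -> F)
  (GRing.isLinear.Build R (E * F)%type F _ _ lin).
by apply: (@smooth_near_linear _ _ l) => x; exact: cvg_snd.
Qed.

Lemma smooth_nearZ E F (f : E -> R^o) (g : E -> F) p :
  smooth_near f p -> smooth_near g p -> smooth_near (fun x => f x *: g x) p.
Proof.
move=> [U [oU Up cf]] [V [oV Vp cg]].
have oW : open (U `&` V) by exact: openI.
exists (U `&` V); split=> // k; apply: class_CZ oW.
  exact: (class_C_sub (@subIsetl _ U V)).
exact: (class_C_sub (@subIsetr _ U V)).
Qed.

Lemma smooth_nearD E F (f : E -> F) (g : E -> F) p :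
  smooth_near f p -> smooth_near g p -> smooth_near (fun x => f x + g x) p.
Proof.
move=> [U [oU Up cf]] [V [oV Vp cg]].
have oW : open (U `&` V) by exact: openI.
exists (U `&` V); split=> // k; apply: class_CD oW.
  exact: (class_C_sub (@subIsetl _ U V)).
exact: (class_C_sub (@subIsetr _ U V)).
Qed.

Lemma smooth_near_sum E F m (f : 'I_m -> E -> F) p :
  (forall i, smooth_near (f i) p) -> smooth_near (fun x => \sum_i f i x) p.
Proof.
elim: m f => [|m IH] f cf.
  have -> : (fun x => \sum_(i < 0) f i x) = (fun=> 0).
    by apply/funext => x; rewrite big_ord0.
  exact: smooth_near_cst.
have -> : (fun x => \sum_(i < m.+1) f i x) =
    (fun x => f ord0 x + \sum_(i < m) f (lift ord0 i) x).
  by apply/funext => x; rewrite big_ord_recl.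
by apply: smooth_nearD => //; exact: IH.
Qed.

Lemma smooth_near_diff E F (f : E -> F) p v :
  smooth_near f p -> smooth_near (fun x => 'd f x v) p.
Proof.
by move=> [U [oU Up cf]]; exists U; split=> // k; have [_] := cf k.+1; exact.
Qed.

Lemma diff_coords E F (f : E -> F) x m (d : 'I_m -> E)
    (phi : 'I_m -> {linear E -> R^o}) w : w = \sum_i phi i w *: d i ->
  'd f x w = \sum_i phi i w *: 'd f x (d i).
Proof.
by move=> e; rewrite {1}e linear_sum; apply: eq_bigr => i _; rewrite linearZ.
Qed.

(** The differential is linear in the direction: expanding the direction in coordinates separates it
    from the base point. *)
Lemma smooth_near_diff_joint E F (f : E -> F) p w : finite_coords E ->
  smooth_near f p -> smooth_near (fun q : E * E => 'd f (q.1) q.2) (p, w).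
Proof.
move=> fdE cf; have [m [b [phi [cphi eb]]]] := fdE.
have -> : (fun q : E * E => 'd f (q.1) q.2) =
    (fun q => \sum_i phi i q.2 *: 'd f (q.1) (b i)).
  by apply/funext => q; exact: diff_coords.
apply: smooth_near_sum => i; apply: smooth_nearZ.
  apply: smooth_near_comp => //; first exact: smooth_near_snd.
  exact: smooth_near_linear.
apply: (@smooth_near_comp _ _ _ fst (fun u => 'd f u (b i))) => //.
  exact: smooth_near_fst.
exact: smooth_near_diff.
Qed.

(* [Psi] gives the differential of [f] in terms of [f], so regularity of [f]
   can be raised one degree at a time. *)
Lemma smooth_bootstrap E F (V : set E) (W : set (E * F)%type) (f : E -> F)
    (Psi : E * F -> E -> F) : finite_coords E -> finite_coords F ->
  open V -> open W -> (forall v, smooth_on W (Psi^~ v)) ->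
  (forall x, V x -> W (x, f x)) -> (forall x, V x -> differentiable f x) ->
  (forall x v, V x -> 'd f x v = Psi (x, f x) v) -> smooth_on V f.
Proof.
move=> fE fF oV oW cP VW df ef; elim=> [|k IH].
  by move=> x /df; exact: differentiable_continuous.
split=> // v.
apply: (@class_C_eq _ _ _ _ _ (fun x => Psi (x, f x) v)) => //.
  by move=> x /set_mem Vx; rewrite ef.
apply: (@class_C_comp _ _ _ _ _ _ W (fun x => (x, f x)) (Psi^~ v)) (cP v k) => //.
  exact: finite_coords_prod.
apply: class_C_pair => //.
by apply: (@class_C_linear _ _ _ _ _ idfun) => x.
Qed.

End SmoothNear.

(** * Second derivatives *)

Section SecondOrder.
Context {R : realType}.
Implicit Types E F H : normedModType R.

Lemma is_diff_line E (a v : E) (s : R^o) :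
  is_diff s (fun t : R^o => a + t *: v) (fun t : R^o => t *: v).
Proof.
by apply: is_diff_eq; apply/funext => t /=; rewrite -[RHS]add0r.
Qed.

Lemma diff_compE E F H (f : E -> F) (g : F -> H) x v :
  differentiable f x -> differentiable g (f x) ->
  'd (fun y => g (f y)) x v = 'd g (f x) ('d f x v).
Proof. by move=> df dg; exact: (congr1 (@^~ v) (diff_comp df dg)). Qed.

Lemma diff_pairE E F H (f : E -> F) (g : E -> H) x v :
  differentiable f x -> differentiable g x ->
  'd (fun y => (f y, g y)) x v = ('d f x v, 'd g x v).
Proof. by move=> df dg; exact: (congr1 (@^~ v) (diff_pair df dg)). Qed.

Lemma is_derive_line E F (f : E -> F) (a v : E) (s : R^o) :
  differentiable f (a + s *: v) ->
  is_derive s (1 : R^o) (fun t : R^o => f (a + t *: v)) ('d f (a + s *: v) v).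
Proof.
move=> df; have [dl el] := is_diff_line a v s.
have dfl : differentiable (fun t : R^o => f (a + t *: v)) s.
  exact: (differentiable_comp dl df).
apply: DeriveDef; first exact: diff_derivable.
by rewrite deriveE // (diff_compE _ dl df) el /= scale1r.
Qed.

Lemma mvt_line E (f : E -> R^o) (a v : E) :
  (forall s : R, 0 <= s <= 1 -> differentiable f (a + s *: v)) ->
  exists2 s : R, 0 < s < 1 & f (a + v) - f a = 'd f (a + s *: v) v.
Proof.
move=> df; pose g (t : R) : R := f (a + t *: v).
have dg s : 0 <= s <= 1 -> is_derive (s : R) (1 : R) g ('d f (a + s *: v) v).
  by move=> s01; exact: (@is_derive_line E R^o f a v s (df s s01)).
have [||s s01] := @MVT R g (fun s => 'd f (a + s *: v) v) 0 1 ltr01.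
- by move=> s; rewrite in_itv /= => /andP[s0 s1]; apply: dg; rewrite !ltW.
- apply: continuous_in_subspaceT => s /set_mem /=; rewrite in_itv /= => /dg [ds _].
  by apply: differentiable_continuous; exact/derivable1_diffP.
rewrite /g scale1r scale0r addr0 subr0 mulr1 => es.
by exists s => //; move: s01; rewrite in_itv.
Qed.

Lemma diff_partial E F H (K : E * F -> H) q w x y : differentiable K (q, w) ->
  'd K (q, w) (x, y) =
  'd (fun u => K (u, w)) q x + 'd (fun v => K (q, v)) w y.
Proof.
move=> dK.
have d1 : differentiable (fun u : E => (u, w)) q by exact: differentiable_pair.
have d2 : differentiable (fun v : F => (q, v)) w by exact: differentiable_pair.
rewrite (diff_compE _ d1 dK) (diff_compE _ d2 dK) -linearD /= !diff_pairE //.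
rewrite !diff_val; congr ('d K _ _).
by congr pair; rewrite /= ?addr0 ?add0r.
Qed.

(** The derivative along [y] is taken first, and then differentiated along [x]. *)
Definition d2 E F (f : E -> F) (p x y : E) : F := 'd (fun u => 'd f u y) p x.

Lemma diff_linear_eq E F (f : {linear E -> F}) x v :
  continuous f -> 'd f x v = f v.
Proof. by move=> cf; rewrite diff_lin. Qed.

(** Product rule for a differential whose base point and direction both move: a second derivative of
    [f] accounts for the point, the differential itself for the direction. The later identities come
    from applying it to an already differentiated law. *)
Lemma diff_apply E E' F (f : E -> F) (h : E' -> E) (w : E' -> E) p y :
  finite_coords E ->
  smooth_near f (h p) -> smooth_near h p -> smooth_near w p ->
  'd (fun u => 'd f (h u) (w u)) p y =
  d2 f (h p) ('d h p y) (w p) + 'd f (h p) ('d w p y).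
Proof.
move=> fE cf ch cw.
have dK := smooth_near_differentiable (smooth_near_diff_joint (w p) fE cf).
have dh := smooth_near_differentiable ch.
have dw := smooth_near_differentiable cw.
have dp := differentiable_pair dh dw.
rewrite (@diff_compE _ _ _ (fun u => (h u, w u))
  (fun q : E * E => 'd f (q.1) (q.2))) //.
rewrite diff_pairE // diff_partial //=; congr (_ + _).
rewrite diff_linear_eq //; apply: diff_continuous.
exact: smooth_near_differentiable.
Qed.

Lemma smooth_near_apply E E' F (f : E -> F) (h : E' -> E) (w : E' -> E) p :
  finite_coords E ->
  smooth_near f (h p) -> smooth_near h p -> smooth_near w p ->
  smooth_near (fun u => 'd f (h u) (w u)) p.
Proof.
move=> fE cf ch cw.
apply: (@smooth_near_comp _ _ _ _ (fun u => (h u, w u))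
  (fun q : E * E => 'd f (q.1) (q.2))).
- exact: finite_coords_prod.
- exact: smooth_near_pair.
- exact: smooth_near_diff_joint.
Qed.

(* The second difference of [f] over the parallelogram spanned by [X], [Y]
   is, by the mean value theorem applied twice, a value of [d2 f]. *)
Lemma second_difference E (f : E -> R^o) p r (X Y : E) :
  (forall q, `|q - p| < r -> smooth_near f q) -> `|X| + `|Y| < r ->
  exists2 q, `|q - p| <= `|X| + `|Y| &
    f (p + X + Y) - f (p + X) - (f (p + Y) - f p) = d2 f q Y X.
Proof.
move=> cf XY.
have ball_in (s t : R) : 0 <= s <= 1 -> 0 <= t <= 1 ->
    `|p + s *: X + t *: Y - p| <= `|X| + `|Y|.
  move=> /andP[s0 s1] /andP[t0 t1].
  rewrite addrC addrA addKr; apply: le_trans (ler_normD _ _) _.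
  by rewrite lerD // normrZ ger0_norm // ler_piMl.
have df (s t : R) : 0 <= s <= 1 -> 0 <= t <= 1 ->
    smooth_near f (p + s *: X + t *: Y).
  by move=> s01 t01; apply: cf; apply: le_lt_trans XY; exact: ball_in.
have i0 : 0 <= (0 : R) <= 1 by rewrite lexx ler01.
have i1 : 0 <= (1 : R) <= 1 by rewrite lexx ler01.
pose g (q : E) : R^o := f (q + Y) - f q.
have dshift q : is_diff q (fun q : E => q + Y) id.
  by apply: is_diff_eq; apply/funext => t; rewrite /= -[RHS]addr0.
have dg s : 0 <= s <= 1 -> differentiable g (p + s *: X) /\
   'd g (p + s *: X) X = 'd f (p + s *: X + Y) X - 'd f (p + s *: X) X.
  move=> s01; have [d1 e1] := dshift (p + s *: X).
  have d2 : differentiable f (p + s *: X + Y).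
    by have := smooth_near_differentiable (df s 1 s01 i1); rewrite scale1r.
  have d3 : differentiable f (p + s *: X).
    by have := smooth_near_differentiable (df s 0 s01 i0); rewrite scale0r addr0.
  have d4 : differentiable (fun q => f (q + Y)) (p + s *: X).
    exact: (differentiable_comp d1 d2).
  split; first exact: differentiableB.
  apply: etrans (congr1 (@^~ X) (diffB d4 d3)) _.
  have <- : 'd (fun q => f (q + Y)) (p + s *: X) X = 'd f (p + s *: X + Y) X.
    by rewrite (diff_compE _ d1 d2) e1.
  by [].
have [s /andP[s0 s1] es] := mvt_line (fun s s01 => (dg s s01).1).
have s01 : 0 <= s <= 1 by rewrite !ltW.
have [|t /andP[t0 t1] et] :=
  @mvt_line _ (fun q => 'd f q X) (p + s *: X) Y.
  move=> t t01; apply: smooth_near_differentiable; apply: smooth_near_diff.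
  exact: df.
have t01 : 0 <= t <= 1 by rewrite !ltW.
exists (p + s *: X + t *: Y); first exact: ball_in.
rewrite /d2 -et -(dg s s01).2 -es /g.
by [].
Qed.

(** The second difference over a parallelogram does not depend on the order of its sides. For sides
    [s *: x] and [s *: y] it is [s * s] times a value of [d2 f] in either order, at two points near
    [p]; dividing by [s * s] and using continuity at [p] gives the symmetry. *)
Lemma d2_sym_scalar E (f : E -> R^o) p x y :
  smooth_near f p -> d2 f p x y = d2 f p y x.
Proof.
move=> cf; apply/eqP; rewrite -subr_eq0 -normr_le0; apply/ler_addgt0Pl => e e0.
rewrite addr0.
have e2 : 0 < e / 2 by rewrite divr_gt0.
have cont v w : \forall q \near p, `|d2 f q v w - d2 f p v w| < e / 2.
  have /smooth_near_continuous := smooth_near_diff v (smooth_near_diff w cf).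
  move=> /cvgr_dist_lt /(_ _ e2); apply: filterS => q.
  by rewrite distrC.
have : nbhs p ([set q | smooth_near f q] `&`
    ([set q | `|d2 f q x y - d2 f p x y| < e / 2] `&`
     [set q | `|d2 f q y x - d2 f p y x| < e / 2])).
  exact: filterI (smooth_near_nbhs cf) (filterI (cont x y) (cont y x)).
move=> /nbhs_normP[r /= r0 hr].
(* Scaling by [s] puts the parallelogram inside the ball of radius [r]; the summand 1 keeps [M]
   positive when both vectors vanish. *)
pose M := `|x| + `|y| + 1.
have M0 : 0 < M by rewrite ltr_wpDl // addr_ge0.
pose s := r / 2 / M.
have s0 : 0 < s by rewrite !divr_gt0.
have sM : s * M < r.
  by rewrite /s divfK ?gt_eqF // ltr_pdivrMr // ltr_pMr // ltr1n.
clearbody s.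
have sxy : `|s *: x| + `|s *: y| < r.
  rewrite !normrZ ger0_norm; last exact: ltW.
  rewrite -mulrDr.
  by apply: le_lt_trans sM; rewrite ler_pM2l // lerDl.
have inb q : `|q - p| < r -> ball_ Num.norm p r q by rewrite /= distrC.
have cfr q : `|q - p| < r -> smooth_near f q by move=> /inb/hr[].
have [q1 q1r e1] := second_difference cfr sxy.
have syx : `|s *: y| + `|s *: x| < r by rewrite addrC.
have [q2 q2r e2'] := second_difference cfr syx.
have scal q v w : smooth_near f q -> d2 f q (s *: v) (s *: w) = s * s * d2 f q v w.
  move=> cq; rewrite /d2.
  have -> : (fun u => 'd f u (s *: w)) = (fun u => s *: 'd f u w).
    by apply/funext => u; rewrite linearZ.
  rewrite diffZ; last exact/smooth_near_differentiable/smooth_near_diff.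
  by rewrite linearZ -mulrA.
have q1b := inb _ (le_lt_trans q1r sxy); have q2b := inb _ (le_lt_trans q2r syx).
have [c1 [_ h1]] := hr _ q1b; have [c2 [h2 _]] := hr _ q2b.
have eq12 : d2 f q1 y x = d2 f q2 x y.
  have : s * s * d2 f q1 y x = s * s * d2 f q2 x y.
    rewrite -!scal // -e1 -e2' (addrAC p) !opprB -!addrA; congr (_ + _).
    by rewrite addrA addrAC [RHS]addrA [RHS]addrAC; congr (_ + _); exact: addrC.
  by apply: mulfI; rewrite mulf_neq0 // gt_eqF.
rewrite (_ : _ - _ = (d2 f p x y - d2 f q2 x y) + (d2 f q1 y x - d2 f p y x)).
  apply: le_trans (ler_normD _ _) _; rewrite distrC [e]splitr.
  by rewrite lerD // ltW.
by rewrite eq12 addrA subrK.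
Qed.

(** Continuous linear functionals commute with [d2], so the scalar case applies to each
    coordinate. *)
Lemma d2_sym E F (f : E -> F) p x y : finite_coords F ->
  smooth_near f p -> d2 f p x y = d2 f p y x.
Proof.
move=> [m [b [phi [cphi eb]]]] cf.
have key v w i : phi i (d2 f p v w) = d2 (fun q => phi i (f q)) p v w.
  have dphi q : differentiable (phi i) q by exact: linear_differentiable.
  have e : \forall u \near p, phi i ('d f u w) = 'd (fun q => phi i (f q)) u w.
    have := smooth_near_nbhs cf; apply: filterS => u.
    move/smooth_near_differentiable => du.
    by rewrite (diff_compE _ du (dphi _)) diff_linear_eq.
  have c1 : smooth_near (fun u => 'd f u w) p by exact: smooth_near_diff.
  rewrite /d2.
  have d1 := smooth_near_differentiable c1.
  have := @diff_compE _ _ _ _ (phi i) p v d1 (dphi _).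
  rewrite diff_linear_eq // => <-.
  have dd := differentiable_comp d1 (dphi _).
  by rewrite (near_eq_diff e dd).2.
rewrite (eb (d2 f p x y)) (eb (d2 f p y x)); apply: eq_bigr => i _; congr (_ *: _).
rewrite !key; apply: d2_sym_scalar.
have [U [oU Up cU]] := cf; exists U; split=> // k.
by apply: (class_C_linear_comp (cphi i) oU); exact: cU.
Qed.

Definition rV_coord_fun n (i : 'I_n) (w : 'rV[R]_n) : R^o := w 0 i.

Lemma rV_coord_linear n (i : 'I_n) : linear (rV_coord_fun i).
Proof. by move=> a u v; rewrite /rV_coord_fun !mxE. Qed.

HB.instance Definition _ n (i : 'I_n) :=
  GRing.isLinear.Build R 'rV[R]_n R^o _ (rV_coord_fun i) (rV_coord_linear i).

Definition rV_coord n (i : 'I_n) : {linear 'rV[R]_n -> R^o} := rV_coord_fun i.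

Lemma rV_coord_continuous n (i : 'I_n) : continuous (rV_coord i).
Proof. exact: coord_continuous. Qed.

Lemma rV_norm_le n (w : 'rV[R]_n) (c : R) :
  0 <= c -> (forall i, `|w 0 i| <= c) -> `|w| <= c.
Proof.
move=> c0 h; rewrite [leLHS]/Num.Def.normr /= mx_normrE.
by apply/bigmax_leP; split=> //= -[i j] _ /=; rewrite ord1.
Qed.

Lemma rV_coord_le n (w : 'rV[R]_n) i : `|w 0 i| <= `|w|.
Proof.
rewrite [leRHS]/Num.Def.normr /= mx_normrE.
by apply: (le_bigmax _ (fun ij => `|w ij.1 ij.2|) (0, i)).
Qed.

Lemma diff_coordE E n (f : E -> 'rV[R]_n) x v i : differentiable f x ->
  'd (fun y => f y 0 i : R^o) x v = 'd f x v 0 i.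
Proof.
move=> df; have dl : differentiable (rV_coord i) (f x).
  by apply: linear_differentiable; exact: rV_coord_continuous.
rewrite (@diff_compE _ _ _ _ (rV_coord i)) // diff_linear_eq //.
exact: rV_coord_continuous.
Qed.

Lemma smooth_near_coord E n (f : E -> 'rV[R]_n) p i :
  smooth_near f p -> smooth_near (fun y => f y 0 i : R^o) p.
Proof.
move=> [U [oU Up cU]]; exists U; split=> // k.
by apply: (class_C_linear_comp (@rV_coord_continuous n i) oU); exact: cU.
Qed.

(** Continuity of the differential in operator norm follows from its continuity along the finitely
    many directions [b i], because the coordinates are Lipschitz. The constant [K] dominates the sum
    of their Lipschitz constants and is made positive by the summand 1. *)
Lemma diff_near_le E (f : E -> R^o) p e : finite_coords E ->
  smooth_near f p -> 0 < e ->
  \forall q \near p, forall w, `|'d f q w - 'd f p w| <= e * `|w|.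
Proof.
move=> [m [b [phi [cphi eb]]]] cf e0.
have /choice[k hk] : forall i, exists k : R, 0 < k /\ forall w, `|phi i w| <= k * `|w|.
  by move=> i; have [k k0 hk] := linear_lipschitz (cphi i); exists k.
pose K := \sum_i k i + 1.
have sk0 : 0 <= \sum_i k i by apply: sumr_ge0 => i _; exact: ltW (hk i).1.
have K0 : 0 < K by rewrite ltr_wpDl.
have eK : 0 < e / K by rewrite divr_gt0.
have : \forall q \near p, forall i, `|'d f q (b i) - 'd f p (b i)| < e / K.
  apply: filter_forall => i.
  have /smooth_near_continuous := smooth_near_diff (b i) cf.
  by move=> /cvgr_dist_lt /(_ _ eK); apply: filterS => q; rewrite distrC.
apply: filterS => q hq w.
rewrite !(diff_coords f _ (eb w)) -sumrB.
apply: le_trans (ler_norm_sum _ _ _) _.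
apply: (@le_trans _ _ (\sum_i k i * `|w| * (e / K))).
  apply: ler_sum => i _; rewrite -scalerBr normrZ.
  by rewrite ler_pM // ?(hk i).2 // ltW.
rewrite -!mulr_suml -mulrA mulrCA mulrC ler_wpM2r // mulrA ler_pdivrMr //.
by rewrite mulrC ler_wpM2l // ?(ltW e0) // lerDl.
Qed.

(** The mean value theorem on the segment from [v] to [u] writes the increment as a differential at
    a point of the ball, and this differential is close to the one at [p]. The bound is uniform in
    both points, which is what turns smooth maps into contractions. *)
Lemma strict_diff_scalar E (f : E -> R^o) p e : finite_coords E ->
  smooth_near f p -> 0 < e ->
  exists2 r, 0 < r & forall u v, `|u - p| < r -> `|v - p| < r ->
    `|f u - f v - 'd f p (u - v)| <= e * `|u - v|.
Proof.
move=> fE cf e0.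
have : nbhs p ([set q | smooth_near f q] `&`
    [set q | forall w, `|'d f q w - 'd f p w| <= e * `|w|]).
  exact: filterI (smooth_near_nbhs cf) (diff_near_le fE cf e0).
move=> /nbhs_normP[r /= r0 hr]; exists r => // u v up vp.
have conv s : 0 <= s <= 1 -> ball_ Num.norm p r (v + s *: (u - v)).
  move=> /andP[s0 s1]; rewrite /= distrC.
  have -> : v + s *: (u - v) - p = (1 - s) *: (v - p) + s *: (u - p).
    have -> : u - v = (u - p) - (v - p) by rewrite opprB addrA subrK.
    rewrite scalerBr scalerBl scale1r addrAC -[RHS]addrA; congr (_ + _).
    by rewrite addrC.
  apply: le_lt_trans (ler_normD _ _) _; rewrite !normrZ (ger0_norm s0).
  rewrite ger0_norm ?subr_ge0 //.
  (* The strict inequality comes from the term in [u], which vanishes at [s = 0]. *)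
  have [->|s0'] := eqVneq s 0; first by rewrite mul0r addr0 subr0 mul1r.
  rewrite (_ : r = (1 - s) * r + s * r); last by rewrite -mulrDl subrK mul1r.
  apply: ler_ltD; first by rewrite ler_wpM2l ?subr_ge0 // ltW.
  by rewrite ltr_pM2l // lt_neqAle eq_sym s0' s0.
have [|s /andP[s0 s1] es] := @mvt_line _ f v (u - v).
  by move=> s /conv/hr[/smooth_near_differentiable].
rewrite subrKC in es; rewrite es.
have s01 : 0 <= s <= 1 by rewrite !ltW.
by have [_] := hr _ (conv s s01); exact.
Qed.

Lemma strict_diff E n (f : E -> 'rV[R]_n) p e : finite_coords E ->
  smooth_near f p -> 0 < e ->
  exists2 r, 0 < r & forall u v, `|u - p| < r -> `|v - p| < r ->
    `|f u - f v - 'd f p (u - v)| <= e * `|u - v|.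
Proof.
move=> fE cf e0.
have h i : \forall r \near 0^'+, forall u v, `|u - p| < r -> `|v - p| < r ->
    `|(f u - f v - 'd f p (u - v)) 0 i| <= e * `|u - v|.
  have [r r0 hr] := strict_diff_scalar fE (smooth_near_coord i cf) e0.
  near=> t => u v ut vt.
  have tr : t <= r by near: t; exact: nbhs_right_le.
  rewrite !mxE -(diff_coordE (u - v) i (smooth_near_differentiable cf)).
  by apply: hr; [exact: lt_le_trans tr|exact: lt_le_trans tr].
have H : \forall r \near (0 : R)^'+, forall i u v, `|u - p| < r ->
    `|v - p| < r -> `|(f u - f v - 'd f p (u - v)) 0 i| <= e * `|u - v|.
  exact: filter_forall.
have : \forall r \near (0:R)^'+, 0 < r /\ forall i u v, `|u - p| < r -> `|v - p| < r ->
    `|(f u - f v - 'd f p (u - v)) 0 i| <= e * `|u - v|.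
  by near=> r; split; [near: r; exact: nbhs_right_gt|near: r].
move=> /filter_ex[r [r0 hr]]; exists r => // u v ur vr.
by apply: rV_norm_le => [|i]; [rewrite mulr_ge0 // ltW|exact: hr].
Unshelve. all: by end_near. Qed.

Lemma diff_of_bound E F (f : E -> F) (l : {linear E -> F}) p : continuous l ->
  (forall eps, 0 < eps -> exists2 r, 0 < r &
     forall u, `|u - p| < r -> `|f u - f p - l (u - p)| <= eps * `|u - p|) ->
  differentiable f p /\ forall x, 'd f p x = l x.
Proof.
move=> cl h; have o : f \o shift p = cst (f p) + l +o_ 0 id.
  apply/eqaddoP => _/posnumP[eps].
  have [r r0 hr] := h eps%:num (gt0 _).
  apply/near_normP; exists r => // u; rewrite subr0 => ur.
  have := hr (u + p); rewrite addrK => /(_ ur).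
  by rewrite -addrA -opprD.
have ed : 'd f p = l :> (E -> F) by exact: diff_unique.
split; last by move=> x; rewrite ed.
by apply/diff_locallyP; rewrite ed.
Qed.

End SecondOrder.

(** * Smooth maps between manifolds *)

Section Manifolds.
Context {R : realType}.
Implicit Types (M N L : topologicalType) (E F H : normedModType R).

Lemma chart_invK M E (c : chart M E) u :
  is_chart c -> cimg c u -> cfun c (cinv c u) = u.
Proof. by move=> [_ _ _ _ cK] [p cp <-]; rewrite cK. Qed.

Lemma chart_inv_dom M E (c : chart M E) u :
  is_chart c -> cimg c u -> cdom c (cinv c u).
Proof. by move=> [_ _ _ _ cK] [p cp <-]; rewrite cK. Qed.

Lemma near_chart_inv M E (c : chart M E) p (P : set M) : is_chart c ->
  cdom c p -> (\forall q \near p, P q) ->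
  \forall u \near cfun c p, P (cinv c u).
Proof.
move=> [_ _ _ ci cK] cp nP; have := ci (cfun c p) (ex_intro2 _ _ p cp erefl).
by rewrite /prop_for /continuous_at cK //; exact.
Qed.

Lemma near_cimg M E (c : chart M E) p : is_chart c -> cdom c p ->
  \forall u \near cfun c p, cimg c u.
Proof. by move=> [_ oi _ _ _] cp; apply: open_nbhs_nbhs; split=> //; exists p. Qed.

Lemma near_cdom M E (c : chart M E) p : is_chart c -> cdom c p ->
  \forall q \near p, cdom c q.
Proof. by move=> [od _ _ _ _] cp; apply: open_nbhs_nbhs. Qed.

Lemma chart_transition_smooth M E (A : set (chart M E)) c d p : is_atlas A ->
  A c -> A d -> cdom c p -> cdom d p ->
  smooth_near (fun u => cfun d (cinv c u)) (cfun c p).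
Proof.
move=> [Ac _ At] cA dA cp dp.
have [oc oi _ ci cK] := Ac c cA; have [od _ _ _ _] := Ac d dA.
apply: (smooth_on_near _ (At c d cA dA)); last by split; [exists p|rewrite cK].
exact: open_preimage_in.
Qed.

(** Pointwise form of [smooth_map]: smoothness can then be proved at [e] and carried to other points
    by translation. *)
Definition smooth_at M N E F (A : set (chart M E)) (B : set (chart N F))
    (f : M -> N) (p : M) : Prop :=
  {for p, continuous f} /\ forall c d, A c -> B d -> cdom c p -> cdom d (f p) ->
    smooth_near (fun u => cfun d (f (cinv c u))) (cfun c p).

Lemma smooth_mapP M N E F (A : set (chart M E)) (B : set (chart N F))
    (f : M -> N) : is_atlas A -> is_atlas B ->
  smooth_map A B f <-> forall p, smooth_at A B f p.
Proof.
move=> [Ac _ _] [Bc _ _]; split=> [[cf sf] p|sf].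
  split; first exact: cf.
  move=> c d cA dB cp dfp.
  have [oc oi _ ci cK] := Ac c cA; have [od _ _ _ _] := Bc d dB.
  apply: (smooth_on_near _ (sf c d cA dB)); last by split; [exists p|rewrite cK].
  apply: (@open_preimage_in _ _ (fun u => f (cinv c u))) => // u /ci ciu.
  by apply: continuous_comp; [exact: ciu|exact: cf].
split=> [p|c d cA dB k]; first by have [] := sf p.
apply: class_C_local => u [cu dfu].
have cch := Ac c cA; have [_ h] := sf (cinv c u).
have [U [oU Uu cU]] := h c d cA dB (chart_inv_dom cch cu) dfu.
by exists U; [rewrite chart_invK in Uu|exact: cU].
Qed.

(** Transition maps carry the expression of [f] from one pair of charts to any other; continuity of
    [f] at [p] keeps nearby values in the domain of [d]. *)
Lemma smooth_at_charts M N E F (A : set (chart M E)) (B : set (chart N F))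
    (f : M -> N) p c d : finite_coords E -> finite_coords F ->
  is_atlas A -> is_atlas B -> A c -> B d ->
  cdom c p -> cdom d (f p) -> {for p, continuous f} ->
  smooth_near (fun u => cfun d (f (cinv c u))) (cfun c p) ->
  smooth_at A B f p.
Proof.
move=> fE fF atA atB cA dB cp dfp cf sf; split=> // c' d' c'A d'B c'p d'fp.
have [Ac _ _] := atA; have [Bc _ _] := atB.
have s1 := chart_transition_smooth atA c'A cA c'p cp.
have s3 := chart_transition_smooth atB dB d'B dfp d'fp.
have [_ _ _ _ c'K] := Ac _ c'A; have [_ _ _ _ cK] := Ac _ cA.
have [_ _ _ _ dK] := Bc _ dB.
have s2 : smooth_near (fun u => cfun d (f (cinv c u))) (cfun c (cinv c' (cfun c' p))).
  by rewrite c'K.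
have s12 := smooth_near_comp fE s1 s2.
have s3' : smooth_near (fun u => cfun d' (cinv d u))
    (cfun d (f (cinv c (cfun c (cinv c' (cfun c' p)))))).
  by rewrite c'K // cK.
have := smooth_near_comp fF s12 s3'; apply: smooth_near_eq.
apply: (near_chart_inv (P := fun q =>
  cfun d' (cinv d (cfun d (f (cinv c (cfun c q))))) = cfun d' (f q))) => //.
  exact: Ac.
have n1 : \forall q \near p, cdom c q by apply: near_cdom cp; exact: Ac.
have n2 : \forall q \near p, cdom d (f q).
  by apply: cf; apply: near_cdom dfp; exact: Bc.
apply: filterS2 n1 n2 => q cq dq.
by rewrite cK // dK.
Qed.

Lemma smooth_at_comp M N L E F H (A : set (chart M E)) (B : set (chart N F))
    (C : set (chart L H)) (f : M -> N) (g : N -> L) p :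
  finite_coords F -> is_atlas A -> is_atlas B ->
  smooth_at A B f p -> smooth_at B C g (f p) ->
  smooth_at A C (fun x => g (f x)) p.
Proof.
move=> fF [Ac _ _] [Bc Bcov _] [cf sf] [cg sg].
split; first by apply: continuous_comp.
move=> c e cA eC cp egp; have [d dB dfp] := Bcov (f p).
have s1 := sf c d cA dB cp dfp; have s2 := sg d e dB eC dfp egp.
have [_ _ _ _ cK] := Ac _ cA; have [_ _ _ _ dK] := Bc _ dB.
have s2' : smooth_near (fun u => cfun e (g (cinv d u))) (cfun d (f (cinv c (cfun c p)))).
  by rewrite cK.
have := smooth_near_comp fF s1 s2'; apply: smooth_near_eq.
apply: (near_chart_inv (P := fun q => cfun e (g (cinv d (cfun d (f q)))) = cfun e (g (f q)))) => //.
  exact: Ac.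
have : \forall q \near p, cdom d (f q) by apply: cf; apply: near_cdom dfp; exact: Bc.
by apply: filterS => q dq; rewrite dK.
Qed.

Lemma smooth_at_id M E (A : set (chart M E)) p : is_atlas A -> smooth_at A A id p.
Proof.
move=> atA; split; first by move=> U.
by move=> c d cA dA cp dp; exact: (chart_transition_smooth atA).
Qed.

Lemma smooth_at_cst M N E F (A : set (chart M E)) (B : set (chart N F)) (a : N) p :
  smooth_at A B (fun=> a) p.
Proof. by split; [exact: cvg_cst|move=> *; exact: smooth_near_cst]. Qed.

Lemma continuous_pair_at M N L (f : M -> N) (g : M -> L) p :
  {for p, continuous f} -> {for p, continuous g} ->
  {for p, continuous (fun x => (f x, g x))}.
Proof. by move=> cf cg; apply: cvg_pair. Qed.

Lemma open_prod_set M N (U : set M) (V : set N) :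
  open U -> open V -> open (U `*` V).
Proof.
move=> oU oV; rewrite (_ : U `*` V = (fst @^-1` U) `&` (snd @^-1` V)) //.
apply: openI; apply: open_comp => // -[p q] _; [exact: cvg_fst|exact: cvg_snd].
Qed.

Lemma prod_chart_is_chart M N E F (c : chart M E) (d : chart N F) :
  is_chart c -> is_chart d ->
  @is_chart R (M * N)%type ((E * F)%type : normedModType R) (prod_chart c d).
Proof.
move=> ch dh; have [oc oic cc ci cK] := ch; have [od oid cd di dK] := dh.
have eimg : cimg (prod_chart c d) = cimg c `*` cimg d.
  apply/seteqP; split=> [[u v] [[p q] [/= cp dq] [<- <-]]|[u v] [/= [p cp <-] [q dq <-]]].
    by split; [exists p|exists q].
  by exists (p, q).
split.
- exact: open_prod_set.
- by rewrite eimg; exact: open_prod_set.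
- move=> [p q] [/= cp dq].
  have h1 : {for (p, q), continuous (fun x : M * N => cfun c x.1)}.
    by apply: (@continuous_comp _ _ _ fst (cfun c)); [exact: cvg_fst|exact: cc].
  have h2 : {for (p, q), continuous (fun x : M * N => cfun d x.2)}.
    by apply: (@continuous_comp _ _ _ snd (cfun d)); [exact: cvg_snd|exact: cd].
  exact: cvg_pair h1 h2.
- rewrite eimg => -[u v] [/= cu dv].
  have h1 : {for (u, v), continuous (fun x : E * F => cinv c x.1)}.
    by apply: (@continuous_comp _ _ _ fst (cinv c)); [exact: cvg_fst|exact: ci].
  have h2 : {for (u, v), continuous (fun x : E * F => cinv d x.2)}.
    by apply: (@continuous_comp _ _ _ snd (cinv d)); [exact: cvg_snd|exact: di].
  exact: cvg_pair h1 h2.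
- by move=> [p q] [/= cp dq]; rewrite cK // dK.
Qed.

Lemma prod_atlas_is_atlas M N E F (A : set (chart M E)) (B : set (chart N F)) :
  finite_coords E -> finite_coords F -> is_atlas A -> is_atlas B ->
  @is_atlas R (M * N)%type ((E * F)%type : normedModType R) (prod_atlas A B).
Proof.
move=> fE fF atA atB; have [Ac Acov At] := atA; have [Bc Bcov Bt] := atB.
split.
- by move=> _ [c cA] [d dB] <-; apply: prod_chart_is_chart; [exact: Ac|exact: Bc].
- move=> [p q]; have [c cA cp] := Acov p; have [d dB dq] := Bcov q.
  by exists (prod_chart c d) => //; exists c => //; exists d.
- move=> _ _ [c cA] [d dB] <- [c' cA'] [d' dB'] <- k.
  apply: class_C_local => -[u v] [[[p q] [/= cp dq] [eu ev]] [/= c'u d'v]].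
  have [_ _ _ _ cK] := Ac _ cA; have [_ _ _ _ dK] := Bc _ dB.
  move: c'u d'v; rewrite -eu -ev cK // dK // => c'p d'q.
  have s1 := chart_transition_smooth atA cA cA' cp c'p.
  have s2 := chart_transition_smooth atB dB dB' dq d'q.
  have s : smooth_near (fun u : E * F =>
      (cfun c' (cinv c u.1), cfun d' (cinv d u.2))) (cfun c p, cfun d q).
    apply: smooth_near_pair.
      by apply: (@smooth_near_comp _ _ _ _ fst (fun u => cfun c' (cinv c u))) => //;
        exact: smooth_near_fst.
    by apply: (@smooth_near_comp _ _ _ _ snd (fun u => cfun d' (cinv d u))) => //;
      exact: smooth_near_snd.
  by have [U [_ Up sU]] := s; exists U; [exact: Up|exact: sU].
Qed.

Lemma smooth_at_pair M N L E F H (A : set (chart M E)) (B : set (chart N F))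
    (C : set (chart L H)) (f : M -> N) (g : M -> L) p :
  smooth_at A B f p -> smooth_at A C g p ->
  @smooth_at _ _ E ((F * H)%type : normedModType R) A (prod_atlas B C)
    (fun x => (f x, g x)) p.
Proof.
move=> [cf sf] [cg sg]; split; first by apply: cvg_pair.
move=> c _ cA [d dB] [e eC] <- cp [/= dfp egp]; apply: smooth_near_pair.
  exact: sf.
exact: sg.
Qed.

Lemma smooth_at_fst M N E F (A : set (chart M E)) (B : set (chart N F)) p :
  finite_coords E -> finite_coords F -> is_atlas A -> is_atlas B ->
  @smooth_at _ _ ((E * F)%type : normedModType R) E (prod_atlas A B) A fst p.
Proof.
move=> fE fF atA atB; split; first exact: cvg_fst.
move=> _ c' [c cA] [d dB] <- cA' [/= cp _] cp'.
apply: (@smooth_near_comp _ _ _ _ fst (fun u => cfun c' (cinv c u))) => //.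
  exact: smooth_near_fst.
exact: (chart_transition_smooth atA).
Qed.

Lemma smooth_at_snd M N E F (A : set (chart M E)) (B : set (chart N F)) p :
  finite_coords E -> finite_coords F -> is_atlas A -> is_atlas B ->
  @smooth_at _ _ ((E * F)%type : normedModType R) F (prod_atlas A B) B snd p.
Proof.
move=> fE fF atA atB; split; first exact: cvg_snd.
move=> _ c' [c cA] [d dB] <- cB' [/= _ dp] dp'.
apply: (@smooth_near_comp _ _ _ _ snd (fun u => cfun c' (cinv d u))) => //.
  exact: smooth_near_snd.
exact: (chart_transition_smooth atB).
Qed.

Lemma line_atlas_is_atlas : is_atlas (@line_atlas R).
Proof.
have e : @cimg R^o R^o (Chart setT id id) = setT.
  by apply/seteqP; split=> // x _; exists x.
split.
- move=> c ->; split; rewrite ?e //=.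
  + exact: openT.
  + exact: openT.
  + by move=> p _ U.
  + by move=> p _ U.
- by move=> p; exists (Chart setT id id).
- move=> c d -> -> k; apply: class_C_local => u _; exists setT => //.
  by apply: (@class_C_linear _ _ _ _ _ idfun) => x.
Qed.

Lemma smooth_at_comp2 M N1 N2 L E F1 F2 H (A : set (chart M E))
    (B1 : set (chart N1 F1)) (B2 : set (chart N2 F2)) (C : set (chart L H))
    (f : M -> N1) (g : M -> N2) (h : N1 -> N2 -> L) p :
  finite_coords F1 -> finite_coords F2 ->
  is_atlas A -> is_atlas B1 -> is_atlas B2 -> is_atlas C ->
  smooth_at A B1 f p -> smooth_at A B2 g p ->
  @smooth_map R _ _ ((F1 * F2)%type : normedModType R) H (prod_atlas B1 B2) C
    (fun q => h q.1 q.2) ->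
  smooth_at A C (fun x => h (f x) (g x)) p.
Proof.
move=> f1 f2 atA at1 at2 atC sf sg sh.
have atP := prod_atlas_is_atlas f1 f2 at1 at2.
apply: (@smooth_at_comp _ _ _ _ ((F1 * F2)%type : normedModType R) _ _ _ _
  (fun x => (f x, g x)) (fun q => h q.1 q.2)) (atA) (atP) _ _.
- exact: finite_coords_prod.
- exact: smooth_at_pair.
- exact: (smooth_mapP _ atP atC).1.
Qed.

End Manifolds.

(** * Smoothness of the inverse of a group law *)

Section FixedPoint.
Context {R : realType}.

Lemma le0_geometric (x C : R) : (forall k : nat, x <= C / 2 ^+ k) -> x <= 0.
Proof.
move=> h; rewrite leNgt; apply/negP => x0.
have C0 : 0 <= C by have := h 0%N; rewrite expr0 divr1; exact: le_trans (ltW x0).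
pose k := Num.bound (C / x).
have kC : C / x < k%:R by apply: archi_boundP; rewrite divr_ge0 // ltW.
have k2 : (k%:R : R) < 2 ^+ k by rewrite -natrX ltr_nat ltn_expl.
have := h k; rewrite leNgt => /negP; apply.
rewrite ltr_pdivrMr ?exprn_gt0 // mulrC -ltr_pdivrMr //.
exact: lt_trans k2.
Qed.

(** The radius [2 * C / 2 ^+ k] is the tail of the geometric series from [k] on, so the intervals of
    that radius around the [a k] are nested. The limit is the supremum of their lower ends, and the
    rate of convergence is explicit. *)
Lemma geometric_cauchy (a : nat -> R) (C : R) :
  (forall k, `|a k.+1 - a k| <= C / 2 ^+ k) ->
  exists l, forall k, `|a k - l| <= 2 * C / 2 ^+ k.
Proof.
move=> h; pose d k : R := 2 * C / 2 ^+ k.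
have C0 : 0 <= C by have := h 0%N; rewrite expr0 divr1; exact: le_trans.
have dS k : d k.+1 = d k - C / 2 ^+ k.
  rewrite /d exprS invfM mulrA -[2 * C * _]mulrA (mulrC C) mulrA divff ?mul1r //.
  by rewrite mulrDl mul1r mulrDl addrK.
have step k : a k - d k <= a k.+1 - d k.+1 /\ a k.+1 + d k.+1 <= a k + d k.
  have := h k; rewrite ler_norml => /andP[h1 h2]; rewrite dS; split.
    by lra.
  by lra.
have lo j k : a j - d j <= a (j + k)%N - d (j + k)%N.
  elim: k => [|k IH]; first by rewrite addn0.
  by rewrite addnS; apply: le_trans IH (step _).1.
have hi j k : a (j + k)%N + d (j + k)%N <= a j + d j.
  elim: k => [|k IH]; first by rewrite addn0.
  by rewrite addnS; apply: le_trans (step _).2 IH.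
have d0 k : 0 <= d k by rewrite divr_ge0 ?mulr_ge0 ?exprn_ge0.
have cross j k : a j - d j <= a k + d k.
  have mid i : a i - d i <= a i + d i.
    by rewrite lerBlDr -addrA lerDl addr_ge0.
  have [jk|/ltnW kj] := leqP j k.
    by have := lo j (k - j)%N; rewrite subnKC // => /le_trans; apply.
  by have := hi k (j - k)%N; rewrite subnKC //; apply: le_trans.
pose S := [set a j - d j | j in [set: nat]].
have supS : has_sup S.
  split; first by exists (a 0%N - d 0%N), 0%N.
  by exists (a 0%N + d 0%N) => _ [j _ <-].
exists (sup S) => k; rewrite ler_norml; apply/andP; split.
  rewrite lerNl opprB lerBlDr; apply: ge_sup; first by case: supS.
  by move=> _ [j _ <-]; have := cross j k; rewrite /d; lra.
rewrite lerBlDr -lerBlDl; apply: ub_le_sup; first by case: supS.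
by exists k.
Qed.

Lemma geometric_cauchy_rV n (a : nat -> 'rV[R]_n) (C : R) :
  (forall k, `|a k.+1 - a k| <= C / 2 ^+ k) ->
  exists l, forall k, `|a k - l| <= 2 * C / 2 ^+ k.
Proof.
move=> h.
have C0 : 0 <= C by have := h 0%N; rewrite expr0 divr1; exact: le_trans.
have /choice[l hl] : forall i, exists l, forall k, `|a k 0 i - l| <= 2 * C / 2 ^+ k.
  move=> i; apply: geometric_cauchy => k; apply: le_trans (h k).
  by apply: le_trans (rV_coord_le _ i); rewrite !mxE.
exists (\row_i l i) => k; apply: rV_norm_le => [|i].
  by rewrite divr_ge0 ?mulr_ge0 ?exprn_ge0.
by rewrite !mxE.
Qed.

(** [T] is only known to contract on a ball that it need not preserve. The iterates from [p] stay
    inside because their distances to [p] are bounded by partial sums of a geometric series of total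
    [2 * D]. *)
Lemma half_contraction_fixpoint n (T : 'rV[R]_n -> 'rV[R]_n) p r :
  (forall b b', `|b - p| <= r -> `|b' - p| <= r ->
     `|T b - T b'| <= `|b - b'| / 2) ->
  2 * `|T p - p| <= r ->
  exists2 b, `|b - p| <= 2 * `|T p - p| & T b = b.
Proof.
move=> cT Tp; pose D := `|T p - p|; pose a k := iter k T p.
have D0 : 0 <= D by exact: normr_ge0.
have r0 : 0 <= r by apply: le_trans Tp; rewrite mulr_ge0.
have key k : `|a k - p| <= 2 * D - 2 * D / 2 ^+ k /\
    `|a k.+1 - a k| <= D / 2 ^+ k.
  elim: k => [|k [IH1 IH2]].
    by rewrite /a /= subrr normr0 expr0 !divr1 subrr.
  have h1 : `|a k.+1 - p| <= 2 * D - 2 * D / 2 ^+ k.+1.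
    have -> : a k.+1 - p = (a k.+1 - a k) + (a k - p) by rewrite addrA subrK.
    apply: le_trans (ler_normD _ _) _; apply: le_trans (lerD IH2 IH1) _.
    by rewrite exprS invfM; lra.
  have small j : 2 * D - 2 * D / 2 ^+ j <= r.
    apply: le_trans Tp; rewrite lerBlDr lerDl.
    by rewrite divr_ge0 ?mulr_ge0 ?exprn_ge0.
  split=> //.
  have /le_trans := cT (a k.+1) (a k) (le_trans h1 (small _)) (le_trans IH1 (small _)).
  by apply; rewrite exprS invfM; lra.
have [l hl] := geometric_cauchy_rV (fun k => (key k).2).
have lp : `|l - p| <= 2 * D.
  by have := hl 0%N; rewrite expr0 divr1 distrC.
exists l => //; apply/eqP; rewrite -subr_eq0 -normr_le0.
apply: (@le0_geometric _ (2 * D)) => k.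
have -> : T l - l = (T l - T (a k)) + (a k.+1 - l) by rewrite addrA subrK.
apply: le_trans (ler_normD _ _) _.
have small : 2 * D - 2 * D / 2 ^+ k <= r.
  apply: le_trans Tp; rewrite lerBlDr lerDl.
  by rewrite divr_ge0 ?mulr_ge0 ?exprn_ge0.
have h1 : `|T l - T (a k)| <= D / 2 ^+ k.
  apply: le_trans (cT _ _ _ _) _.
  - exact: le_trans lp Tp.
  - exact: le_trans (key k).1 small.
  rewrite distrC ler_pdivrMr //; apply: le_trans (hl k) _.
  by rewrite -mulrA mulrC.
have h2 : `|a k.+1 - l| <= D / 2 ^+ k.
  apply: le_trans (hl k.+1) _; rewrite exprS invfM mulrA.
  by rewrite -[2 * D * _]mulrA (mulrC D) mulrA divff // mul1r.
by rewrite mulrDl mul1r mulrDl; exact: lerD.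
Qed.

End FixedPoint.

(** * Identities in an abstract group *)

Section Group.
Context {G : Type} {mul : G -> G -> G} {e : G} {inv : G -> G}.
Context (grp : is_group mul e inv).

Lemma group_mulA : associative mul. Proof. by case: grp. Qed.
Lemma group_mul1 x : mul e x = x. Proof. by case: grp. Qed.
Lemma group_mule x : mul x e = x. Proof. by case: grp. Qed.
Lemma group_mulV x : mul (inv x) x = e. Proof. by case: grp. Qed.
Lemma group_mulxV x : mul x (inv x) = e. Proof. by case: grp. Qed.

Lemma group_inv_unique x y : mul x y = e -> y = inv x.
Proof. by move=> h; rewrite -[y]group_mul1 -(group_mulV x) -group_mulA h group_mule. Qed.

Lemma group_invK x : inv (inv x) = x.
Proof. by apply/esym/group_inv_unique; rewrite group_mulV. Qed.

Lemma group_invM x y : inv (mul x y) = mul (inv y) (inv x).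
Proof.
apply/esym/group_inv_unique.
by rewrite -group_mulA (group_mulA y) group_mulxV group_mul1 group_mulxV.
Qed.

Lemma group_inv1 : inv e = e.
Proof. by apply/esym/group_inv_unique; rewrite group_mul1. Qed.

(** Expresses inversion near [a] through inversion near [e]: when [x] is close to [a], the element
    [mul (inv a) x] is close to [e]. *)
Lemma group_translate x a : inv x = mul (inv (mul (inv a) x)) (inv a).
Proof. by rewrite group_invM group_invK -group_mulA group_mulxV group_mule. Qed.

End Group.

Definition local_op (R : realType) n (G : Type) (c : chart G 'rV[R]_n)
    (op : G -> G -> G) : 'rV[R]_n * 'rV[R]_n -> 'rV[R]_n :=
  fun q => cfun c (op (cinv c q.1) (cinv c q.2)).

(** * Binary operations read in a chart *)

Section LocalOperation.
Context {R : realType} {n : nat} {G : topologicalType}.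
Context {A : set (chart G 'rV[R]_n)} (c : chart G 'rV[R]_n).
Context (atA : is_atlas A) (cA : A c).
Local Notation E := 'rV[R]_n.
Let fE := @finite_coords_rV R n.
Let fEE := finite_coords_prod fE fE.

Lemma atlas_chart : is_chart c.
Proof. by have [h _ _] := atA; exact: h. Qed.

Lemma chartK p : cdom c p -> cinv c (cfun c p) = p.
Proof. by have [_ _ _ _ h] := atlas_chart; exact: h. Qed.

Lemma smooth_local_op (op : G -> G -> G) a b :
  smooth_map (prod_atlas A A) A (fun p => op p.1 p.2) ->
  cdom c a -> cdom c b -> cdom c (op a b) ->
  smooth_near (local_op c op) (cfun c a, cfun c b).
Proof.
move=> sop ca cb cab.
have atP := prod_atlas_is_atlas fE fE atA atA.
have [_ h] := (smooth_mapP _ atP atA).1 sop (a, b).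
apply: (h (prod_chart c c) c) => //.
by exists c => //; exists c.
Qed.

Lemma near_local_op (op : G -> G -> G) a b :
  smooth_map (prod_atlas A A) A (fun p => op p.1 p.2) ->
  cdom c a -> cdom c b -> cdom c (op a b) ->
  \forall q \near (cfun c a, cfun c b),
    [/\ cimg c q.1, cimg c q.2 & cdom c (op (cinv c q.1) (cinv c q.2))].
Proof.
move=> [cop _] ca cb cab.
have ch2 := prod_chart_is_chart atlas_chart atlas_chart.
have ab : cdom (prod_chart c c) (a, b) by [].
have h1 := near_cimg ch2 ab.
have h2 : \forall p \near (a, b), cdom c (op p.1 p.2).
  by apply: cop; exact: near_cdom atlas_chart cab.
have h3 := near_chart_inv ch2 ab h2.
apply: filterS2 h1 h3 => -[u v] [[p q] [/= cp cq] [<- <-]] /= h.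
by split=> //; [exists p|exists q].
Qed.

End LocalOperation.

(** * Regularity of inversion, from the smoothness of the law alone *)

Section SmoothInverse.
Context {R : realType} {n : nat} {G : topologicalType}.
Context {A : set (chart G 'rV[R]_n)} {mul : G -> G -> G} {e : G} {inv : G -> G}.
Context (atA : is_atlas A) (grp : is_group mul e inv).
Context (smul : smooth_map (prod_atlas A A) A (fun p => mul p.1 p.2)).
Local Notation E := 'rV[R]_n.
Let fE := @finite_coords_rV R n.
Let fEE := finite_coords_prod fE fE.
Let atP := prod_atlas_is_atlas fE fE atA atA.

Context (c : chart G 'rV[R]_n) (cA : A c) (ce : cdom c e).
Let p0 := cfun c e.
Let m := local_op c mul.
Definition chart_inv (u : E) : E := cfun c (inv (cinv c u)).
Let sigma := chart_inv.

Let cinv0 : cinv c p0 = e. Proof. exact: (chartK atA). Qed.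

Let cee : cdom c (mul e e). Proof. by rewrite (group_mul1 grp). Qed.

Lemma smooth_law : smooth_near m (p0, p0).
Proof. exact: (smooth_local_op atA). Qed.

Lemma law_right0 u : cimg c u -> m (u, p0) = u.
Proof.
by move=> cu; rewrite /m /local_op /= cinv0 (group_mule grp) chart_invK //;
  exact: (atlas_chart atA).
Qed.

Lemma law_left0 u : cimg c u -> m (p0, u) = u.
Proof.
by move=> cu; rewrite /m /local_op /= cinv0 (group_mul1 grp) chart_invK //;
  exact: (atlas_chart atA).
Qed.

Lemma near_cimg0 : \forall u \near p0, cimg c u.
Proof. exact: near_cimg (atlas_chart atA cA) ce. Qed.

(** With one slot frozen at the unit the law is the identity near [p0], so both partial
    differentials are the identity. *)
Lemma diff_law x y : 'd m (p0, p0) (x, y) = x + y.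
Proof.
rewrite diff_partial; last exact: smooth_near_differentiable smooth_law.
have h1 : \forall u \near p0, id u = m (u, p0).
  by apply: filterS near_cimg0 => u cu; rewrite law_right0.
have h2 : \forall u \near p0, id u = m (p0, u).
  by apply: filterS near_cimg0 => u cu; rewrite law_left0.
have [d0 e0] := is_diff_id p0.
congr (_ + _).
  exact: etrans (congr1 (@^~ x) (near_eq_diff h1 d0).2) (congr1 (@^~ x) e0).
exact: etrans (congr1 (@^~ y) (near_eq_diff h2 d0).2) (congr1 (@^~ y) e0).
Qed.

Lemma chart_inv0 : sigma p0 = p0.
Proof. by rewrite /sigma /chart_inv cinv0 (group_inv1 grp). Qed.

(* For [u] near [p0] the equation [m (u, b) = p0] is solved by iterating
   [b |-> b - (m (u, b) - p0)]. *)
Lemma chart_inv_bound : \forall u \near p0,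
  [/\ `|sigma u - p0| <= 2 * `|u - p0|, m (u, sigma u) = p0 & cdom c (inv (cinv c u))].
Proof.
(* Since [m] has differential [x + y] at [(p0, p0)], the difference of two values of
   [b - (m (u, b) - p0)] is minus the error term of strict differentiability. Taking the error
   factor 1/2 makes this map a contraction by one half. *)
have half : 0 < (2^-1 : R) by rewrite invr_gt0.
have [r r0 hr] := strict_diff fEE smooth_law half.
have /near_normP[r1 r10 hr1] := near_cimg0.
have /near_normP[r2 r20 hr2] := near_local_op atA cA smul ce ce cee.
pose s := Num.min r (Num.min r1 r2).
have s0 : 0 < s by rewrite !lt_min r0 r10 r20.
(* The map moves [p0] by [u - p0], so the fixed point lies within [2 * |u - p0|] of [p0]; the radius
   [s / 4] keeps it within [s / 2]. *)
have s4 : 0 < s / 4 by rewrite divr_gt0.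
apply/near_normP; exists (s / 4) => // u us.
have su : `|u - p0| < s by apply: lt_trans us _; rewrite ltr_pdivrMr // ltr_pMr // ltr1n.
have cu : cimg c u.
  by apply: hr1; apply: lt_le_trans su _; rewrite !ge_min lexx orbT.
pose T b := b - (m (u, b) - p0).
have Tp0 : `|T p0 - p0| = `|u - p0|.
  by rewrite /T law_right0 // opprB addrCA addrAC subrr add0r -normrN opprB.
have lt_s b : `|b - p0| <= s / 2 -> `|b - p0| < s.
  by move/le_lt_trans; apply; rewrite ltr_pdivrMr // ltr_pMr // ltr1n.
have sr x : x < s -> x < r by move=> h; apply: lt_le_trans h _; rewrite ge_min lexx.
have [||b bp Tb] := @half_contraction_fixpoint _ _ T p0 (s / 2).
- move=> b b' /lt_s hb /lt_s hb'.
  have hq x : `|x - p0| < s -> _ :=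
    fun h => @norm_pair_lt _ _ _ (u, x) (p0, p0) r (sr _ su) (sr _ h).
  have := hr (u, b) (u, b') (hq _ hb) (hq _ hb').
  rewrite pair_subl diff_law add0r norm_pair0 //= mulrC.
  rewrite -normrN; congr (_ <= _); congr (`| _ |).
  by apply/rowP => i; rewrite !mxE; ring.
- by rewrite Tp0; lra.
move: bp; rewrite Tp0 => bp.
have bs : `|b - p0| < s by apply: le_lt_trans bp _; lra.
have mb : m (u, b) = p0.
  by move: Tb => /eqP; rewrite /T -subr_eq0 addrAC subrr add0r oppr_eq0 subr_eq0 => /eqP.
have [_ cb cub] : [/\ cimg c u, cimg c b & cdom c (mul (cinv c u) (cinv c b))].
  apply: (hr2 (u, b)).
  by apply: norm_pair_lt; [apply: lt_le_trans su _|apply: lt_le_trans bs _];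
    rewrite !ge_min lexx !orbT.
have ub : mul (cinv c u) (cinv c b) = e.
  by rewrite -[LHS](chartK atA cA) // -/(m (u, b)) [cfun _ _]mb cinv0.
have eb := group_inv_unique grp ub.
have sb : sigma u = b by rewrite /sigma /chart_inv -eb chart_invK //; exact: (atlas_chart atA).
by rewrite sb -eb; split=> //; exact: chart_inv_dom (atlas_chart atA cA) cb.
Qed.

Lemma chart_inv_continuous0 : {for p0, continuous sigma}.
Proof.
apply/continuous_normP => eps eps0; rewrite chart_inv0.
have /near_normP[r r0 hr] := chart_inv_bound.
exists (Num.min r (eps / 2)); first by rewrite lt_min r0 divr_gt0.
move=> q; rewrite lt_min => /andP[/hr[hq _ _]] h.
by apply: le_lt_trans hq _; rewrite mulrC -ltr_pdivlMr.
Qed.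

Lemma inv_continuous0 : {for e, continuous inv}.
Proof.
have ch := atlas_chart atA cA.
have [_ _ cc ci _] := ch.
have h : {for e, continuous (fun x => cinv c (sigma (cfun c x)))}.
  apply: (@continuous_comp _ _ _ (cfun c) (fun u => cinv c (sigma u))); first exact: cc.
  apply: (@continuous_comp _ _ _ sigma (cinv c)); first exact: chart_inv_continuous0.
  by rewrite chart_inv0; apply: ci; exists e.
have eqn : \forall x \near e, cinv c (sigma (cfun c x)) = inv x.
  have : \forall x \near e, cdom c (inv (cinv c (cfun c x))).
    have hs : \forall u \near cfun c e, cdom c (inv (cinv c u)).
      by apply: filterS chart_inv_bound => u [].
    exact: (cc e ce [set u | cdom c (inv (cinv c u))] hs).
  have := near_cdom ch ce; apply: filterS2 => x cx.
  by rewrite /sigma /chart_inv (chartK atA cA cx) => cix; rewrite (chartK atA cA cix).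
move: h; rewrite /prop_for /continuous_at (nbhs_singleton eqn).
by move=> h; apply: cvg_trans h; exact: near_eq_cvg.
Qed.

Lemma inv_continuous : continuous inv.
Proof.
have [cmul _] := smul; move=> a.
have h : {for a, continuous (fun x => mul (inv (mul (inv a) x)) (inv a))}.
  have h1 : {for a, continuous (fun x => mul (inv a) x)}.
    apply: (@continuous_comp _ _ _ (fun x => (inv a, x)) (fun p => mul p.1 p.2)).
      by apply: cvg_pair; [exact: cvg_cst|].
    exact: cmul.
  have h2 : {for a, continuous (fun x => inv (mul (inv a) x))}.
    apply: (@continuous_comp _ _ _ (fun x => mul (inv a) x) inv) => //.
    by rewrite (group_mulV grp); exact: inv_continuous0.
  apply: (@continuous_comp _ _ _ (fun x => (inv (mul (inv a) x), inv a)) (fun p => mul p.1 p.2)).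
    by apply: cvg_pair; [exact: h2|exact: cvg_cst].
  exact: cmul.
by rewrite /continuous_at (_ : inv = (fun x => mul (inv (mul (inv a) x)) (inv a)));
  [exact: h|apply/funext => x; exact: (group_translate grp)].
Qed.

Lemma near_law : \forall q \near (p0, p0),
  [/\ cimg c q.1, cimg c q.2 & cdom c (mul (cinv c q.1) (cinv c q.2))].
Proof. exact: (near_local_op atA cA smul ce ce cee). Qed.

(** The points [(u, sigma u)] and [(p0, p0)] have the same image under [m], so strict
    differentiability makes the sum of [u - p0] and [sigma u - p0] small compared with their norms.
    The bound [|sigma u - p0| <= 2 * |u - p0|] makes it small compared with [|u - p0|]. *)
Lemma chart_inv_diff0 : differentiable sigma p0 /\ forall x, 'd sigma p0 x = - x.
Proof.
apply: (@diff_of_bound _ _ _ _ -%R) => [x|eps eps0]; first exact: opp_continuous.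
  have eps2 : 0 < eps / 2 by rewrite divr_gt0.
  have [r r0 hr] := strict_diff fEE smooth_law eps2.
  have [r1 r10 hr1] := (near_normP _ _).1 chart_inv_bound.
  exists (Num.min (r / 2) r1); first by rewrite lt_min r10 divr_gt0.
  move=> u; rewrite lt_min => /andP[u1 u2].
  have [b1 b2 _] := hr1 u u2.
  have k1 : `|(u, sigma u).1 - (p0, p0).1| < r.
    by apply: lt_le_trans u1 _; rewrite ler_pdivrMr // ler_pMr // ler1n.
  have k2 : `|(u, sigma u).2 - (p0, p0).2| < r.
    by apply: le_lt_trans b1 _; rewrite mulrC -ltr_pdivlMr.
  have k3 : `|(p0, p0).1 - (p0, p0).1| < r by rewrite subrr normr0.
  have := hr (u, sigma u) (p0, p0) (norm_pair_lt k1 k2) (norm_pair_lt k3 k3).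
  rewrite b2 law_right0; last by exists e.
  have -> : (u, sigma u) - (p0, p0) = (u - p0, sigma u - p0) by [].
  rewrite subrr sub0r normrN diff_law => h.
  rewrite chart_inv0 opprK addrC; apply: le_trans h _.
  have hm : `|((u - p0, sigma u - p0) : ((E * E)%type : normedModType R))| <= 2 * `|u - p0|.
    rewrite prod_normE /= ge_max b1 andbT.
    by rewrite ler_peMl // ler1n.
  apply: le_trans (ler_wpM2l (ltW eps2) hm) _.
  by rewrite mulrA divfK.
Qed.

(** Near [u], inversion is [sigma v = m (sigma (m (sigma u, v)), sigma u)]. At [v = u] the inner
    argument of [sigma] is [p0], the only point where its differential is known so far, and the
    chain rule gives the formula. *)
Lemma chart_inv_diff : \forall u \near p0, differentiable sigma u /\
  forall x, 'd sigma u x = 'd m (p0, sigma u) (- 'd m (sigma u, u) (0, x), 0).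
Proof.
have [r r0 hr] := (near_normP _ _).1 (smooth_near_nbhs smooth_law).
have [r1 r10 hr1] := (near_normP _ _).1 near_law.
have [r2 r20 hr2] := (near_normP _ _).1 chart_inv_bound.
have [r3 r30 hr3] := (near_normP _ _).1 near_cimg0.
pose s := Num.min r (Num.min r1 (Num.min r2 r3)).
have s0 : 0 < s by rewrite !lt_min r0 r10 r20 r30.
apply/near_normP; exists (s / 2); first by rewrite divr_gt0.
move=> u us2.
have us : `|u - p0| < s by apply: lt_trans us2 _; rewrite ltr_pdivrMr // ltr_pMr // ltr1n.
have [uu1 [uu2 [uu3 uu4]]] :
    `|u - p0| < r /\ `|u - p0| < r1 /\ `|u - p0| < r2 /\ `|u - p0| < r3.
  by move: us; rewrite !lt_min => /and4P[].
have [b1 b2 cub] := hr2 u uu3; have cu := hr3 u uu4.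
have su : `|sigma u - p0| < s by apply: le_lt_trans b1 _; rewrite mulrC -ltr_pdivlMr.
have [su1 [su2 [su3 su4]]] : `|sigma u - p0| < r /\ `|sigma u - p0| < r1 /\
    `|sigma u - p0| < r2 /\ `|sigma u - p0| < r3.
  by move: su; rewrite !lt_min => /and4P[].
have csu := hr3 _ su4.
have n0 t : 0 < t -> `|p0 - p0| < t by rewrite subrr normr0.
have sm1 : smooth_near m (sigma u, u).
  by apply: hr; exact: (@norm_pair_lt _ _ _ (sigma u, u) (p0, p0)).
have sm2 : smooth_near m (p0, sigma u).
  by apply: hr; exact: (@norm_pair_lt _ _ _ (p0, sigma u) (p0, p0) _ (n0 _ r0)).
have nl1 : \forall q \near (sigma u, u), [/\ cimg c q.1, cimg c q.2 &
    cdom c (mul (cinv c q.1) (cinv c q.2))].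
  have := near_local_op atA cA smul (a := inv (cinv c u)) (b := cinv c u) cub.
  rewrite (chart_invK (atlas_chart atA cA) cu); apply.
    exact: chart_inv_dom (atlas_chart atA cA) cu.
  by rewrite (group_mulV grp).
have csig : cinv c (sigma u) = inv (cinv c u).
  by rewrite /sigma /chart_inv (chartK atA cA).
have msu : m (sigma u, u) = p0.
  by rewrite /m /local_op /= csig (group_mulV grp).
have d1 v : is_diff v (fun v : E => (sigma u, v)) (fun x => (0, x)).
  exact: is_diff_pair.
have d2 v : is_diff v (fun v : E => (v, sigma u)) (fun x => (x, 0)).
  exact: is_diff_pair.
pose f v := m (sigma u, v).
have df : differentiable f u.
  by apply: differentiable_comp; [case: (d1 u)|exact: smooth_near_differentiable].
have ef x : 'd f u x = 'd m (sigma u, u) (0, x).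
  have [dd ed] := d1 u.
  rewrite (diff_compE _ dd) ?ed //; exact: smooth_near_differentiable.
have [ds0 es0] := chart_inv_diff0.
pose g v := m (v, sigma u).
have dg : differentiable g p0.
  by apply: differentiable_comp; [case: (d2 p0)|exact: smooth_near_differentiable].
have eg x : 'd g p0 x = 'd m (p0, sigma u) (x, 0).
  have [dd ed] := d2 p0.
  rewrite (diff_compE _ dd) ?ed //; exact: smooth_near_differentiable.
have dsf : differentiable (fun v => sigma (f v)) u.
  by apply: differentiable_comp; rewrite // /f msu.
have sfu : sigma (f u) = p0 by rewrite /f msu chart_inv0.
have dgsf : differentiable (fun v => g (sigma (f v))) u.
  by apply: (@differentiable_comp _ _ _ _ (fun v => sigma (f v)) g); rewrite // sfu.
have eqn : \forall v \near u, g (sigma (f v)) = sigma v.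
  have cf : {for u, continuous f} by exact: differentiable_continuous.
  have nf : \forall v \near u, cdom c (inv (cinv c (f v))).
    have hs : \forall v \near f u, cdom c (inv (cinv c v)).
      by rewrite /f msu; apply: filterS chart_inv_bound => v [].
    exact: (cf [set v | cdom c (inv (cinv c v))] hs).
  have cs1 : {for u, continuous (fun v : E => (sigma u, v))}.
    by apply: differentiable_continuous; case: (d1 u).
  have nl2 := cs1 _ nl1.
  apply: filterS2 nf nl2 => v h1 [/= _ cv h2].
  rewrite /g /m /local_op /= /sigma /chart_inv; congr (cfun c _).
  rewrite (chartK atA cA h1) -/(sigma u) csig.
  rewrite /f /m /local_op /= (chartK atA cA h2) csig.
  by rewrite -(group_translate grp).
have fu : f u = p0 by exact: msu.
have dsfu : differentiable sigma (f u) by rewrite fu.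
have dgsfu : differentiable g (sigma (f u)) by rewrite sfu.
have [de ee] := @near_eq_diff R _ _ (fun v => g (sigma (f v))) sigma u eqn dgsf.
split; [exact: de|move=> x; apply: etrans (congr1 (@^~ x) ee) _].
apply: etrans (@diff_compE _ _ _ _ (fun v => sigma (f v)) g u x dsf dgsfu) _.
rewrite sfu eg (@diff_compE _ _ _ _ f sigma u x df dsfu).
by rewrite fu es0 ef.
Qed.

(** The formula for ['d sigma u] involves [sigma] only through its value at [u], so it has the form
    required by [smooth_bootstrap]. The set [W] collects the pairs at which both differentials of
    [m] in that formula are smooth. *)
Lemma smooth_chart_inv : smooth_near sigma p0.
Proof.
have [U [oU Up sU]] := smooth_law.
pose Psi (q : E * E) (x : E) := 'd m (p0, q.2) (- 'd m (q.2, q.1) (0, x), 0).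
pose W := [set q : E * E | U (p0, q.2) /\ U (q.2, q.1)].
have c1 (q : E * E) : {for q, continuous (fun q : E * E => (p0, q.2))}.
  by apply: continuous_pair_at; [exact: cvg_cst|exact: cvg_snd].
have c2 (q : E * E) : {for q, continuous (fun q : E * E => (q.2, q.1))}.
  by apply: continuous_pair_at; [exact: cvg_snd|exact: cvg_fst].
have oW : open W.
  rewrite (_ : W = ((fun q : E * E => (p0, q.2)) @^-1` U) `&`
     ((fun q : E * E => (q.2, q.1)) @^-1` U)) //.
  by apply: openI; apply: open_comp => // q _; [exact: c1|exact: c2].
have nW : \forall u \near p0, W (u, sigma u).
  have cs : {for p0, continuous (fun u : E => (u, sigma u))}.
    by apply: continuous_pair_at; [exact: cvg_id|exact: chart_inv_continuous0].
  by apply: cs; apply: open_nbhs_nbhs; split=> //; rewrite /W /= chart_inv0.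
have : nbhs p0 [set u | [/\ W (u, sigma u), differentiable sigma u &
   forall x, 'd sigma u x = Psi (u, sigma u) x]].
  by apply: filterS2 nW chart_inv_diff => u h [].
rewrite nbhsE => -[V [oV Vp] hV].
exists V; split=> //.
apply: (smooth_bootstrap (W := W) (Psi := Psi) fE fE oV oW).
- move=> x k; apply: class_C_local => q [q1 q2].
  have sf1 : smooth_near (fun q : E * E => q.1) q by exact: smooth_near_fst.
  have sf2 : smooth_near (fun q : E * E => q.2) q by exact: smooth_near_snd.
  have s1 : smooth_near (fun q : E * E => (p0, q.2)) q.
    by apply: smooth_near_pair => //; exact: smooth_near_cst.
  have s2 : smooth_near (fun q : E * E => (q.2, q.1)) q by exact: smooth_near_pair.
  have s3 : smooth_near (fun q : E * E => 'd m (q.2, q.1) (0, x)) q.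
    apply: smooth_near_apply => //; first by exists U.
    exact: smooth_near_cst.
  have s4 : smooth_near (fun q : E * E => (- 'd m (q.2, q.1) (0, x), (0 : E))) q.
    apply: smooth_near_pair; last exact: smooth_near_cst.
    apply: (@smooth_near_comp _ _ _ _ _ -%R) => //.
    by apply: (@smooth_near_linear _ _ _ -%R) => y; exact: opp_continuous.
  have : smooth_near (Psi^~ x) q.
    by apply: smooth_near_apply => //; exists U.
  by move=> [Y [oY Yq sY]]; exists Y => //; exact: sY.
- by move=> u /hV[].
- by move=> u /hV[].
- by move=> u x /hV[].
Qed.

Lemma smooth_inv : smooth_map A A inv.
Proof.
apply/(smooth_mapP inv atA atA) => a.
have se : smooth_at A A inv e.
  apply: (smooth_at_charts (c := c) (d := c)) => //; first by rewrite (group_inv1 grp).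
    exact: inv_continuous.
  exact: smooth_chart_inv.
have -> : inv = (fun x => mul (inv (mul (inv a) x)) (inv a)).
  by apply/funext => x; exact: (group_translate grp).
have s1 : smooth_at A A (fun x => mul (inv a) x) a.
  apply: (smooth_at_comp2 (h := mul) fE fE atA atA atA atA) => //.
    exact: smooth_at_cst.
  exact: smooth_at_id.
apply: (smooth_at_comp2 (h := mul) fE fE atA atA atA atA) => //.
  apply: (smooth_at_comp (g := inv) fE atA atA s1).
  by rewrite (group_mulV grp).
exact: smooth_at_cst.
Qed.

End SmoothInverse.

(** * Integral curves and one-parameter subgroups *)

Section Primitive.
Context {R : realType}.
Local Notation mu := (@lebesgue_measure R).

(** The integral starts at -1 so that 0 is interior to the interval of integration and the
    derivative is two-sided at every [t] of norm less than 1; subtracting the value at 0 fixes the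
    constant. *)
Lemma scalar_primitive (f : R -> R) : continuous f ->
  exists F : R -> R, F 0 = 0 /\ forall t : R, `|t| < 1 ->
    differentiable (F : R^o -> R^o) t /\
    forall h, 'd (F : R^o -> R^o) t h = h * f t.
Proof.
move=> cf; pose F (x : R) : R := (\int[mu]_(t in `[(-1)%R, x]) f t)%R.
have intf : mu.-integrable `[(-1)%R, 1%R] (EFin \o f).
  apply: continuous_compact_integrable; first exact: segment_compact.
  exact: continuous_subspaceT.
have dF t : `|t| < 1 -> derivable F t 1 /\ derive1 F t = f t.
  rewrite ltr_norml => /andP[t1 t2].
  by apply: (@continuous_FTC1_closed R f (-1) t 1) => //; exact: cf.
exists (fun x => F x - F 0); split; first by rewrite subrr.
move=> t /dF[d1 e1].
have d2 : differentiable (F : R^o -> R^o) t by exact/derivable1_diffP.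
have d3 : differentiable (fun x : R^o => F x - F 0 : R^o) t.
  apply: differentiableB; first exact: d2.
  exact: differentiable_cst.
split; first exact: d3.
move=> h.
have e2 := congr1 (@^~ h) (diffB d2 (differentiable_cst (F 0 : R^o) (t : R^o))).
apply: etrans e2 _.
have -> : ('d (F : R^o -> R^o) t \- 'd (cst (F 0 : R^o)) t) h =
   'd (F : R^o -> R^o) t h - 'd (cst (F 0 : R^o)) t h by [].
have e4 := congr1 (@^~ h) (diff_cst (F 0 : R^o) (t : R^o)).
rewrite [X in _ - X]e4 subr0.
have e3 := congr1 (@^~ h) (deriv1E d1).
by rewrite e3 e1.
Qed.

Lemma vector_primitive n (f : R^o -> 'rV[R]_n) : continuous f ->
  exists F : R^o -> 'rV[R]_n, F 0 = 0 /\ forall t : R, `|t| < 1 ->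
    differentiable F t /\ forall h, 'd F t h = h *: f t.
Proof.
move=> cf.
have /choice[F hF] : forall i, exists F : R -> R, F 0 = 0 /\
    forall t : R, `|t| < 1 -> differentiable (F : R^o -> R^o) t /\
    forall h, 'd (F : R^o -> R^o) t h = h * f t 0 i.
  move=> i; apply: scalar_primitive => t.
  apply: (@continuous_comp _ _ _ f (fun v : 'rV[R]_n => v 0 i)); first exact: cf.
  exact: coord_continuous.
exists (fun t => \row_i F i t); split.
  by apply/rowP => i; rewrite !mxE (hF i).1.
move=> t t1.
have lin : linear (fun h : R^o => h *: f t).
  by move=> a u v; rewrite scalerDl scalerA.
pose l : {linear R^o -> 'rV[R]_n} := HB.pack (fun h : R^o => h *: f t)
  (GRing.isLinear.Build R R^o 'rV[R]_n _ _ lin).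
apply: (@diff_of_bound _ _ _ _ l).
  apply: continuous_linear_finite_coords; exact: finite_coords_line.
move=> eps eps0.
have [r r0 hr] := (continuous_normP _ _).1 (cf t) eps eps0.
have t1' : 0 < 1 - `|t| by rewrite subr_gt0.
exists (Num.min r (1 - `|t|)); first by rewrite lt_min r0.
move=> u; rewrite lt_min => /andP[ur u1].
have pt (s : R) : 0 <= s <= 1 -> `|t + s *: (u - t)| < 1 /\ `|t + s *: (u - t) - t| < r.
  move=> /andP[s0 s1]; have hs : `|s *: (u - t)| <= `|u - t|.
    by rewrite normrZ ger0_norm // ler_piMl.
  split; last by rewrite addrC addKr; exact: le_lt_trans hs ur.
  apply: le_lt_trans (ler_normD _ _) _.
  by rewrite -ltrBrDl; exact: le_lt_trans hs u1.
apply: rV_norm_le => [|i]; first by rewrite mulr_ge0 // ltW.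
have [s /pt hs|s /andP[s0 s1] es] := @mvt_line _ R^o (F i) t (u - t).
  by have [d _] := (hF i).2 _ hs.1; exact: d.
have [hs1 hs2] := pt s (introT andP (conj (ltW s0) (ltW s1))).
rewrite !mxE; rewrite subrKC in es; rewrite es ((hF i).2 _ hs1).2.
have := hr _ hs2; set v := f (t + s *: (u - t)) => hv.
have -> : (u - t) * v 0 i - (u - t) * f t 0 i = (v - f t) 0 i * (u - t).
  by rewrite !mxE; ring.
rewrite normrM ler_wpM2r //; apply: le_trans (ltW hv); exact: rV_coord_le.
Qed.

Lemma primitive_bound n (F f : R^o -> 'rV[R]_n) (t K : R) : 0 <= K -> F 0 = 0 ->
  (forall s : R, `|s| <= `|t| -> [/\ differentiable F s,
     forall h, 'd F s h = h *: f s & `|f s| <= K]) ->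
  `|F t| <= K * `|t|.
Proof.
move=> K0 F0 hF; apply: rV_norm_le => [|i]; first by rewrite mulr_ge0.
have pt (s : R) : 0 <= s <= 1 -> `|0 + s *: (t : R^o)| <= `|t|.
  by move=> /andP[s0 s1]; rewrite add0r normrZ ger0_norm // ler_piMl.
have [s /pt hs|s /andP[s0 s1] es] := @mvt_line _ R^o (fun u => F u 0 i) 0 t.
  have [d _ _] := hF _ hs.
  apply: (@differentiable_comp _ _ _ _ F (rV_coord i)) => //.
  apply: linear_differentiable; exact: rV_coord_continuous.
have [d ed hK] := hF _ (pt s (introT andP (conj (ltW s0) (ltW s1)))).
rewrite add0r F0 mxE subr0 in es; rewrite es (diff_coordE _ _ d) ed !mxE normrM mulrC.
rewrite ler_wpM2r //; apply: le_trans hK; exact: rV_coord_le.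
Qed.

End Primitive.

(** * Local existence of integral curves *)

Section Picard.
Context {R : realType} {n : nat}.
Local Notation E := 'rV[R]_n.

(** The retraction of the line onto [[-d, d]]. It lets the iterates be continuous functions on the
    whole line while the time of integration stays small. *)
Definition clamp (d t : R) : R := Num.max (- d) (Num.min d t).

Lemma clamp_le d t : 0 <= d -> `|clamp d t| <= d.
Proof.
move=> d0; rewrite ler_norml /clamp le_max lexx /= ge_max ge_min lexx /=.
by rewrite andbT; lra.
Qed.

Lemma clamp_id d t : `|t| <= d -> clamp d t = t.
Proof. by rewrite ler_norml => /andP[h1 h2]; rewrite /clamp min_r // max_r. Qed.

Lemma clamp_continuous d : continuous (clamp d : R^o -> R^o).
Proof.
move=> t.
have h1 : {for t, continuous (fun t : R^o => Num.min d t : R^o)}.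
  by apply: (@continuous_min _ _ (fun=> d : R^o) id); [exact: cvg_cst|exact: cvg_id].
by apply: (@continuous_max _ _ (fun=> - d : R^o) (fun t : R^o => Num.min d t : R^o)) => //;
  exact: cvg_cst.
Qed.

(** The iterates of [u |-> p + primitive of (X o u)], with clamped time, converge uniformly at a
    geometric rate. The limit is a fixed point, and where the clamp is the identity a fixed point is
    an integral curve. *)
Lemma picard (X : E -> E) p : smooth_near X p ->
  exists2 d : R, 0 < d & exists u : R^o -> E, u 0 = p /\
    forall t, `|t| < d -> differentiable u t /\ forall h, 'd u t h = h *: X (u t).
Proof.
move=> sX.
have fE := @finite_coords_rV R n.
have [r1 r10 hr1] := (near_normP _ _).1 (smooth_near_nbhs sX).
have [r2 r20 hr2] := strict_diff fE sX ltr01.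
have [k k0 hk] := linear_lipschitz (diff_continuous (smooth_near_differentiable sX)).
(* A Lipschitz constant of [X] on the small ball: [k] for its differential at [p], and 1 for the
   error term of strict differentiability. *)
pose L := 1 + k; have L0 : 0 < L by rewrite addr_gt0.
pose r := Num.min r1 r2 / 2.
have r0 : 0 < r by rewrite divr_gt0 // lt_min r10.
have rr q : `|q - p| <= r -> `|q - p| < r1 /\ `|q - p| < r2.
  move=> h; apply/andP; rewrite -lt_min; apply: le_lt_trans h _.
  by rewrite ltr_pdivrMr // ltr_pMr ?ltr1n // lt_min r10.
have LX u v : `|u - p| <= r -> `|v - p| <= r -> `|X u - X v| <= L * `|u - v|.
  move=> /rr[_ hu] /rr[_ hv].
  have := hr2 u v hu hv; rewrite mul1r => h.
  have -> : X u - X v = (X u - X v - 'd X p (u - v)) + 'd X p (u - v) by rewrite subrK.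
  by apply: le_trans (ler_normD _ _) _; rewrite mulrDl mul1r lerD.
have cX q : `|q - p| <= r -> {for q, continuous X}.
  by move=> /rr[h _]; exact/smooth_near_continuous/hr1.
pose M := `|X p| + L * r.
have M0 : 0 <= M by rewrite addr_ge0 // mulr_ge0 // ltW.
have MX q : `|q - p| <= r -> `|X q| <= M.
  move=> h; have -> : X q = X p + (X q - X p) by rewrite addrC subrK.
  apply: le_trans (ler_normD _ _) _; rewrite lerD2l.
  apply: le_trans (LX _ _ h _) _; first by rewrite subrr normr0 ltW.
  by rewrite ler_pM2l.
(* The three bounds keep the clamped time where primitives are differentiable, keep the iterates in
   the ball of radius [r] on which [X] is bounded by [M], and make the integral operator contract by
   one half. *)
pose d := Num.min 2^-1 (Num.min (r / (M + 1)) (2 * L)^-1).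
have M1 : 0 < M + 1 by rewrite ltr_wpDl.
have d0 : 0 < d.
  by rewrite !lt_min invr_gt0 ltr0n /= divr_gt0 //= invr_gt0 mulr_gt0.
have d1 : d < 1.
  apply: (@le_lt_trans _ _ 2^-1); first by rewrite ge_min lexx.
  by rewrite invf_lt1 // ltr1n.
have dM : M * d <= r.
  apply: (@le_trans _ _ ((M + 1) * d)); first by rewrite ler_pM2r // lerDl.
  by rewrite mulrC -ler_pdivlMr // !ge_min lexx orbT.
have dL : L * d <= 2^-1.
  have : d <= (2 * L)^-1 by rewrite !ge_min lexx !orbT.
  by rewrite invfM ler_pdivlMr // mulrC.
have cl_lt t : `|clamp d t| < 1 by apply: le_lt_trans (clamp_le _ (ltW d0)) d1.
(* A primitive is chosen for all functions at once; on a discontinuous [f] the value is irrelevant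
   and [f] itself serves. *)
have /choice[P hP] : forall f : R^o -> E, exists F : R^o -> E, continuous f ->
    F 0 = 0 /\ forall t : R, `|t| < 1 ->
    differentiable F t /\ forall h, 'd F t h = h *: f t.
  move=> f; have [/vector_primitive[F hF]|nf] := pselect (continuous f).
    by exists F.
  by exists f => /nf.
pose T (u : R^o -> E) : R^o -> E := fun t => p + P (fun t => X (u t)) (clamp d t).
pose good (u : R^o -> E) := continuous u /\ forall t, `|u t - p| <= r.
have goodX u : good u -> continuous (fun t => X (u t)).
  by move=> [cu hu] t; apply: (@continuous_comp _ _ _ u X); [exact: cu|exact: cX].
have goodT u : good u -> good (T u).
  move=> gu; have cXu := goodX u gu; have [F0 dF] := hP _ cXu; split.
    move=> t; have [dt _] := dF _ (cl_lt t).
    have cP := differentiable_continuous dt.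
    apply: (@continuousD _ _ _ (fun=> p)); first exact: cvg_cst.
    by apply: (@continuous_comp _ _ _ (clamp d : R^o -> R^o)); [exact: clamp_continuous|exact: cP].
  move=> t; rewrite /T addrC addKr; apply: le_trans dM.
  apply: (@le_trans _ _ (M * `|clamp d t|)); last by rewrite ler_wpM2l // clamp_le // ltW.
  apply: (primitive_bound M0 F0) => s hs.
  have s1 : `|s| < 1 by exact: le_lt_trans hs (cl_lt t).
  have [ds es] := dF s s1; split=> [||]; [exact: ds|exact: es|].
  by apply: MX; exact: gu.2.
have contrT u v K : 0 <= K -> good u -> good v -> (forall t, `|u t - v t| <= K) ->
    forall t, `|T u t - T v t| <= K / 2.
  move=> K0 gu gv huv t; rewrite /T opprD addrACA subrr add0r.
  have [F0 dF] := hP _ (goodX u gu); have [H0 dH] := hP _ (goodX v gv).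
  set F := P (fun t => X (u t)) in F0 dF *; set H := P (fun t => X (v t)) in H0 dH *.
  have LK0 : 0 <= L * K by rewrite mulr_ge0 // ltW.
  apply: (@le_trans _ _ (L * K * `|clamp d t|)).
    apply: (@primitive_bound _ _ (fun t => F t - H t) (fun t => X (u t) - X (v t))) => //.
      by rewrite F0 H0 subrr.
    move=> s hs; have s1 : `|s| < 1 by exact: le_lt_trans hs (cl_lt t).
    have [dsF esF] := dF s s1; have [dsH esH] := dH s s1; split.
    - exact: differentiableB.
    - move=> h; apply: etrans (congr1 (@^~ h) (diffB dsF dsH)) _.
      by rewrite scalerBr -esF -esH.
    - apply: le_trans (LX _ _ (gu.2 s) (gv.2 s)) _.
      by rewrite ler_pM2l.
  apply: (@le_trans _ _ (L * K * d)); first by rewrite ler_wpM2l // clamp_le // ltW.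
  by rewrite mulrAC mulrC ler_wpM2l.
pose u_ j : R^o -> E := iter j T (fun=> p).
have gu j : good (u_ j).
  elim: j => [|j IH]; last exact: goodT.
  by split=> t; [exact: cvg_cst|rewrite /u_ /= subrr normr0 ltW].
have du j t : `|u_ j.+1 t - u_ j t| <= r / 2 ^+ j.
  elim: j t => [|j IH] t.
    by rewrite expr0 divr1; have := (gu 1%N).2 t.
  have := contrT _ _ (r / 2 ^+ j) _ (gu j.+1) (gu j) IH t.
  have -> : r / 2 ^+ j.+1 = r / 2 ^+ j / 2 by rewrite exprS invfM mulrCA mulrC.
  apply.
  by rewrite divr_ge0 ?exprn_ge0 // ltW.
have /choice[l hl] : forall t, exists l, forall j, `|u_ j t - l| <= 2 * r / 2 ^+ j.
  by move=> t; apply: geometric_cauchy_rV => j; exact: du.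
have C0 j : 0 <= 2 * r / 2 ^+ j.
  by rewrite divr_ge0 ?exprn_ge0 // mulr_ge0 // ltW.
have gl : good l.
  split.
    move=> t; apply/continuous_normP => eps eps0.
    have [j hj] : exists j, 2 * r / 2 ^+ j < eps / 3.
      apply: contrapT => /forallNP h.
      have : eps / 3 <= 0.
        by apply: (@le0_geometric _ _ (2 * r)) => j; rewrite leNgt; apply/negP/h.
      by rewrite leNgt divr_gt0.
    have e3 : 0 < eps / 3 by rewrite divr_gt0.
    have [s s0 hs] := (continuous_normP _ _).1 ((gu j).1 t) _ e3.
    exists s => // q /hs hq.
    have -> : l q - l t = (l q - u_ j q) + (u_ j q - u_ j t) + (u_ j t - l t).
      by rewrite !addrA !subrK.
    apply: le_lt_trans (ler_normD _ _) _.
    have h1 : `|l q - u_ j q + (u_ j q - u_ j t)| <= `|u_ j q - l q| + `|u_ j q - u_ j t|.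
      by apply: le_trans (ler_normD _ _) _; rewrite distrC.
    have h2 := hl q j; have h3 := hl t j.
    by lra.
  move=> t; rewrite -subr_le0; apply: (@le0_geometric _ _ (2 * r)) => j.
  rewrite lerBlDr.
  have -> : l t - p = (l t - u_ j t) + (u_ j t - p) by rewrite addrA subrK.
  apply: le_trans (ler_normD _ _) _; rewrite distrC; apply: lerD; first exact: hl.
  exact: (gu j).2.
have fixl t : l t = T l t.
  apply/eqP; rewrite -subr_eq0 -normr_le0; apply: (@le0_geometric _ _ (2 * r)) => j.
  have -> : l t - T l t = (l t - u_ j.+1 t) + (T (u_ j) t - T l t) by rewrite addrA subrK.
  apply: le_trans (ler_normD _ _) _.
  have h1 := contrT _ _ _ (C0 j) (gu j) gl (fun t => hl t j) t.
  have h2 := hl t j.+1; rewrite distrC in h2.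
  apply: le_trans (lerD h2 h1) _.
  by rewrite exprS invfM; lra.
have [F0 dF] := hP _ (goodX l gl).
exists d => //; exists l; split.
  by rewrite fixl /T clamp_id ?normr0 ?ltW // F0 addr0.
move=> t td; have t1 : `|t| < 1 by exact: lt_trans td d1.
have [dt et] := dF t t1.
have eqn : \forall s \near (t : R^o), p + P (fun t => X (l t)) s = l s.
  apply/near_normP; exists (d - `|t|); first by rewrite subr_gt0.
  move=> s hs; rewrite (fixl s) /T clamp_id //.
  have -> : s = t + (s - t) by rewrite addrC subrK.
  apply: le_trans (ler_normD _ _) _; apply: ltW.
  by rewrite addrC -ltrBrDr.
have dpt : differentiable (fun s : R^o => p + P (fun t => X (l t)) s) t.
  by apply: differentiableD; [exact: differentiable_cst|exact: dt].
have [dl el] := near_eq_diff eqn dpt.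
split; first exact: dl.
move=> h; apply: etrans (congr1 (@^~ h) el) _.
apply: etrans (congr1 (@^~ h) (diffD (differentiable_cst p (t : R^o)) dt)) _.
rewrite -et -[RHS]add0r; congr (_ + _).
by have := congr1 (@^~ h) (diff_cst p (t : R^o)).
Qed.

End Picard.

(** * Powers, and extension of local homomorphisms of the line *)

Section Powers.
Context {G : topologicalType} {mul : G -> G -> G} {e : G} {inv : G -> G}.
Context (grp : is_group mul e inv).

Definition group_pow (a : G) (k : nat) : G := iter k (mul a) e.

Lemma group_powD a j k : group_pow a (j + k) = mul (group_pow a j) (group_pow a k).
Proof.
elim: j => [|j IH]; first by rewrite (group_mul1 grp).
by rewrite addSn /group_pow /= -!/(group_pow a _) IH (group_mulA grp).
Qed.

Lemma group_powS a k : group_pow a k.+1 = mul (group_pow a k) a.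
Proof. by rewrite -addn1 group_powD /group_pow /= (group_mule grp). Qed.

Lemma group_powM a j k : group_pow a (j * k) = group_pow (group_pow a j) k.
Proof.
elim: k => [|k IH]; first by rewrite muln0.
by rewrite mulnS group_powD IH.
Qed.

Lemma group_pow_commute a b k : mul a b = mul b a ->
  group_pow (mul a b) k = mul (group_pow a k) (group_pow b k).
Proof.
move=> ab; have abk j : mul b (group_pow a j) = mul (group_pow a j) b.
  elim: j => [|j IH]; first by rewrite /group_pow /= (group_mule grp) (group_mul1 grp).
  by rewrite /group_pow /= -!/(group_pow a _) (group_mulA grp) -ab -(group_mulA grp) IH (group_mulA grp).
elim: k => [|k IH]; first by rewrite /group_pow /= (group_mul1 grp).
rewrite /group_pow /= -!/(group_pow _ _) IH -!(group_mulA grp); congr (mul a _).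
by rewrite !(group_mulA grp) abk.
Qed.

Lemma group_idem x : mul x x = x -> x = e.
Proof.
by move=> h; rewrite -(group_mulV grp x) -{3}h (group_mulA grp) (group_mulV grp) (group_mul1 grp).
Qed.

Lemma hom0 (R : realType) (g : R^o -> G) :
  {morph g : s t / s + t >-> mul s t} -> g 0 = e.
Proof. by move=> gM; apply: group_idem; rewrite -gM addr0. Qed.

Lemma hom_pw (R : realType) (g : R^o -> G) t k :
  {morph g : s t / s + t >-> mul s t} -> g (t *+ k) = group_pow (g t) k.
Proof.
move=> gM; elim: k => [|k IH]; first by rewrite mulr0n (hom0 gM).
by rewrite mulrS gM IH.
Qed.

Lemma exists_large (R : realType) (x d : R) : 0 < d -> exists k : nat, x / k.+1%:R < d.
Proof.
move=> d0; exists (Num.bound (`|x| / d)).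
rewrite ltr_pdivrMr // mulrC -ltr_pdivrMr //.
apply: le_lt_trans (_ : `|x| / d < _).
  by rewrite ler_pM2r ?invr_gt0 // ler_norm.
apply: lt_trans (archi_boundP _) _; first by rewrite divr_ge0 // ltW.
by rewrite ltr_nat.
Qed.

(* A local homomorphism is extended by [g t := (gamma (t / N)) ^ N], which does
   not depend on the large integer [N]. *)
Lemma extend_hom (R : realType) (gamma : R^o -> G) (d : R) : 0 < d ->
  (forall s t : R^o, `|s| < d -> `|t| < d -> gamma (s + t) = mul (gamma s) (gamma t)) ->
  exists g : R^o -> G, {morph g : s t / s + t >-> mul s t} /\
    forall t : R, `|t| < d -> g t = gamma t.
Proof.
move=> d0 gM.
have g0 : gamma 0 = e by apply: group_idem; rewrite -gM ?normr0 // addr0.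
have g_pw (t : R) k : `|t| * k%:R < d -> group_pow (gamma t) k = gamma (t * k%:R).
  elim: k => [|k IH] h; first by rewrite mulr0 g0.
  have hk : `|t| * k%:R < d.
    by apply: le_lt_trans h; rewrite ler_wpM2l // ler_nat.
  have ht : `|t| < d.
    by apply: le_lt_trans h; rewrite -[leLHS]mulr1 ler_wpM2l // ler1n.
  rewrite group_powS IH // -gM ?normrM ?normr_nat //.
  by rewrite -[X in _ + X]mulr1 -mulrDr natr1.
(* The index [k] stands for [k.+1] equal parts, so no division by zero occurs. *)
pose P t k := group_pow (gamma (t / k.+1%:R)) k.+1.
have normd (t : R) k : `|t / k.+1%:R| = `|t| / k.+1%:R.
  by rewrite normrM normfV normr_nat.
have indep t j k : `|t| / j.+1%:R < d -> `|t| / k.+1%:R < d -> P t j = P t k.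
  (* Two subdivisions are compared through their common refinement into [a.+1 * b.+1] parts. *)
  have main a b : `|t| / a.+1%:R < d ->
      P t a = group_pow (gamma (t / (a.+1%:R * b.+1%:R))) (a.+1 * b.+1).
    move=> ha; rewrite mulnC group_powM g_pw.
      by rewrite invfM mulrA divfK ?pnatr_eq0.
    by rewrite normrM normfV normrM !normr_nat invfM mulrA divfK ?pnatr_eq0.
  move=> hj hk; rewrite (main j k hj) (main k j hk).
  by rewrite [j.+1%:R * _]mulrC [(j.+1 * _)%N]mulnC.
have /choice[N hN] : forall t : R, exists k : nat, `|t| / k.+1%:R < d.
  by move=> t; exact: exists_large.
exists (fun t => P t (N t)); split.
  move=> s t.
  have [k hk] := exists_large (`|s| + `|t|) d0.
  have hs : `|s| / k.+1%:R < d.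
    by apply: le_lt_trans hk; rewrite ler_wpM2r ?invr_ge0 // lerDl.
  have ht : `|t| / k.+1%:R < d.
    by apply: le_lt_trans hk; rewrite ler_wpM2r ?invr_ge0 // lerDr.
  have hst : `|s + t| / k.+1%:R < d.
    by apply: le_lt_trans hk; rewrite ler_wpM2r ?invr_ge0 // ler_normD.
  rewrite (indep _ _ _ (hN _) hst) (indep _ _ _ (hN _) hs) (indep _ _ _ (hN _) ht).
  have ns : `|s / k.+1%:R| < d by rewrite normd.
  have nt : `|t / k.+1%:R| < d by rewrite normd.
  rewrite /P mulrDl gM //; apply: group_pow_commute.
  by rewrite -!gM // addrC.
move=> t td; rewrite (indep t (N t) 0%N (hN t)); last by rewrite divr1.
by rewrite /P divr1 /group_pow /= (group_mule grp).
Qed.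

End Powers.

(** * One-parameter subgroups and the exponential *)

Section OneParameter.
Context {R : realType} {n : nat} {G : topologicalType}.
Context {A : set (chart G 'rV[R]_n)} {mul : G -> G -> G} {e : G} {inv : G -> G}.
Context (atA : is_atlas A) (grp : is_group mul e inv).
Context (smul : smooth_map (prod_atlas A A) A (fun p => mul p.1 p.2)).
Context (c : chart G 'rV[R]_n) (cA : A c) (ce : cdom c e).
Local Notation E := 'rV[R]_n.
Let fE := @finite_coords_rV R n.
Let fEE := finite_coords_prod fE fE.
Let fR := @finite_coords_line R.
Let atP := prod_atlas_is_atlas fE fE atA atA.
Let atL := @line_atlas_is_atlas R.
Let p0 := cfun c e.
Let m := local_op c mul.
Let K := local_op c (fun a b => mul a (inv b)).
Let ch := atlas_chart atA cA.
Let cinv0 : cinv c p0 = e. Proof. exact: (chartK atA). Qed.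

(** The left-invariant field with value [y] at [e], written through the differential of the law in
    both variables so that its smooth dependence on [u] is immediate. *)
Definition left_field (y u : E) : E := 'd (local_op c mul) (u, cfun c e) (0, y).
Let X := left_field.

Lemma smooth_quotient : smooth_map (prod_atlas A A) A (fun p => mul p.1 (inv p.2)).
Proof.
apply/(smooth_mapP _ atP atA) => p.
have sinv := smooth_inv atA grp smul cA ce.
apply: (smooth_at_comp2 (f := fst) (h := mul) fE fE atP atA atA atA) => //.
  exact: smooth_at_fst.
apply: (smooth_at_comp (f := snd) (g := inv) fE atP atA).
  exact: smooth_at_snd.
exact: (smooth_mapP _ atA atA).1.
Qed.

Lemma smooth_near_pair_cst (u p : E) : smooth_near (fun w : E => (u, w)) p.
Proof. by apply: smooth_near_pair; [exact: smooth_near_cst|exact: smooth_near_id]. Qed.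

Lemma product_near (u : E) : cimg c u ->
  \forall w \near p0, cdom c (mul (cinv c u) (cinv c w)).
Proof.
move=> cu.
have cud := chart_inv_dom ch cu.
have cue : cdom c (mul (cinv c u) e) by rewrite (group_mule grp).
have := near_local_op atA cA smul cud ce cue; rewrite (chart_invK ch cu) => h.
have c1 := smooth_near_continuous (smooth_near_pair_cst u p0).
have h' : \forall w \near p0,
  [/\ cimg c u, cimg c w & cdom c (mul (cinv c u) (cinv c w))] := c1 _ h.
by apply: filterS h' => w [].
Qed.

Lemma diff_left (u y : E) : smooth_near m (u, p0) ->
  differentiable (fun w : E => m (u, w)) p0 /\
  'd (fun w : E => m (u, w)) p0 y = X y u.
Proof.
move=> /smooth_near_differentiable dm.
have d1 := smooth_near_differentiable (smooth_near_pair_cst u p0).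
split; first exact: (@differentiable_comp _ _ _ _ (fun w : E => (u, w)) m _ d1 dm).
rewrite (@diff_compE _ _ _ _ (fun w : E => (u, w)) m p0 y d1 dm).
have [d0 e0] := is_diff_id p0.
have ep : 'd (fun w : E => (u, w)) p0 y = (0, y).
  apply: etrans (diff_pairE y (differentiable_cst u p0) d0) _.
  congr pair; first exact: (congr1 (@^~ y) (diff_cst u p0)).
  exact: (congr1 (@^~ y) e0).
exact: (congr1 ('d m (u, p0)) ep).
Qed.

(** Multiplying both [u] and [v] on the right by [w] leaves the quotient [K (u, v)] unchanged.
    Differentiating in [w] at the unit shows that [K] has zero derivative along the pair of
    left-invariant fields. *)
Lemma quotient_invariant : exists2 r : R, 0 < r &
  forall u v : E, `|u - p0| < r -> `|v - p0| < r ->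
  [/\ [/\ cimg c u, cimg c v & cdom c (mul (cinv c u) (inv (cinv c v)))],
      smooth_near m (u, p0), smooth_near m (v, p0), smooth_near K (u, v) &
      forall y, 'd K (u, v) (X y u, X y v) = 0].
Proof.
have cee : cdom c (mul e (inv e)) by rewrite (group_inv1 grp) (group_mul1 grp).
pose q a b := mul a (inv b).
have sK := smooth_local_op (op := q) atA cA smooth_quotient ce ce cee.
have nK := near_local_op (op := q) atA cA smooth_quotient ce ce cee.
have [r1 r10 hr1] := (near_normP _ _).1 (smooth_near_nbhs sK).
have [r2 r20 hr2] := (near_normP _ _).1 nK.
have [r3 r30 hr3] := (near_normP _ _).1 (smooth_near_nbhs (smooth_law atA grp smul cA ce)).
exists (Num.min r1 (Num.min r2 r3)); first by rewrite !lt_min r10 r20.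
move=> u v; rewrite !lt_min => /and3P[u1 u2 u3] /and3P[v1 v2 v3].
have n0 t : 0 < t -> `|p0 - p0| < t by rewrite subrr normr0.
have [cu cv cuv] := hr2 (u, v) (@norm_pair_lt _ _ _ (u, v) (p0, p0) _ u2 v2).
have su := hr3 (u, p0) (@norm_pair_lt _ _ _ (u, p0) (p0, p0) _ u3 (n0 _ r30)).
have sv := hr3 (v, p0) (@norm_pair_lt _ _ _ (v, p0) (p0, p0) _ v3 (n0 _ r30)).
have suv := hr1 (u, v) (@norm_pair_lt _ _ _ (u, v) (p0, p0) _ u1 v1).
split; [by []|exact: su|exact: sv|exact: suv|move=> y].
have [du eu] := diff_left y su; have [dv ev] := diff_left y sv.
have mu : m (u, p0) = u by exact: (law_right0 atA grp cA ce).
have mv : m (v, p0) = v by exact: (law_right0 atA grp cA ce).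
have dK := smooth_near_differentiable suv.
pose f w := K (m (u, w), m (v, w)).
have eqn : \forall w \near p0, K (u, v) = f w.
  apply: filterS2 (product_near cu) (product_near cv) => w h1 h2.
  rewrite /f /K /m /local_op /= (chartK atA cA h1) (chartK atA cA h2).
  rewrite (group_invM grp) (group_mulA grp) -(group_mulA grp (cinv c u)).
  by rewrite (group_mulxV grp) (group_mule grp).
have [df ef] := near_eq_diff eqn (differentiable_cst (K (u, v)) p0).
have dp := differentiable_pair du dv.
have dK' : differentiable K (m (u, p0), m (v, p0)) by rewrite mu mv.
have ep : 'd (fun w : E => (m (u, w), m (v, w))) p0 y = (X y u, X y v).
  exact: etrans (diff_pairE y du dv) (f_equal2 pair eu ev).
have e1 := @diff_compE _ _ _ _ (fun w : E => (m (u, w), m (v, w))) K p0 y dp dK'.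
have e2 : 'd f p0 y = 0.
  exact: etrans (congr1 (@^~ y) ef) (congr1 (@^~ y) (diff_cst (K (u, v)) p0)).
have e3 := congr1 ('d K (m (u, p0), m (v, p0))) ep.
have := etrans (esym (etrans e1 e3)) e2.
by rewrite mu mv.
Qed.

Definition integral_curve (y : E) (d : R) (u : R^o -> E) : Prop :=
  forall t : R, `|t| < d -> differentiable u t /\ forall h, 'd u t h = h *: X y (u t).

Lemma diff0_const (f : R^o -> E) (d : R) :
  (forall t : R, `|t| < d -> differentiable f t /\ forall h, 'd f t h = 0) ->
  forall t : R, `|t| < d -> f t = f 0.
Proof.
move=> hf t td; apply/eqP; rewrite -subr_eq0 -normr_le0.
apply: rV_norm_le => // i.
have pt (s : R) : 0 <= s <= 1 -> `|0 + s *: (t : R^o)| < d.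
  move=> /andP[s0 s1]; apply: le_lt_trans td.
  by rewrite add0r normrZ ger0_norm // ler_piMl.
have [s /pt hs|s /andP[s0 s1] es] := @mvt_line _ R^o (fun u => f u 0 i) 0 t.
  have [df _] := hf _ hs.
  apply: (@differentiable_comp _ _ _ _ f (rV_coord i)); first exact: df.
  apply: linear_differentiable; exact: rV_coord_continuous.
have [df ef] := hf _ (pt s (introT andP (conj (ltW s0) (ltW s1)))).
rewrite add0r (diff_coordE _ _ df) ef mxE in es.
by rewrite !mxE es normr0.
Qed.

(** Along two integral curves of the same left-invariant field, [K] has zero derivative. With equal
    starting points this is uniqueness; with a curve and its time shift it is the homomorphism
    property. *)
Lemma quotient_constant y d r u v :
  (forall u v : E, `|u - p0| < r -> `|v - p0| < r ->
  [/\ [/\ cimg c u, cimg c v & cdom c (mul (cinv c u) (inv (cinv c v)))],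
      smooth_near m (u, p0), smooth_near m (v, p0), smooth_near K (u, v) &
      forall y, 'd K (u, v) (X y u, X y v) = 0]) ->
  integral_curve y d u -> integral_curve y d v ->
  (forall t, `|t| < d -> `|u t - p0| < r /\ `|v t - p0| < r) ->
  forall t : R, `|t| < d ->
    mul (cinv c (u t)) (inv (cinv c (v t))) = mul (cinv c (u 0)) (inv (cinv c (v 0))).
Proof.
move=> hr cu cv uvr t td.
have d0 : 0 < d by exact: le_lt_trans td.
have h0 : `|0 : R| < d by rewrite normr0.
have main : K (u t, v t) = K (u 0, v 0).
  apply: (@diff0_const (fun t => K (u t, v t)) d) td => s sd.
  have [ru rv] := uvr s sd; have [_ _ _ sK eK] := hr _ _ ru rv.
  have [du eu] := cu s sd; have [dv ev] := cv s sd.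
  have dp := differentiable_pair du dv.
  have dK := smooth_near_differentiable sK.
  split; first exact: (@differentiable_comp _ _ _ _ (fun t => (u t, v t)) K _ dp dK).
  move=> h; apply: etrans (@diff_compE _ _ _ _ (fun t => (u t, v t)) K s h dp dK) _.
  have ep : 'd (fun t => (u t, v t)) s h = h *: (X y (u s), X y (v s)).
    by apply: etrans (diff_pairE h du dv) _; congr pair; [exact: eu|exact: ev].
  apply: etrans (congr1 ('d K (u s, v s)) ep) _.
  by apply: etrans (linearZZ _ _ _) _; rewrite eK scaler0.
have [ru rv] := uvr t td; have [[_ _ c1] _ _ _ _] := hr _ _ ru rv.
have [ru0 rv0] := uvr 0 h0; have [[_ _ c2] _ _ _ _] := hr _ _ ru0 rv0.
by rewrite -[LHS](chartK atA cA c1) -[RHS](chartK atA cA c2); congr (cinv c _).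
Qed.

Lemma group_quotient_eq a b : mul a (inv b) = e -> a = b.
Proof.
by move=> h; rewrite -[a](group_mule grp) -(group_mulV grp b) (group_mulA grp) h (group_mul1 grp).
Qed.

Lemma smooth_left_field y : smooth_near (X y) p0.
Proof.
apply: smooth_near_apply => //; first exact: (smooth_law atA grp smul cA ce).
  by apply: smooth_near_pair; [exact: smooth_near_id|exact: smooth_near_cst].
exact: smooth_near_cst.
Qed.

Lemma left_field0 y : X y p0 = y.
Proof. by rewrite /X /left_field (diff_law atA grp smul cA ce) add0r. Qed.

(* Differentiate [phi (t + h) = phi t * phi h] in [h]. *)
Lemma one_param_integral_curve (phi : R^o -> G) r : 0 < r ->
  one_param_subgroup A mul phi -> exists2 d, 0 < d &
    integral_curve (derive1 (cfun c \o phi) 0) d (cfun c \o phi) /\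
    forall t, `|t| < d -> cdom c (phi t) /\ `|(cfun c \o phi) t - p0| < r.
Proof.
move=> r0 [sphi phiM]; have phi0 := hom0 grp phiM.
pose w : R^o -> E := cfun c \o phi.
have [cphi _] := sphi.
have [_ hphi] := (smooth_mapP _ atL atA).1 sphi 0.
have cphi0 : cdom c (phi 0) by rewrite phi0.
have sw : smooth_near w 0 by exact: (hphi (Chart setT id id) c).
have w0 : w 0 = p0 by rewrite /w /= phi0.
have dw0 := smooth_near_differentiable sw.
have ew0 (h : R^o) : 'd w 0 h = h *: derive1 w 0.
  by rewrite (derive1E' dw0) -linearZ /= /GRing.scale /= mulr1.
have [r1 r10 hr1] := quotient_invariant.
have n1 : \forall t \near (0 : R^o), cdom c (phi t).
  by apply: cphi; apply: near_cdom ch cphi0.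
have [d1 d10 hd1] := (near_normP _ _).1 n1.
have rr0 : 0 < Num.min r r1 by rewrite lt_min r0.
have [d2 d20 hd2] := (continuous_normP _ _).1 (smooth_near_continuous sw) _ rr0.
exists (Num.min d1 d2); first by rewrite lt_min d10.
have inb (t : R) : `|t| < Num.min d1 d2 -> [/\ cdom c (phi t), `|w t - p0| < r & `|w t - p0| < r1].
  rewrite lt_min => /andP[t1 t2]; split.
  - by apply: hd1; rewrite subr0.
  - by have := hd2 t; rewrite subr0 w0 => /(_ t2); rewrite lt_min => /andP[].
  - by have := hd2 t; rewrite subr0 w0 => /(_ t2); rewrite lt_min => /andP[].
split; last by move=> t /inb[].
move=> t /inb[ct _ wt]; have [_ sm _ _ _] := hr1 _ _ wt wt.
have wtE : cinv c (w t) = phi t by rewrite /w /= (chartK atA cA ct).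
pose f (s : R^o) := m (w t, w (s - t)).
have eqn : \forall s \near (t : R^o), f s = w s.
  have c1 : {for (t : R^o), continuous (fun s : R^o => s - t)}.
    by apply: (@continuousD _ _ _ id (fun=> - t)); [exact: cvg_id|exact: cvg_cst].
  have n2 : \forall s \near (t : R^o), cdom c (phi (s - t)).
    have n1' : \forall s \near (t - t : R^o), cdom c (phi s) by rewrite subrr.
    exact: (c1 _ n1').
  apply: filterS n2 => s cs.
  rewrite /f /m /local_op /= wtE /w /= (chartK atA cA cs) -phiM.
  by rewrite addrC subrK.
have [dsh esh] : is_diff (t : R^o) (fun s : R^o => s - t) id.
  by apply: is_diff_eq; apply/funext => h; rewrite /= -[RHS]addr0 -[X in _ = _ + X]oppr0.
have dw' : differentiable w (t - t) by rewrite subrr.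
have dws : differentiable (fun s : R^o => w (s - t)) t.
  exact: (@differentiable_comp _ _ _ _ (fun s : R^o => s - t) w _ dsh dw').
have ews h : 'd (fun s : R^o => w (s - t)) t h = h *: derive1 w 0.
  apply: etrans (@diff_compE _ _ _ _ (fun s : R^o => s - t) w _ h dsh dw') _.
  apply: etrans (congr1 ('d w (t - t)) (congr1 (@^~ h) esh)) _.
  by rewrite subrr; exact: ew0.
have [dl el] := diff_left (derive1 w 0) sm.
have wtt : w (t - t) = p0 by rewrite subrr.
have dl' : differentiable (fun z : E => m (w t, z)) (w (t - t)) by rewrite wtt.
have df : differentiable f t.
  exact: (@differentiable_comp _ _ _ _ (fun s : R^o => w (s - t)) (fun z : E => m (w t, z)) _ dws dl').
have [dw ew] := near_eq_diff eqn df.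
split; first exact: dw.
move=> h; apply: etrans (congr1 (@^~ h) ew) _.
apply: etrans (@diff_compE _ _ _ _ (fun s : R^o => w (s - t))
  (fun z : E => m (w t, z)) _ h dws dl') _.
apply: etrans (congr1 ('d (fun z : E => m (w t, z)) (w (t - t))) (ews h)) _.
apply: etrans (linearZZ _ _ _) _; congr (h *: _).
by rewrite wtt.
Qed.

(** Near 0 both curves integrate the same left-invariant field from [e], so their quotient is
    constantly [e]. Any [t] is a multiple of a small time, and homomorphisms turn multiples into
    powers. *)
Lemma one_param_unique (phi psi : R^o -> G) :
  one_param_subgroup A mul phi -> one_param_subgroup A mul psi ->
  derive1 (cfun c \o phi) 0 = derive1 (cfun c \o psi) 0 -> phi = psi.
Proof.
move=> sphi spsi ed.
have [r r0 hr] := quotient_invariant.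
have [d1 d10 [i1 h1]] := one_param_integral_curve r0 sphi.
have [d2 d20 [i2 h2]] := one_param_integral_curve r0 spsi.
pose d := Num.min d1 d2; have d0 : 0 < d by rewrite lt_min d10.
have sub1 (t : R) : `|t| < d -> `|t| < d1 by rewrite lt_min => /andP[].
have sub2 (t : R) : `|t| < d -> `|t| < d2 by rewrite lt_min => /andP[].
have local (t : R) : `|t| < d -> phi t = psi t.
  move=> td.
  have j1 : integral_curve (derive1 (cfun c \o phi) 0) d (cfun c \o phi).
    by move=> s /sub1; exact: i1.
  have j2 : integral_curve (derive1 (cfun c \o phi) 0) d (cfun c \o psi).
    by rewrite ed => s /sub2; exact: i2.
  have := quotient_constant hr j1 j2 _ td.
  have phi0 := hom0 grp sphi.2; have psi0 := hom0 grp spsi.2.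
  rewrite /= phi0 psi0 (chartK atA cA ce) (group_mulxV grp).
  rewrite (chartK atA cA (h1 _ (sub1 _ td)).1) (chartK atA cA (h2 _ (sub2 _ td)).1).
  move=> h; apply: group_quotient_eq; apply: h => s sd; split.
    exact: (h1 _ (sub1 _ sd)).2.
  exact: (h2 _ (sub2 _ sd)).2.
apply/funext => t.
have [k hk] := exists_large `|t| d0.
have -> : t = (t / k.+1%:R : R^o) *+ k.+1 by rewrite -[RHS]mulr_natr divfK ?pnatr_eq0.
rewrite (hom_pw grp _ _ sphi.2) (hom_pw grp _ _ spsi.2) local //.
by rewrite normrM normfV normr_nat.
Qed.

(** The integral curve of the left-invariant field from [p0] is a homomorphism for small times,
    hence extends to the line. It is smooth near 0 because it solves a smooth equation, and
    everywhere else by translation. *)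
Lemma one_param_exists y : exists2 g : R^o -> G, one_param_subgroup A mul g &
  derive1 (cfun c \o g) 0 = y.
Proof.
have [r r0 hr] := quotient_invariant.
have [r1 r10 hr1] := (near_normP _ _).1 (smooth_near_nbhs (smooth_left_field y)).
have [d1 d10 [u [u0 hu]]] := picard (smooth_left_field y).
have h0 : `|0 : R| < d1 by rewrite normr0.
have rr0 : 0 < Num.min r r1 by rewrite lt_min r0.
have cu0 : {for (0 : R^o), continuous u} by apply: differentiable_continuous; have [] := hu 0 h0.
have [d2 d20 hd2] := (continuous_normP _ _).1 cu0 _ rr0.
pose d := Num.min d1 d2; have d0 : 0 < d by rewrite lt_min d10.
have inb (t : R) : `|t| < d -> [/\ `|t| < d1, `|u t - p0| < r & `|u t - p0| < r1].
  rewrite lt_min => /andP[t1 t2]; split=> //.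
  - by have := hd2 t; rewrite subr0 u0 => /(_ t2); rewrite lt_min => /andP[].
  - by have := hd2 t; rewrite subr0 u0 => /(_ t2); rewrite lt_min => /andP[].
pose gamma (t : R^o) := cinv c (u t).
(* Times below [d / 2] have their sum in the interval where the curve is controlled. *)
have d2' : 0 < d / 2 by rewrite divr_gt0.
have half (t : R) : `|t| < d / 2 -> `|t| < d.
  by move/lt_trans; apply; rewrite ltr_pdivrMr // ltr_pMr // ltr1n.
have sumd (s t : R) : `|s| < d / 2 -> `|t| < d / 2 -> `|s + t| < d.
  move=> hs ht; apply: le_lt_trans (ler_normD _ _) _.
  by rewrite [d]splitr; exact: ltrD.
(* The curve and its shift by [s] integrate the same field, so [gamma (s + t)] times the inverse of
   [gamma t] keeps its value at [t = 0], which is [gamma s]. *)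
have gM (s t : R^o) : `|s| < d / 2 -> `|t| < d / 2 -> gamma (s + t) = mul (gamma s) (gamma t).
  move=> hs ht.
  have i1 : integral_curve y (d / 2) (fun t => u (s + t)).
    move=> z hz; have [zd1 _ _] := inb _ (sumd _ _ hs hz); have [dz ez] := hu _ zd1.
    have [dsh esh] : is_diff (z : R^o) (fun z : R^o => s + z) id.
      by apply: is_diff_eq; apply/funext => h; rewrite /= -[RHS]add0r.
    split; first exact: (@differentiable_comp _ _ _ _ (fun z : R^o => s + z) u _ dsh dz).
    move=> h; apply: etrans (@diff_compE _ _ _ _ (fun z : R^o => s + z) u _ h dsh dz) _.
    by apply: etrans (congr1 ('d u (s + z)) (congr1 (@^~ h) esh)) _; exact: ez.
  have i2 : integral_curve y (d / 2) u.
    by move=> z /half/inb[zd1 _ _]; exact: hu.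
  have := quotient_constant hr i1 i2 _ ht; rewrite addr0 u0 cinv0.
  rewrite (group_inv1 grp) (group_mule grp) -/(gamma _) -/(gamma _) -/(gamma _) => h.
  rewrite -h; last by move=> z hz; have [_ h1 _] := inb _ (sumd _ _ hs hz);
    have [_ h2 _] := inb _ (half _ hz).
  by rewrite -(group_mulA grp) (group_mulV grp) (group_mule grp).
have [g [ghom gg]] := extend_hom grp d2' gM.
(* The differential equation expresses the derivative of [u] by [X y] at [u], so the regularity of
   [u] rises one order at a time. *)
have su : smooth_near u 0.
  pose V := [set t : R^o | `|t - 0| < d].
  pose W := [set q : R^o * E | `|q.2 - p0| < r1].
  have oV : open V by exact: (open_norm_ball (0 : R^o)).
  have oW : open W.
    apply: (@open_comp _ _ snd [set v : E | `|v - p0| < r1]).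
      by move=> q _; exact: cvg_snd.
    exact: (open_norm_ball p0).
  exists V; split=> //; first by rewrite /V /= subrr normr0.
  apply: (smooth_bootstrap (W := W) (Psi := fun q (h : R^o) => h *: X y q.2) fR fE oV oW).
  - move=> h k; apply: class_C_local => q Wq.
    have : smooth_near (fun q : R^o * E => h *: X y q.2) q.
      apply: smooth_nearZ; first exact: smooth_near_cst.
      apply: (@smooth_near_comp _ _ _ _ snd (X y)) => //; first exact: smooth_near_snd.
      exact: hr1.
    by move=> [Y [oY Yq sY]]; exists Y => //; exact: sY.
  - by move=> t; rewrite /V /= subr0 => /inb[].
  - by move=> t; rewrite /V /= subr0 => /inb[t1 _ _]; have [] := hu t t1.
  - by move=> t h; rewrite /V /= subr0 => /inb[t1 _ _]; have [_] := hu t t1.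
have gcg t : `|t| < d / 2 -> [/\ cdom c (g t), cfun c (g t) = u t & g t = cinv c (u t)].
  move=> td; have [_ h _] := inb _ (half _ td); have [[cu _ _] _ _ _ _] := hr _ _ h h.
  rewrite gg // /gamma; split=> //; first exact: chart_inv_dom ch cu.
  exact: chart_invK.
have near0 P : (forall t : R, `|t| < d / 2 -> P t) -> \forall t \near (0 : R^o), P t.
  by move=> h; apply/near_normP; exists (d / 2) => // t; rewrite subr0; exact: h.
have g0 : g 0 = e by exact: (hom0 grp).
have cg0 : {for (0 : R^o), continuous g}.
  have h : {for (0 : R^o), continuous (fun t => cinv c (u t))}.
    apply: (@continuous_comp _ _ _ u (cinv c)); first exact: cu0.
    by rewrite u0; have [_ _ _ ci _] := ch; apply: ci; exists e.
  have eqn : \forall t \near (0 : R^o), cinv c (u t) = g t.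
    by apply: near0 => t /gcg[].
  move: h; rewrite /prop_for /continuous_at (nbhs_singleton eqn).
  by move=> h; apply: cvg_trans h; exact: near_eq_cvg.
have eqn : \forall t \near (0 : R^o), u t = (cfun c \o g) t.
  by apply: near0 => t /gcg[].
have sg0 : smooth_at (@line_atlas R) A g 0.
  apply: (smooth_at_charts (c := Chart setT id id) (d := c)) => //.
    by rewrite g0.
  exact: smooth_near_eq su.
exists g; last first.
  have [dg eg] := near_eq_diff eqn (smooth_near_differentiable su).
  rewrite (derive1E' dg); apply: etrans (congr1 (@^~ 1) eg) _.
  by have [_ ->] := hu 0 h0; rewrite scale1r u0 left_field0.
split=> //; apply/(smooth_mapP _ atL atA) => t.
have -> : g = (fun s => mul (g t) (g (s - t))).
  by apply/funext => s; rewrite -ghom addrC subrK.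
have sshift : smooth_at (@line_atlas R) (@line_atlas R) (fun s : R^o => s - t) t.
  apply: (smooth_at_charts (c := Chart setT id id) (d := Chart setT id id)) => //.
    by apply: (@continuousD _ _ _ id (fun=> - t)); [exact: cvg_id|exact: cvg_cst].
  by apply: smooth_nearD; [exact: smooth_near_id|exact: smooth_near_cst].
apply: (smooth_at_comp2 (h := mul) fE fE atL atA atA atA) => //.
  exact: smooth_at_cst.
apply: (smooth_at_comp (g := g) fR atL atL sshift).
by rewrite subrr.
Qed.

Lemma one_param_scale (g : R^o -> G) (s : R) : one_param_subgroup A mul g ->
  one_param_subgroup A mul (fun t : R^o => g (s *: t)) /\
  derive1 (cfun c \o (fun t : R^o => g (s *: t))) 0 = s *: derive1 (cfun c \o g) 0.
Proof.
move=> [sg gM]; have [_ hg] := (smooth_mapP _ atL atA).1 sg 0.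
have g0 : g 0 = e by exact: (hom0 grp).
have sw : smooth_near (cfun c \o g) 0.
  by apply: (hg (Chart setT id id) c) => //; rewrite g0.
have dw := smooth_near_differentiable sw.
split; first split.
- apply/(smooth_mapP _ atL atA) => t.
  have ss : smooth_at (@line_atlas R) (@line_atlas R) (fun t : R^o => s *: t) t.
    apply: (smooth_at_charts (c := Chart setT id id) (d := Chart setT id id)) => //.
      by apply: scaler_continuous.
    apply: smooth_nearZ; [exact: smooth_near_cst|exact: smooth_near_id].
  apply: (smooth_at_comp (g := g) fR atL atL ss).
  exact: (smooth_mapP _ atL atA).1.
- by move=> t t'; rewrite scalerDr gM.
have [ds es] : is_diff (0 : R^o) (fun t : R^o => s *: t) (fun t : R^o => s *: t).
  exact: is_diff_scaler.
have dw' : differentiable (cfun c \o g) (s *: (0 : R^o)) by rewrite scaler0.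
have dc : differentiable (cfun c \o (fun t : R^o => g (s *: t))) 0.
  exact: (@differentiable_comp _ _ _ _ (fun t : R^o => s *: t) (cfun c \o g) _ ds dw').
rewrite (derive1E' dc) (derive1E' dw).
apply: etrans (@diff_compE _ _ _ _ (fun t : R^o => s *: t) (cfun c \o g) _ 1 ds dw') _.
apply: etrans (congr1 ('d (cfun c \o g) (s *: 0)) (congr1 (@^~ 1) es)) _.
by apply: etrans (linearZZ _ _ _) _; rewrite scaler0.
Qed.

(** [lie_exp] is a choice: existence rules out its default value, and uniqueness forces every chosen
    subgroup to be the rescaling of the single curve [g]. *)
Lemma lie_exp_curve y : exists2 g : R^o -> G, one_param_subgroup A mul g &
  derive1 (cfun c \o g) 0 = y /\ forall s : R, lie_exp A c mul e (s *: y) = g s.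
Proof.
have [g sg eg] := one_param_exists y; exists g => //; split=> // s.
have [sgs egs] := one_param_scale s sg.
rewrite /lie_exp; case: xgetP => [p _ [h [sh eh <-]]|/(_ (g s)) []]; last first.
  by exists (fun t : R^o => g (s *: t)); split=> //; rewrite ?egs ?eg // /GRing.scale /= mulr1.
have -> : h = (fun t : R^o => g (s *: t)).
  by apply: one_param_unique => //; rewrite egs eg.
by rewrite /GRing.scale /= mulr1.
Qed.

End OneParameter.

(** * Mixed second derivatives of local group laws *)

Section BilinearAlgebra.
Context {K : fieldType} {V : lmodType K}.
Implicit Types B D P : V -> V -> V.

Lemma subr_add_common (a b c : V) : a + b - (a + c) = b - c.
Proof. by rewrite opprD addrACA subrr add0r. Qed.

Lemma bilinear_commutator B : is_bilinear B -> is_bilinear (fun x y => B x y - B y x).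
Proof.
move=> [b1 b2]; split=> [x|y] a u v.
  by rewrite b1 [B (_ + _) x]b2 scalerBr opprD addrACA.
by rewrite /= [B (_ + _) y]b2 b1 scalerBr opprD addrACA.
Qed.

Lemma bilinearBl B x x' y : is_bilinear B -> B (x - x') y = B x y - B x' y.
Proof.
move=> [_ b2]; have := b2 y (-1) x' x; rewrite !scaleN1r [- x' + x]addrC => /= ->.
by rewrite addrC.
Qed.

(** [D] stands for a second derivative of the action that is never computed; being symmetric, it
    disappears on exchanging [x] and [y] and subtracting. *)
Lemma curvature_of_symmetric_defect B P D (z : V) : is_bilinear P ->
  (forall x y, D x y = D y x) ->
  (forall x y, D x y + P (B x y + P x y) z = P x (P y z)) ->
  forall x y, P (B x y - B y x) z = associator P x y z - associator P y x z.
Proof.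
move=> bP symD h x y; rewrite /associator -!h (symD y x) (bilinearBl _ _ _ bP).
have addP a b : P (a + b) z = P a z + P b z.
  by have := (bP.2) z 1 a b; rewrite !scale1r.
by rewrite !addP !addrA !addrK opprD addrACA subrr add0r.
Qed.

End BilinearAlgebra.

(** Each outer product with a commutator is replaced by its expression through [D]; in the cyclic
    sum the terms in [D] cancel by symmetry and the iterated products cancel in pairs. *)
Lemma jacobi_of_symmetric_defect (K : fieldType) n (B : 'rV[K]_n -> 'rV[K]_n -> 'rV[K]_n)
    (D : 'rV[K]_n -> 'rV[K]_n -> 'rV[K]_n -> 'rV[K]_n) : is_bilinear B ->
  (forall z x y, D z x y = D z y x) ->
  (forall x y z, D z x y + B (B x y) z - (D y x z + B (B x z) y) = B x (B y z - B z y)) ->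
  let C x y := B x y - B y x in
  forall x y z, C x (C y z) + C y (C z x) + C z (C x y) = 0.
Proof.
move=> bB symD h C x y z; rewrite /C -!h !(bilinearBl _ _ _ bB).
rewrite (symD z x y) (symD y x z) (symD x z y).
move: (D z y x) (D y z x) (D x y z) => a1 a2 a3.
move: (B (B x y) z) (B (B x z) y) (B (B y z) x) => b1 b2 b3.
move: (B (B y x) z) (B (B z x) y) (B (B z y) x) => b4 b5 b6.
by apply/rowP => i; rewrite !mxE; ring.
Qed.

(** * Calculus of mixed derivatives *)

Section LocalIdentities.
Context {R : realType} {n : nat}.
Local Notation E := 'rV[R]_n.
Let fE := @finite_coords_rV R n.
Let fEE := finite_coords_prod fE fE.

Lemma near_eq_diffE (E1 F : normedModType R) (f g : E1 -> F) x v :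
  (\forall y \near x, f y = g y) -> smooth_near f x -> 'd f x v = 'd g x v.
Proof.
move=> fg /smooth_near_differentiable df.
exact: esym (congr1 (@^~ v) (near_eq_diff fg df).2).
Qed.

Lemma diff_cstE (E1 F : normedModType R) (a : F) (x v : E1) : 'd (fun=> a) x v = 0.
Proof. exact: (congr1 (@^~ v) (diff_cst a x)). Qed.

Lemma diff_idE (E1 : normedModType R) (x v : E1) : 'd (fun y => y) x v = v.
Proof. by have [_ e0] := is_diff_id x; exact: (congr1 (@^~ v) e0). Qed.

Lemma smooth_slice (F : normedModType R) (f : E * E -> F) (g : E -> E) u q :
  smooth_near f (u, g q) -> smooth_near g q ->
  smooth_near (fun w => f (u, g w)) q.
Proof.
move=> sf sg; apply: (@smooth_near_comp _ _ _ _ (fun w => (u, g w)) f) => //.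
by apply: smooth_near_pair => //; exact: smooth_near_cst.
Qed.

Lemma diff_slice (F : normedModType R) (f : E * E -> F) (g : E -> E) u q y :
  smooth_near f (u, g q) -> smooth_near g q ->
  'd (fun w => f (u, g w)) q y = 'd f (u, g q) (0, 'd g q y).
Proof.
move=> sf sg; have dg := smooth_near_differentiable sg.
have dp := differentiable_pair (differentiable_cst u q) dg.
apply: etrans (@diff_compE _ _ _ _ (fun w => (u, g w)) f q y dp
  (smooth_near_differentiable sf)) _.
apply: (congr1 ('d f (u, g q))).
apply: etrans (diff_pairE y (differentiable_cst u q) dg) _.
exact: (congr1 (fun a => (a, _)) (diff_cstE u q y)).
Qed.

Context (p : E).

(** For a law with unit [p] this is the left-invariant field with value [y]; for an action fixing
    [p] it is the linear action of [u] on tangent vectors at [p]. *)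
Definition partial2 (f : E * E -> E) (y u : E) : E := 'd f (u, p) (0, y).

Definition mixed (f : E * E -> E) (x y : E) : E := 'd (partial2 f y) p x.

Lemma smooth_near_slices (f : E * E -> E) : smooth_near f (p, p) ->
  exists2 r, 0 < r & forall u v : E, `|u - p| < r -> `|v - p| < r -> smooth_near f (u, v).
Proof.
move=> /smooth_near_nbhs/near_normP[r r0 hr]; exists r => // u v ur vr.
by apply: hr; exact: (@norm_pair_lt _ _ _ (u, v) (p, p)).
Qed.

Lemma near_slices (P : E * E -> Prop) : (\forall q \near (p, p), P q) ->
  exists2 r, 0 < r & forall u v : E, `|u - p| < r -> `|v - p| < r -> P (u, v).
Proof.
move=> /near_normP[r r0 hr]; exists r => // u v ur vr.
by apply: hr; exact: (@norm_pair_lt _ _ _ (u, v) (p, p)).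
Qed.

Lemma near_of_norm (P : E -> Prop) r : 0 < r ->
  (forall u, `|u - p| < r -> P u) -> \forall u \near p, P u.
Proof. by move=> r0 h; apply/near_normP; exists r. Qed.

Lemma norm_self_lt r : 0 < r -> `|p - p| < r.
Proof. by rewrite subrr normr0. Qed.

Lemma diff_right (f : E * E -> E) u y : smooth_near f (u, p) ->
  'd (fun w => f (u, w)) p y = partial2 f y u.
Proof.
move=> sf; apply: etrans (@diff_slice _ f id u p y sf (smooth_near_id p)) _.
exact: (congr1 (fun a => 'd f (u, p) (0, a)) (diff_idE p y)).
Qed.

Lemma smooth_right (f : E * E -> E) u v : smooth_near f (u, v) ->
  smooth_near (fun w => f (u, w)) v.
Proof. by move=> sf; apply: (@smooth_slice _ f id) => //; exact: smooth_near_id. Qed.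

Lemma smooth_partial2_apply (f : E * E -> E) (h w : E -> E) q :
  smooth_near f (h q, p) -> smooth_near h q -> smooth_near w q ->
  smooth_near (fun u => partial2 f (w u) (h u)) q.
Proof.
move=> sf sh sw.
apply: (@smooth_near_apply _ _ _ _ f (fun u => (h u, p)) (fun u => (0, w u))) => //.
- by apply: smooth_near_pair => //; exact: smooth_near_cst.
- by apply: smooth_near_pair => //; exact: smooth_near_cst.
Qed.

Lemma smooth_partial2 (f : E * E -> E) y u : smooth_near f (u, p) ->
  smooth_near (partial2 f y) u.
Proof.
move=> sf; apply: (@smooth_partial2_apply f id (fun=> y)) => //.
  exact: smooth_near_id.
exact: smooth_near_cst.
Qed.

Lemma partial2D f y z u : partial2 f (y + z) u = partial2 f y u + partial2 f z u.
Proof.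
rewrite /partial2 -linearD; congr ('d f (u, p) _).
by congr pair; rewrite /= addr0.
Qed.

Lemma partial2Z f a y u : partial2 f (a *: y) u = a *: partial2 f y u.
Proof.
rewrite /partial2 -linearZZ; congr ('d f (u, p) _).
by congr pair; rewrite /= scaler0.
Qed.

Lemma partial2N f y u : partial2 f (- y) u = - partial2 f y u.
Proof. by rewrite -scaleN1r partial2Z scaleN1r. Qed.

Lemma partial2B f y z u : partial2 f (y - z) u = partial2 f y u - partial2 f z u.
Proof. by rewrite partial2D partial2N. Qed.

Lemma partial2_linear f u : linear (fun y => partial2 f y u).
Proof. by move=> a y z; rewrite partial2D partial2Z. Qed.

Lemma diff_partial2_aux (f : E * E -> E) (h w : E -> E) q x :
  smooth_near f (p, p) -> h q = p -> smooth_near h q -> smooth_near w q ->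
  'd (fun u => partial2 f (w u) (h u)) q x =
  d2 f (p, p) ('d h q x, 0) (0, w q) + partial2 f ('d w q x) p.
Proof.
move=> sf hq sh sw.
have sh' : smooth_near (fun u => (h u, p)) q.
  by apply: smooth_near_pair => //; exact: smooth_near_cst.
have sw' : smooth_near (fun u => ((0 : E), w u)) q.
  by apply: smooth_near_pair => //; exact: smooth_near_cst.
have sf' : smooth_near f (h q, p) by rewrite hq.
apply: etrans (@diff_apply _ _ _ _ f (fun u => (h u, p)) (fun u => (0, w u)) q x fEE sf' sh' sw') _.
have eh : 'd (fun u => (h u, p)) q x = ('d h q x, 0).
  apply: etrans (diff_pairE x (smooth_near_differentiable sh) (differentiable_cst p q)) _.
  exact: (congr1 (pair _) (diff_cstE p q x)).
have ew : 'd (fun u => ((0 : E), w u)) q x = (0, 'd w q x).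
  apply: etrans (diff_pairE x (differentiable_cst (0 : E) q) (smooth_near_differentiable sw)) _.
  exact: (congr1 (fun a => (a, _)) (diff_cstE (0 : E) q x)).
apply: etrans (f_equal2 +%R (congr1 (fun a => d2 f (h q, p) a (0, w q)) eh)
  (congr1 ('d f (h q, p)) ew)) _.
by rewrite hq.
Qed.

Lemma mixedE (f : E * E -> E) x y : smooth_near f (p, p) ->
  mixed f x y = d2 f (p, p) (x, 0) (0, y).
Proof.
move=> sf; apply: etrans (@diff_partial2_aux f id (fun=> y) p x sf erefl
  (smooth_near_id p) (smooth_near_cst y p)) _.
have -> : partial2 f ('d (fun=> y) p x) p = 0.
  apply: etrans (congr1 (fun a => partial2 f a p) (diff_cstE y p x)) _.
  exact: (linear0 ('d f (p, p))).
rewrite addr0; exact: (congr1 (fun a => d2 f (p, p) (a, 0) (0, y)) (diff_idE p x)).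
Qed.

(* The mixed second derivative is computed by differentiating [w u] and the
   base point [h u] separately. *)
Lemma diff_partial2_apply (f : E * E -> E) (h w : E -> E) q x :
  smooth_near f (p, p) -> h q = p -> smooth_near h q -> smooth_near w q ->
  'd (fun u => partial2 f (w u) (h u)) q x =
  mixed f ('d h q x) (w q) + partial2 f ('d w q x) p.
Proof. by move=> sf hq sh sw; rewrite mixedE //; exact: diff_partial2_aux. Qed.

Lemma mixedDl f x x' y : mixed f (x + x') y = mixed f x y + mixed f x' y.
Proof. exact: linearD. Qed.

Lemma mixedZl f a x y : mixed f (a *: x) y = a *: mixed f x y.
Proof. exact: linearZZ. Qed.

Lemma mixedNl f x y : mixed f (- x) y = - mixed f x y.
Proof. exact: linearN. Qed.

Lemma mixedDr f x y y' : smooth_near f (p, p) ->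
  mixed f x (y + y') = mixed f x y + mixed f x y'.
Proof.
move=> sf; rewrite !mixedE //.
have -> : ((0, y + y') : E * E) = (0, y) + (0, y') by congr pair; rewrite /= addr0.
rewrite /d2; have -> : (fun u => 'd f u ((0, y) + (0, y'))) =
  (fun u => 'd f u (0, y)) + (fun u => 'd f u (0, y')).
  by apply/funext => u; exact: linearD.
have d1 := smooth_near_differentiable (smooth_near_diff (0, y) sf).
have d2' := smooth_near_differentiable (smooth_near_diff (0, y') sf).
exact: (congr1 (@^~ _) (diffD d1 d2')).
Qed.

Lemma mixedZr f a x y : smooth_near f (p, p) ->
  mixed f x (a *: y) = a *: mixed f x y.
Proof.
move=> sf; rewrite !mixedE //.
have -> : ((0, a *: y) : E * E) = a *: (0, y) by congr pair; rewrite /= scaler0.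
rewrite /d2; have -> : (fun u => 'd f u (a *: (0, y))) = a \*: (fun u => 'd f u (0, y)).
  by apply/funext => u; exact: linearZZ.
have d1 := smooth_near_differentiable (smooth_near_diff (0, y) sf).
exact: (congr1 (@^~ _) (diffZ a d1)).
Qed.

Lemma mixedNr f x y : smooth_near f (p, p) -> mixed f x (- y) = - mixed f x y.
Proof. by move=> sf; rewrite -scaleN1r mixedZr // scaleN1r. Qed.

Lemma mixed_bilinear f : smooth_near f (p, p) -> is_bilinear (mixed f).
Proof.
move=> sf; split=> [x|y] a u v; first by rewrite mixedDr // mixedZr.
by rewrite /= mixedDl mixedZl.
Qed.

Definition commutator (f : E * E -> E) (x y : E) : E := mixed f x y - mixed f y x.

Lemma commutator_bilinear f : smooth_near f (p, p) -> is_bilinear (commutator f).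
Proof. by move=> sf; exact: bilinear_commutator (mixed_bilinear sf). Qed.

Lemma smooth_bilinear (B : E -> E -> E) (a b : E -> E) q : is_bilinear B ->
  smooth_near a q -> smooth_near b q ->
  smooth_near (fun w => B (a w) (b w)) q /\
  forall x, 'd (fun w => B (a w) (b w)) q x = B ('d a q x) (b q) + B (a q) ('d b q x).
Proof.
move=> [B1 B2] sa sb; have [k [d [phi [cphi ed]]]] := fE.
pose l1 u : {linear E -> E} := HB.pack (B u) (GRing.isLinear.Build R E E _ _ (B1 u)).
pose l2 v : {linear E -> E} := HB.pack (B^~ v) (GRing.isLinear.Build R E E _ _ (B2 v)).
have c1 u : continuous (l1 u) by exact: continuous_linear_finite_coords.
have c2 v : continuous (l2 v) by exact: continuous_linear_finite_coords.
have sB z : smooth_near (fun q : E * E => B q.1 q.2) z.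
  have -> : (fun q : E * E => B q.1 q.2) = (fun q => \sum_i phi i q.1 *: B (d i) q.2).
    apply/funext => z'; rewrite [in LHS](ed z'.1).
    rewrite -[LHS]/(l2 z'.2 _) linear_sum; apply: eq_bigr => i _.
    by rewrite linearZ.
  apply: smooth_near_sum => i; apply: smooth_nearZ.
    apply: (@smooth_near_comp _ _ _ _ fst (phi i)) => //; first exact: smooth_near_fst.
    exact: smooth_near_linear.
  apply: (@smooth_near_comp _ _ _ _ snd (l1 (d i))) => //; first exact: smooth_near_snd.
  exact: smooth_near_linear.
have sab := smooth_near_pair sa sb.
split; first exact: (@smooth_near_comp _ _ _ _ (fun w => (a w, b w)) (fun q : E * E => B q.1 q.2)).
move=> x; have dB := smooth_near_differentiable (sB (a q, b q)).
apply: etrans (@diff_compE _ _ _ _ (fun w => (a w, b w)) (fun q : E * E => B q.1 q.2)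
  q x (smooth_near_differentiable sab) dB) _.
have da := smooth_near_differentiable sa; have db := smooth_near_differentiable sb.
apply: etrans (congr1 ('d (fun q : E * E => B q.1 q.2) (a q, b q)) (diff_pairE x da db)) _.
apply: etrans (diff_partial _ _ dB) _; congr (_ + _).
  exact: (@diff_linear_eq _ _ _ (l2 (b q))).
exact: (@diff_linear_eq _ _ _ (l1 (a q))).
Qed.

End LocalIdentities.

(** * Jacobi, derivation and curvature identities for local laws and actions *)

Section LocalGroup.
Context {R : realType} {n : nat}.
Local Notation E := 'rV[R]_n.
Let fE := @finite_coords_rV R n.
Let fEE := finite_coords_prod fE fE.
Context {p : E} {m : E * E -> E} (sm : smooth_near m (p, p)).
Context (mr : \forall u \near p, m (u, p) = u) (ml : \forall u \near p, m (p, u) = u).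

Local Notation X := (partial2 p m).
Local Notation B := (mixed p m).
Local Notation br := (commutator p m).

Lemma partial2_left_unit (f : E * E -> E) y : smooth_near f (p, p) ->
  (\forall u \near p, f (p, u) = u) -> partial2 p f y p = y.
Proof.
move=> sf h; rewrite -(diff_right y sf).
apply: etrans (near_eq_diffE y h (smooth_right sf)) _.
exact: diff_idE.
Qed.

Lemma X0 y : X y p = y. Proof. exact: partial2_left_unit. Qed.

Lemma m_pp : m (p, p) = p. Proof. exact: nbhs_singleton mr. Qed.

Section Jacobi.
Context (mA : \forall q \near (p, p), \forall w \near p,
  m (m q, w) = m (q.1, m (q.2, w))).

(* [X y] is related to itself by left translations; differentiating the relation
   at the identity gives the bracket of left-invariant fields. *)
Lemma bracket_left_fields y z : \forall u \near p,
  'd (X z) u (X y u) - 'd (X y) u (X z u) = X (br y z) u.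
Proof.
have [r r0 hr] := smooth_near_slices sm.
have [r1 r10 hr1] := near_slices mA.
have [r2 r20 hr2] := (near_normP _ _).1 mr.
have m_near : \forall q \near (p, p), `|m q - p| < Num.min r r2.
  have := smooth_near_continuous sm; move/continuous_normP.
  have rr : 0 < Num.min r r2 by rewrite lt_min r0.
  move=> /(_ _ rr)[r3 r30 hr3]; apply/near_normP; exists r3 => // q /hr3.
  by rewrite m_pp.
have [r3 r30 hr3] := near_slices m_near.
apply: (near_of_norm (r := Num.min r (Num.min r1 (Num.min r2 r3)))).
  by rewrite !lt_min r0 r10 r20.
move=> u; rewrite !lt_min => /and4P[u0 u1 u2 u3].
have sup : smooth_near m (u, p) by apply: hr => //; exact: norm_self_lt.
(* Invariance of the field under left translation by [u]: associativity differentiated in its last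
   variable. *)
have left_inv z' : \forall v \near p, X z' (m (u, v)) = 'd (fun w => m (u, w)) v (X z' v).
  apply: (near_of_norm (r := Num.min r (Num.min r1 (Num.min r2 r3)))).
    by rewrite !lt_min r0 r10 r20.
  move=> v; rewrite !lt_min => /and4P[v0 v1 v2 v3].
  have muv := hr3 u v u3 v3; rewrite lt_min in muv; move/andP: muv => [muv _].
  have s1 : smooth_near m (m (u, v), p) by apply: hr => //; exact: norm_self_lt.
  have s2 : smooth_near m (v, p) by apply: hr => //; exact: norm_self_lt.
  have mv : m (v, p) = v by exact: hr2.
  have s3 : smooth_near (fun w => m (u, w)) (m (v, p)).
    by rewrite mv; apply: smooth_right; exact: hr.
  rewrite -(diff_right z' s1).
  apply: etrans (near_eq_diffE z' (hr1 u v u1 v1) (smooth_right s1)) _.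
  apply: etrans (@diff_compE _ _ _ _ (fun w => m (v, w)) (fun w => m (u, w)) p z'
    (smooth_near_differentiable (smooth_right s2)) (smooth_near_differentiable s3)) _.
  apply: etrans (congr1 ('d (fun w => m (u, w)) (m (v, p))) (diff_right z' s2)) _.
  by rewrite mv.
have mu : m (u, p) = u by exact: hr2.
(* Differentiating the invariance at [v = p] produces a second derivative of the translation by [u],
   symmetric in [y'] and [z']; it cancels in the bracket of the two fields. *)
have key y' z' : 'd (X z') u (X y' u) = d2 (fun w => m (u, w)) p y' z' + X (B y' z') u.
  have sXu : smooth_near (X z') (m (u, p)) by rewrite mu; exact: smooth_partial2.
  have sXp : smooth_near (X z') p by exact: smooth_partial2.
  have sF : smooth_near (fun v => X z' (m (u, v))) p.
    exact: (@smooth_near_comp _ _ _ _ (fun v => m (u, v)) (X z') p fE (smooth_right sup) sXu).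
  have e1 := near_eq_diffE y' (left_inv z') sF.
  have e2 := @diff_compE _ _ _ _ (fun v => m (u, v)) (X z') p y'
    (smooth_near_differentiable (smooth_right sup)) (smooth_near_differentiable sXu).
  have e3 : 'd (fun v => X z' (m (u, v))) p y' = 'd (X z') u (X y' u).
    apply: etrans e2 _; apply: etrans (congr1 ('d (X z') (m (u, p))) (diff_right y' sup)) _.
    by rewrite mu.
  have e4 := @diff_apply _ _ _ _ (fun w => m (u, w)) id (X z') p y' fE
    (smooth_right sup) (smooth_near_id p) sXp.
  rewrite -e3; apply: etrans e1 _; apply: etrans e4 _; congr (_ + _).
    apply: etrans (congr1 (fun a => d2 (fun w => m (u, w)) p a (X z' p)) (diff_idE p y')) _.
    exact: (congr1 (d2 (fun w => m (u, w)) p y') (X0 z')).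
  exact: diff_right.
have es := d2_sym z y fE (smooth_right sup).
apply: etrans (f_equal2 (fun a b => a - b) (key y z) (key z y)) _.
apply: etrans (congr1 (fun a => _ - (a + X (B z y) u)) es) _.
apply: etrans (subr_add_common _ _ _) _.
exact: esym (partial2B p m (B y z) (B z y) u).
Qed.

(** The bracket relation between fields, differentiated once more at [p] along [x]. The terms in
    [d2] contain third derivatives of the law and are left as they are, only their symmetry being
    used afterwards. *)
Lemma mixed_bracket x y z :
  d2 (X z) p x y + B (B x y) z - (d2 (X y) p x z + B (B x z) y) = B x (br y z).
Proof.
have sX w : smooth_near (X w) p by exact: smooth_partial2.
have term y' z' : smooth_near (fun u => 'd (X z') u (X y' u)) p /\
   'd (fun u => 'd (X z') u (X y' u)) p x = d2 (X z') p x y' + B (B x y') z'.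
  split; first exact: (@smooth_near_apply _ _ _ _ (X z') id (X y') p fE (sX z') (smooth_near_id p) (sX y')).
  apply: etrans (@diff_apply _ _ _ _ (X z') id (X y') p x fE (sX z') (smooth_near_id p) (sX y')) _.
  congr (_ + _); apply: etrans (congr1 (fun a => d2 (X z') p a (X y' p)) (diff_idE p x)) _.
  exact: (congr1 (d2 (X z') p x) (X0 y')).
have [s1 e1] := term y z; have [s2 e2] := term z y.
have s12 : smooth_near (fun u => 'd (X z) u (X y u) - 'd (X y) u (X z u)) p.
  apply: smooth_nearD => //.
  apply: (@smooth_near_comp _ _ _ _ _ -%R) => //.
  by apply: (@smooth_near_linear _ _ _ -%R) => v; exact: opp_continuous.
have h := near_eq_diffE x (bracket_left_fields y z) s12.
apply: etrans (f_equal2 (fun a b => a - b) (esym e1) (esym e2)) _.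
apply: etrans _ h.
exact: esym (congr1 (@^~ x) (diffB (smooth_near_differentiable s1) (smooth_near_differentiable s2))).
Qed.

Lemma jacobi x y z : br x (br y z) + br y (br z x) + br z (br x y) = 0.
Proof.
apply: (jacobi_of_symmetric_defect (mixed_bilinear sm) (D := fun w => d2 (X w) p)).
  by move=> w a b; apply: d2_sym => //; exact: smooth_partial2.
exact: mixed_bracket.
Qed.

End Jacobi.

Context {tau : E * E -> E} (st : smooth_near tau (p, p)).
Context (tr : \forall u \near p, tau (u, p) = p).
Context (tl : \forall u \near p, tau (p, u) = u).
Local Notation Y := (partial2 p tau).
Local Notation P := (mixed p tau).

Lemma Y0 y : Y y p = y. Proof. exact: partial2_left_unit. Qed.

(** For fixed [w], [tau (w, _)] is a local automorphism fixing [p], and it carries the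
    left-invariant field of [y] to that of [Y y w]. Differentiating this at [p] and antisymmetrizing
    shows that its differential preserves the bracket. *)
Lemma automorphism_bracket x y :
  (\forall w \near p, \forall q \near (p, p),
    tau (w, m q) = m (tau (w, q.1), tau (w, q.2))) ->
  \forall w \near p, Y (br x y) w = br (Y x w) (Y y w).
Proof.
move=> aut.
have [r r0 hr] := smooth_near_slices st.
have [r1 r10 hr1] := smooth_near_slices sm.
have sp : \forall w \near p, `|w - p| < r by apply: near_of_norm r0 _.
apply: filterS3 aut sp tr => w autw wr tw.
have swp : smooth_near tau (w, p) by apply: hr => //; exact: norm_self_lt.
have stw := smooth_right swp.
have [r2 r20 hr2] := near_slices autw.
have [r3 r30 hr3] := (near_normP _ _).1 mr.
have t_near : \forall u \near p, `|tau (w, u) - p| < r1.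
  have := smooth_near_continuous stw; move/continuous_normP/(_ _ r10).
  by rewrite tw => -[r4 r40 h4]; apply/near_normP; exists r4.
have [r4 r40 hr4] := (near_normP _ _).1 t_near.
pose t := fun u => tau (w, u).
have related y' : \forall u \near p, 'd t u (X y' u) = X (Y y' w) (t u).
  apply: (near_of_norm (r := Num.min (Num.min r r1) (Num.min r2 (Num.min r3 r4)))).
    by rewrite !lt_min r0 r10 r20 r30.
  move=> u; rewrite !lt_min => /and3P[/andP[u0 u1] u2 /andP[u3 u4]].
  have mu : m (u, p) = u by exact: hr3.
  have s1 : smooth_near m (u, p) by apply: hr1 => //; exact: norm_self_lt.
  have s2 : smooth_near t (m (u, p)) by rewrite mu; apply: smooth_right; exact: hr.
  have s3 : smooth_near m (t u, t p).
    by rewrite /t tw; apply: hr1; [exact: hr4|exact: norm_self_lt].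
  have h : \forall v \near p, t (m (u, v)) = m (t u, t v).
    by apply: (near_of_norm (r := r2)) => // v vr; exact: (hr2 u v).
  have sF := @smooth_near_comp _ _ _ _ (fun v => m (u, v)) t p fE (smooth_right s1) s2.
  have e1 := near_eq_diffE y' h sF.
  have e2 := @diff_compE _ _ _ _ (fun v => m (u, v)) t p y'
    (smooth_near_differentiable (smooth_right s1)) (smooth_near_differentiable s2).
  have e3 : 'd (fun v => t (m (u, v))) p y' = 'd t u (X y' u).
    apply: etrans e2 _; apply: etrans (congr1 ('d t (m (u, p))) (diff_right y' s1)) _.
    by rewrite mu.
  rewrite -e3; apply: etrans e1 _; apply: etrans (diff_slice y' s3 stw) _.
  rewrite (diff_right y' swp) /t tw.
  by [].
(* The second derivative of [t] is again symmetric and vanishes on exchanging [x'] and [y']. *)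
have key x' y' : d2 t p x' y' + Y (B x' y') w = B (Y x' w) (Y y' w).
  have sX v : smooth_near (X v) p by exact: smooth_partial2.
  have e1 := @diff_apply _ _ _ _ t id (X y') p x' fE stw (smooth_near_id p) (sX y').
  have s1 := @smooth_near_apply _ _ _ _ t id (X y') p fE stw (smooth_near_id p) (sX y').
  have e2 := near_eq_diffE x' (related y') s1.
  have sXt : smooth_near (X (Y y' w)) (t p) by rewrite /t tw.
  have e3 := @diff_compE _ _ _ _ t (X (Y y' w)) p x'
    (smooth_near_differentiable stw) (smooth_near_differentiable sXt).
  have e4 : 'd (fun u => X (Y y' w) (t u)) p x' = B (Y x' w) (Y y' w).
    apply: etrans e3 _.
    apply: etrans (congr1 ('d (X (Y y' w)) (t p)) (diff_right x' swp)) _.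
    by rewrite /t tw.
  rewrite -e4 -e2; apply: esym; apply: etrans e1 _; congr (_ + _).
    apply: etrans (congr1 (fun a => d2 t p a (X y' p)) (diff_idE p x')) _.
    exact: (congr1 (d2 t p x') (X0 y')).
  exact: diff_right.
have es := d2_sym y x fE stw.
apply: etrans _ (f_equal2 (fun a b => a - b) (key x y) (key y x)).
apply: esym; apply: etrans (congr1 (fun a => _ - (a + Y (B y x) w)) es) _.
apply: etrans (subr_add_common _ _ _) _.
exact: esym (partial2B p tau (B x y) (B y x) w).
Qed.

(** Differentiates, at [w = p] where [Y _ w] is the identity, a family of bracket-preserving linear
    maps. *)
Lemma derivation_bracket x y z :
  (\forall w \near p, \forall q \near (p, p),
    tau (w, m q) = m (tau (w, q.1), tau (w, q.2))) ->
  P z (br x y) = br (P z x) y + br x (P z y).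
Proof.
move=> /(automorphism_bracket x y) h.
have sY v : smooth_near (Y v) p by exact: smooth_partial2.
have [_ e] := smooth_bilinear (commutator_bilinear sm) (sY x) (sY y).
apply: etrans (near_eq_diffE z h (sY _)) _.
by rewrite e !Y0.
Qed.

(** The action law is differentiated in its three variables, starting from the last. The
    Grossman-Larson product in its first argument contributes [P x y] besides [B x y], and this is
    where the associators come from. *)
Lemma curvature x y z :
  (\forall q \near (p, p), \forall w \near p,
     tau (m (q.1, tau q), w) = tau (q.1, tau (q.2, w))) ->
  P (br x y) z = associator P x y z - associator P y x z.
Proof.
move=> act.
have [r r0 hr] := smooth_near_slices st.
have [r1 r10 hr1] := smooth_near_slices sm.
have [r2 r20 hr2] := near_slices act.
have [r3 r30 hr3] := (near_normP _ _).1 mr.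
have [r4 r40 hr4] := (near_normP _ _).1 tr.
have tpp : tau (p, p) = p by exact: nbhs_singleton tr.
pose g (q : E * E) := m (q.1, tau q).
have sg : smooth_near g (p, p).
  apply: (@smooth_near_comp _ _ _ _ (fun q : E * E => (q.1, tau q)) m) => //.
    by apply: smooth_near_pair => //; exact: smooth_near_fst.
  by rewrite tpp.
have [r5 r50 hr5] := smooth_near_slices sg.
have g_near : \forall q \near (p, p), `|g q - p| < r.
  have := smooth_near_continuous sg; move/continuous_normP/(_ _ r0) => -[r6 r60 h6].
  by apply/near_normP; exists r6 => // q /h6; rewrite /g /= tpp m_pp.
have [r6 r60 hr6] := near_slices g_near.
have sY v : smooth_near (Y v) p by exact: smooth_partial2.
have n0 := norm_self_lt p.
(* The left-invariant field of the Grossman-Larson law [g], obtained by the chain rule from those of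
   [m] and the linear action [Y]. *)
pose N y' u := X (Y y' u) u.
have first y' : \forall u \near p, 'd (Y z) u (N y' u) = Y (P y' z) u.
  apply: (near_of_norm (r := Num.min (Num.min r r1)
     (Num.min r2 (Num.min r3 (Num.min r4 (Num.min r5 r6)))))).
    by rewrite !lt_min r0 r10 r20 r30 r40 r50.
  move=> u; rewrite !lt_min => /and3P[/andP[u0 u1] u2 /and4P[u3 u4 u5 u6]].
  have sup : smooth_near tau (u, p) by apply: hr => //; exact: n0.
  have mup : smooth_near m (u, p) by apply: hr1 => //; exact: n0.
  have gup : smooth_near g (u, p) by apply: hr5 => //; exact: n0.
  have tu : tau (u, p) = p by exact: hr4.
  have gu : g (u, p) = u by rewrite /g /= tu; exact: hr3.
  have h : \forall v \near p, Y z (g (u, v)) = Y (Y z v) u.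
    apply: (near_of_norm (r := Num.min (Num.min r r4) (Num.min r2 r6))).
      by rewrite !lt_min r0 r40 r20.
    move=> v; rewrite !lt_min => /andP[/andP[v0 v4] /andP[v2 v6]].
    have s1 : smooth_near tau (g (u, v), p) by apply: hr; [exact: hr6|exact: n0].
    have s2 : smooth_near tau (v, p) by apply: hr => //; exact: n0.
    have tv : tau (v, p) = p by exact: hr4.
    have s3 : smooth_near tau (u, tau (v, p)) by rewrite tv.
    rewrite -(diff_right z s1).
    apply: etrans (near_eq_diffE z (hr2 u v u2 v2) (smooth_right s1)) _.
    apply: etrans (@diff_slice _ _ _ tau (fun w => tau (v, w)) u p z s3 (smooth_right s2)) _.
    by rewrite (diff_right z s2) tv.
  have sYg : smooth_near (Y z) (g (u, p)) by rewrite gu; exact: smooth_partial2.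
  have sF := @smooth_near_comp _ _ _ _ (fun v => g (u, v)) (Y z) p fE (smooth_right gup) sYg.
  have e1 := near_eq_diffE y' h sF.
  have e2 := @diff_compE _ _ _ _ (fun v => g (u, v)) (Y z) p y'
    (smooth_near_differentiable (smooth_right gup)) (smooth_near_differentiable sYg).
  have mup' : smooth_near m (u, tau (u, p)) by rewrite tu.
  have e3 : 'd (fun v => g (u, v)) p y' = N y' u.
    apply: etrans (@diff_slice _ _ _ m (fun v => tau (u, v)) u p y' mup' (smooth_right sup)) _.
    by rewrite (diff_right y' sup) tu.
  have e4 : 'd (fun v => Y z (g (u, v))) p y' = 'd (Y z) u (N y' u).
    by apply: etrans e2 _; apply: etrans (congr1 ('d (Y z) (g (u, p))) e3) _; rewrite gu.
  rewrite -e4; apply: etrans e1 _.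
  pose l : {linear E -> E} := HB.pack (fun y => Y y u)
    (GRing.isLinear.Build R E E _ _ (@partial2_linear _ _ p tau u)).
  have cl : continuous l by exact: continuous_linear_finite_coords.
  apply: etrans (@diff_compE _ _ _ _ (Y z) l p y'
    (smooth_near_differentiable (sY z)) (linear_differentiable _ cl)) _.
  exact: (@diff_linear_eq _ _ _ l).
have sN y' : smooth_near (N y') p.
  by apply: smooth_partial2_apply => //; exact: smooth_near_id.
have eN x' y' : 'd (N y') p x' = B x' y' + P x' y'.
  apply: etrans (@diff_partial2_apply _ _ p m id (Y y') p x' sm erefl (smooth_near_id p) (sY y')) _.
  rewrite Y0 X0; congr (_ + _).
  exact: (congr1 (fun a => B a y') (diff_idE p x')).
(* The differential of [N y'] at [p] is [B x' y' + P x' y'], the mixed derivative of the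
   Grossman-Larson law; the term in [d2] is the symmetric defect. *)
have key x' y' : d2 (Y z) p x' y' + P (B x' y' + P x' y') z = P x' (P y' z).
  have s1 := @smooth_near_apply _ _ _ _ (Y z) id (N y') p fE (sY z) (smooth_near_id p) (sN y').
  have e1 := @diff_apply _ _ _ _ (Y z) id (N y') p x' fE (sY z) (smooth_near_id p) (sN y').
  have e2 := near_eq_diffE x' (first y') s1.
  apply: esym; apply: etrans (esym e2) _; apply: etrans e1 _; congr (_ + _).
    apply: etrans (congr1 (fun a => d2 (Y z) p a (N y' p)) (diff_idE p x')) _.
    exact: (congr1 (d2 (Y z) p x') (etrans (X0 (Y y' p)) (Y0 y'))).
  exact: (congr1 (fun a => P a z) (eN x' y')).
apply: (curvature_of_symmetric_defect (mixed_bilinear st) (D := d2 (Y z) p)) => //.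
by move=> a b; apply: d2_sym.
Qed.

End LocalGroup.

(** * Second-order consequences of the compatibility of two actions *)

Section Commutation.
Context {R : realType} {n : nat}.
Local Notation E := 'rV[R]_n.
Let fE := @finite_coords_rV R n.
Let fEE := finite_coords_prod fE fE.
Context {p : E}.

Lemma near_preimage (E1 E2 : normedModType R) (h : E1 -> E2) q (P : E2 -> Prop) :
  {for q, continuous h} -> (\forall x \near h q, P x) -> \forall x \near q, P (h x).
Proof. by move=> ch nP; exact: (ch [set x | P x] nP). Qed.

Lemma mixed_near_eq (f g : E * E -> E) x y : smooth_near f (p, p) ->
  (\forall q \near (p, p), f q = g q) -> mixed p f x y = mixed p g x y.
Proof.
move=> sf fg.
have n1 : \forall q \near (p, p), 'd f q (0, y) = 'd g q (0, y).
  have := near_join fg; have := smooth_near_nbhs sf; apply: filterS2 => q sq fgq.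
  exact: near_eq_diffE.
have n2 : \forall u \near p, partial2 p f y u = partial2 p g y u.
  have c1 : {for p, continuous (fun u : E => (u, p))}.
    apply: smooth_near_continuous.
    by apply: smooth_near_pair; [exact: smooth_near_id|exact: smooth_near_cst].
  exact: (near_preimage (h := fun u : E => (u, p)) c1 n1).
by apply: near_eq_diffE n2 _; exact: smooth_partial2.
Qed.

(** Exchanging the variables of [f] exchanges the order of its two differentiations, which is
    harmless by symmetry of second derivatives. *)
Lemma mixed_swap (f : E * E -> E) x y : smooth_near f (p, p) ->
  mixed p (fun q => f (q.2, q.1)) x y = mixed p f y x.
Proof.
move=> sf; pose s (q : E * E) := (q.2, q.1).
have ss q : smooth_near s q.
  by apply: smooth_near_pair; [exact: smooth_near_snd|exact: smooth_near_fst].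
have es (q v : E * E) : 'd s q v = (v.2, v.1).
  have lin : linear s by [].
  pose l : {linear (E * E)%type -> (E * E)%type} := HB.pack s
    (GRing.isLinear.Build R (E * E)%type (E * E)%type _ _ lin).
  apply: (@diff_linear_eq _ _ _ l); exact: continuous_linear_finite_coords.
have sfs : smooth_near (fun q => f (s q)) (p, p).
  exact: (@smooth_near_comp _ _ _ _ s f).
rewrite mixedE // mixedE // (d2_sym _ _ fE sf).
have n1 : \forall q \near (p, p), 'd (fun q => f (s q)) q (0, y) = 'd f (s q) (y, 0).
  have cs := smooth_near_continuous (ss (p, p)).
  have := near_preimage cs (smooth_near_nbhs sf); apply: filterS => q sq.
  apply: etrans (@diff_compE _ _ _ _ s f q (0, y)
    (smooth_near_differentiable (ss q)) (smooth_near_differentiable sq)) _.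
  exact: (congr1 ('d f (s q)) (es q (0, y))).
have s1 := smooth_near_diff (0, y) sfs.
apply: etrans (near_eq_diffE (x, 0) n1 s1) _.
have sfp : smooth_near f (s (p, p)) by [].
apply: etrans (@diff_apply _ _ _ _ f s (fun=> (y, 0)) (p, p) (x, 0) fEE sfp
  (ss (p, p)) (smooth_near_cst _ _)) _.
have -> : 'd f (s (p, p)) ('d (fun=> ((y, 0) : E * E)) ((p, p) : E * E) (x, 0)) = 0.
  apply: etrans (congr1 ('d f (s (p, p))) (diff_cstE _ _ _)) _.
  exact: (linear0 ('d f (s (p, p)))).
rewrite addr0.
exact: (congr1 (fun a => d2 f (p, p) a (y, 0)) (es (p, p) (x, 0))).
Qed.

Context {t1 t2 : E * E -> E} {s1 : E -> E}.
Context (st1 : smooth_near t1 (p, p)) (st2 : smooth_near t2 (p, p)).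
Context (tr1 : \forall u \near p, t1 (u, p) = p) (tr2 : \forall u \near p, t2 (u, p) = p).
Context (tl1 : \forall u \near p, t1 (p, u) = u) (tl2 : \forall u \near p, t2 (p, u) = u).
Context (ss1 : smooth_near s1 p) (s1p : s1 p = p) (ds1 : forall x, 'd s1 p x = - x).
Local Notation Y1 := (partial2 p t1).
Local Notation Y2 := (partial2 p t2).
Local Notation P1 := (mixed p t1).
Local Notation P2 := (mixed p t2).

Lemma diff_partial2_s1 (t : E * E -> E) (st : smooth_near t (p, p)) y x :
  smooth_near (fun u => partial2 p t y (s1 u)) p /\
  'd (fun u => partial2 p t y (s1 u)) p x = - mixed p t x y.
Proof.
have sY : smooth_near (partial2 p t y) (s1 p) by rewrite s1p; exact: smooth_partial2.
split; first exact: (@smooth_near_comp _ _ _ _ s1 (partial2 p t y)).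
apply: etrans (@diff_compE _ _ _ _ s1 (partial2 p t y) p x
  (smooth_near_differentiable ss1) (smooth_near_differentiable sY)) _.
apply: etrans (congr1 ('d (partial2 p t y) (s1 p)) (ds1 x)) _.
by rewrite s1p; exact: mixedNl.
Qed.

(** Differentiating in the last variable gives [Y1 (Y2 z (s1 u)) u]. In [u] at [p] the outer base
    point contributes [P1 x z], and the inner one [- P2 x z] because [s1] has differential minus the
    identity. *)
Lemma mixed_composite x z :
  mixed p (fun q => t1 (q.1, t2 (s1 q.1, q.2))) x z = P1 x z - P2 x z.
Proof.
pose t3 (q : E * E) := t1 (q.1, t2 (s1 q.1, q.2)).
have [r r0 hr] := smooth_near_slices st1.
have [r2 r20 hr2] := smooth_near_slices st2.
have [rr rr0 hrr] := (near_normP _ _).1 tr2.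
have n0 := norm_self_lt p.
have cs1 : \forall u \near p, `|s1 u - p| < Num.min r2 rr.
  apply: (near_preimage (P := fun v => `|v - p| < Num.min r2 rr) (smooth_near_continuous ss1)).
  by rewrite s1p; apply/near_normP; exists (Num.min r2 rr); rewrite // lt_min r20.
have ss1' : smooth_near (fun q : E * E => s1 q.1) (p, p).
  by apply: (@smooth_near_comp _ _ _ _ fst s1) => //; exact: smooth_near_fst.
have t2pp : t2 (p, p) = p by exact: nbhs_singleton tr2.
have st3 : smooth_near t3 (p, p).
  apply: (@smooth_near_comp _ _ _ _ (fun q : E * E => (q.1, t2 (s1 q.1, q.2))) t1) => //.
    apply: smooth_near_pair; first exact: smooth_near_fst.
    apply: (@smooth_near_comp _ _ _ _ (fun q : E * E => (s1 q.1, q.2)) t2) => //.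
      by apply: smooth_near_pair => //; exact: smooth_near_snd.
    by rewrite /= s1p.
  by rewrite /= s1p t2pp.
have [r3 r30 hr3] := smooth_near_slices st3.
have h : \forall u \near p, partial2 p t3 z u = Y1 (Y2 z (s1 u)) u.
  have n1 : \forall u \near p, `|u - p| < Num.min r r3.
    by apply/near_normP; exists (Num.min r r3) => //; rewrite lt_min r0.
  apply: filterS2 cs1 n1 => u; rewrite !lt_min => /andP[u2 urr] /andP[ur u3].
  have s3 : smooth_near t3 (u, p) by apply: hr3 => //; exact: n0.
  have s2 : smooth_near t2 (s1 u, p) by apply: hr2 => //; exact: n0.
  have tp : t2 (s1 u, p) = p by exact: hrr.
  have sv1 : smooth_near t1 (u, t2 (s1 u, p)) by rewrite tp; apply: hr => //; exact: n0.
  apply: etrans (esym (diff_right z s3)) _.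
  apply: etrans (@diff_slice _ _ _ t1 (fun w => t2 (s1 u, w)) u p z sv1 (smooth_right s2)) _.
  apply: etrans (congr1 (fun a => 'd t1 (u, t2 (s1 u, p)) (0, a)) (diff_right z s2)) _.
  by rewrite tp.
have s3p := smooth_partial2 z st3.
apply: etrans (near_eq_diffE x h s3p) _.
have [sY2 eY2] := diff_partial2_s1 st2 z x.
apply: etrans (@diff_partial2_apply _ _ p t1 id (fun u => Y2 z (s1 u)) p x st1 erefl
  (smooth_near_id p) sY2) _.
apply: (f_equal2 +%R).
  apply: etrans (congr1 (fun a => P1 a (Y2 z (s1 p))) (diff_idE p x)) _.
  rewrite s1p; apply: (congr1 (P1 x)); exact: partial2_left_unit.
apply: etrans (congr1 (fun a => Y1 a p) eY2) _; exact: partial2_left_unit.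
Qed.

(** [L] is one side of the compatibility condition differentiated in its last variable. Its
    derivative along [y] in [q.2] is [Y1 (P2 (Y1 y (s1 u)) z) u]; along [x], the outer point gives
    the nested product and [s1] gives the other one with a minus sign. *)
Lemma mixed_nested x y z :
  let L q := Y1 (Y2 z (t1 (s1 q.1, q.2))) q.1 in
  smooth_near L (p, p) /\
  mixed p L x y = P1 x (P2 y z) - P2 (P1 x y) z.
Proof.
move=> L.
have [r r0 hr] := smooth_near_slices st1.
have [r2 r20 hr2] := smooth_near_slices st2.
have [rr rr0 hrr] := (near_normP _ _).1 tr1.
have n0 := norm_self_lt p.
have cs1 : \forall u \near p, `|s1 u - p| < Num.min r rr.
  apply: (near_preimage (P := fun v => `|v - p| < Num.min r rr) (smooth_near_continuous ss1)).
  by rewrite s1p; apply/near_normP; exists (Num.min r rr); rewrite // lt_min r0.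
have ss1' : smooth_near (fun q : E * E => s1 q.1) (p, p).
  by apply: (@smooth_near_comp _ _ _ _ fst s1) => //; exact: smooth_near_fst.
have t1pp : t1 (p, p) = p by exact: nbhs_singleton tr1.
have sY2 : smooth_near (Y2 z) p by exact: smooth_partial2.
have st1' : smooth_near (fun q : E * E => t1 (s1 q.1, q.2)) (p, p).
  apply: (@smooth_near_comp _ _ _ _ (fun q : E * E => (s1 q.1, q.2)) t1) => //.
    by apply: smooth_near_pair => //; exact: smooth_near_snd.
  by rewrite /= s1p.
have sL : smooth_near L (p, p).
  apply: (@smooth_near_apply _ _ _ _ t1 (fun q : E * E => (q.1, p))
    (fun q => (0, Y2 z (t1 (s1 q.1, q.2))))) => //.
    by apply: smooth_near_pair; [exact: smooth_near_fst|exact: smooth_near_cst].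
  apply: smooth_near_pair; first exact: smooth_near_cst.
  apply: (@smooth_near_comp _ _ _ _ (fun q : E * E => t1 (s1 q.1, q.2)) (Y2 z)) => //.
  by rewrite /= s1p t1pp.
split; first exact: sL.
have [r3 r30 hr3] := smooth_near_slices sL.
pose w u := P2 (Y1 y (s1 u)) z.
have h : \forall u \near p, partial2 p L y u = Y1 (w u) u.
  have n1 : \forall u \near p, `|u - p| < Num.min r r3.
    by apply/near_normP; exists (Num.min r r3) => //; rewrite lt_min r0.
  apply: filterS2 cs1 n1 => u; rewrite !lt_min => /andP[us urr] /andP[ur u3].
  have s3 : smooth_near L (u, p) by apply: hr3 => //; exact: n0.
  have s2 : smooth_near t1 (s1 u, p) by apply: hr => //; exact: n0.
  have tp : t1 (s1 u, p) = p by exact: hrr.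
  have sY2' : smooth_near (Y2 z) (t1 (s1 u, p)) by rewrite tp.
  have sc := @smooth_near_comp _ _ _ _ (fun v => t1 (s1 u, v)) (Y2 z) p fE
    (smooth_right s2) sY2'.
  have ec : 'd (fun v => Y2 z (t1 (s1 u, v))) p y = w u.
    apply: etrans (@diff_compE _ _ _ _ (fun v => t1 (s1 u, v)) (Y2 z) p y
      (smooth_near_differentiable (smooth_right s2)) (smooth_near_differentiable sY2')) _.
    apply: etrans (congr1 ('d (Y2 z) (t1 (s1 u, p))) (diff_right y s2)) _.
    exact: (congr1 (fun a => 'd (Y2 z) a (Y1 y (s1 u))) tp).
  pose l : {linear E -> E} := HB.pack (fun a => Y1 a u)
    (GRing.isLinear.Build R E E _ _ (@partial2_linear _ _ p t1 u)).
  have cl : continuous l by exact: continuous_linear_finite_coords.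
  apply: etrans (esym (diff_right y s3)) _.
  apply: etrans (@diff_compE _ _ _ _ (fun v => Y2 z (t1 (s1 u, v))) l p y
    (smooth_near_differentiable sc) (linear_differentiable _ cl)) _.
  apply: etrans (@diff_linear_eq _ _ _ l _ _ cl) _.
  exact: (congr1 l ec).
apply: etrans (near_eq_diffE x h (smooth_partial2 y sL)) _.
have [sYs eYs] := diff_partial2_s1 st1 y x.
have cl : continuous ('d (Y2 z) p).
  exact: diff_continuous (smooth_near_differentiable sY2).
have sw : smooth_near w p.
  apply: (@smooth_near_comp _ _ _ _ (fun u => Y1 y (s1 u)) ('d (Y2 z) p)) => //.
  exact: smooth_near_linear.
have dl q : differentiable ('d (Y2 z) p) q by exact: linear_differentiable.
have ew : 'd w p x = - P2 (P1 x y) z.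
  apply: etrans (@diff_compE _ _ _ _ (fun u => Y1 y (s1 u)) ('d (Y2 z) p) p x
    (smooth_near_differentiable sYs) (dl _)) _.
  apply: etrans (@diff_linear_eq _ _ _ ('d (Y2 z) p) _ _ cl) _.
  apply: etrans (congr1 ('d (Y2 z) p) eYs) _.
  exact: mixedNl.
apply: etrans (@diff_partial2_apply _ _ p t1 id w p x st1 erefl (smooth_near_id p) sw) _.
apply: (f_equal2 +%R).
  apply: etrans (congr1 (fun a => P1 a (w p)) (diff_idE p x)) _.
  apply: (congr1 (P1 x)); rewrite /w s1p.
  apply: (congr1 (fun a => P2 a z)); exact: partial2_left_unit.
apply: etrans (congr1 (fun a => Y1 a p) ew) _; exact: partial2_left_unit.
Qed.

(** Establishes the formula defining [L] on a full neighbourhood of [(p, p)], as needed before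
    taking its mixed derivative. *)
Lemma diff_nested z : \forall q \near (p, p),
  'd (fun v => t1 (q.1, t2 (t1 (s1 q.1, q.2), v))) p z =
    Y1 (Y2 z (t1 (s1 q.1, q.2))) q.1 /\
  smooth_near (fun v => t1 (q.1, t2 (t1 (s1 q.1, q.2), v))) p.
Proof.
have [r r0 hr] := smooth_near_slices st1.
have [r2 r20 hr2] := smooth_near_slices st2.
have [rr rr0 hrr] := (near_normP _ _).1 tr2.
have n0 := norm_self_lt p.
have t1pp : t1 (p, p) = p by exact: nbhs_singleton tr1.
have ss1' : smooth_near (fun q : E * E => s1 q.1) (p, p).
  by apply: (@smooth_near_comp _ _ _ _ fst s1) => //; exact: smooth_near_fst.
have st1' : smooth_near (fun q : E * E => t1 (s1 q.1, q.2)) (p, p).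
  apply: (@smooth_near_comp _ _ _ _ (fun q : E * E => (s1 q.1, q.2)) t1) => //.
    by apply: smooth_near_pair => //; exact: smooth_near_snd.
  by rewrite /= s1p.
have n1 : \forall q \near (p, p), `|t1 (s1 q.1, q.2) - p| < Num.min r2 rr.
  apply: (near_preimage (P := fun v => `|v - p| < Num.min r2 rr)
    (h := fun q : E * E => t1 (s1 q.1, q.2)) (smooth_near_continuous st1')).
  by rewrite /= s1p t1pp; apply/near_normP; exists (Num.min r2 rr); rewrite // lt_min r20.
have n2 : \forall q \near (p, p), `|q.1 - p| < r.
  apply: (near_preimage (P := fun v => `|v - p| < r) (h := fst)).
    exact: smooth_near_continuous (smooth_near_fst _).
  by apply/near_normP; exists r.
apply: filterS2 n1 n2 => q; rewrite lt_min => /andP[q1 q2] q3.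
have s2 : smooth_near t2 (t1 (s1 q.1, q.2), p) by apply: hr2 => //; exact: n0.
have tp : t2 (t1 (s1 q.1, q.2), p) = p by exact: hrr.
have s3 : smooth_near t1 (q.1, t2 (t1 (s1 q.1, q.2), p)).
  by rewrite tp; apply: hr => //; exact: n0.
split; last exact: smooth_slice s3 (smooth_right s2).
apply: etrans (@diff_slice _ _ _ t1 (fun v => t2 (t1 (s1 q.1, q.2), v)) q.1 p z s3
  (smooth_right s2)) _.
apply: etrans (congr1 (fun a => 'd t1 (q.1, t2 (t1 (s1 q.1, q.2), p)) (0, a))
  (diff_right z s2)) _.
by rewrite tp.
Qed.

End Commutation.

(** Both sides of the hypothesis have the same derivative in [v] at [p] for all [q] near [(p, p)],
    hence those derivatives have the same mixed derivative in [q]. *)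
Lemma mixed_commute (R : realType) n (p : 'rV[R]_n)
    (t1 t2 : 'rV[R]_n * 'rV[R]_n -> 'rV[R]_n) (s1 s2 : 'rV[R]_n -> 'rV[R]_n) :
  smooth_near t1 (p, p) -> smooth_near t2 (p, p) ->
  (\forall u \near p, t1 (u, p) = p) -> (\forall u \near p, t2 (u, p) = p) ->
  (\forall u \near p, t1 (p, u) = u) -> (\forall u \near p, t2 (p, u) = u) ->
  smooth_near s1 p -> s1 p = p -> (forall x, 'd s1 p x = - x) ->
  smooth_near s2 p -> s2 p = p -> (forall x, 'd s2 p x = - x) ->
  (\forall q \near (p, p), \forall v \near p,
    t1 (q.1, t2 (t1 (s1 q.1, q.2), v)) = t2 (q.2, t1 (t2 (s2 q.2, q.1), v))) ->
  forall x y z,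
  mixed p t1 x (mixed p t2 y z) - mixed p t2 (mixed p t1 x y) z =
  mixed p t2 y (mixed p t1 x z) - mixed p t1 (mixed p t2 y x) z.
Proof.
move=> st1 st2 tr1 tr2 tl1 tl2 ss1 s1p ds1 ss2 s2p ds2 H x y z.
have [sL1 <-] := mixed_nested st1 st2 tr1 tl1 ss1 s1p ds1 x y z.
have [sL2 <-] := mixed_nested st2 st1 tr2 tl2 ss2 s2p ds2 y x z.
(* On the second side the roles of [q.1] and [q.2] are exchanged. *)
apply: etrans _ (mixed_swap x y sL2); apply: mixed_near_eq; first exact: sL1.
have n1 := diff_nested st1 st2 tr1 tr2 ss1 s1p z.
have n2 := diff_nested st2 st1 tr2 tr1 ss2 s2p z.
have cs : {for (p, p), continuous (fun q : 'rV[R]_n * 'rV[R]_n => (q.2, q.1))}.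
  apply: smooth_near_continuous.
  by apply: smooth_near_pair; [exact: smooth_near_snd|exact: smooth_near_fst].
have n2' := near_preimage (h := fun q : 'rV[R]_n * 'rV[R]_n => (q.2, q.1)) cs n2.
apply: filterS3 H n1 n2' => q Hq [e1 sm1] [e2 _].
apply: etrans (esym e1) _; apply: etrans _ e2.
exact: near_eq_diffE.
Qed.

(** * Post-groups *)

Section PostGroup.
Context {G : choiceType} {mul : G -> G -> G} {e : G} {inv : G -> G}.
Context {tri : G -> G -> G} (pg : is_post_group mul e inv tri).
Local Notation gl := (GL_law mul tri).
Local Notation S := (GL_inv mul e tri).

Lemma post_group_group : is_group mul e inv. Proof. by case: pg. Qed.
Let grp := post_group_group.

Lemma post_group_inj a : injective (tri a).
Proof. by case: pg => _ h _ _; exact: bij_inj (h a). Qed.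

Lemma post_groupM a b c : tri a (mul b c) = mul (tri a b) (tri a c).
Proof. by case: pg => _ _ h _; exact: h. Qed.

Lemma post_group_action a b c : tri (gl a b) c = tri a (tri b c).
Proof. by case: pg. Qed.

Lemma post_group_fix a : tri a e = e.
Proof.
have h := post_groupM a e e; rewrite (group_mul1 grp) in h.
by rewrite -[LHS](group_mul1 grp) -{1}(group_mulV grp (tri a e)) -(group_mulA grp) -h
  (group_mulV grp).
Qed.

(** [e] is idempotent for the Grossman-Larson law, so [tri e] is an injective idempotent map. *)
Lemma post_group_id c : tri e c = c.
Proof.
apply: (@post_group_inj e); rewrite -post_group_action.
by rewrite /GL_law post_group_fix (group_mul1 grp).
Qed.

Lemma post_groupV a b : tri a (inv b) = inv (tri a b).
Proof.
by apply: (group_inv_unique grp); rewrite -post_groupM (group_mulxV grp) post_group_fix.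
Qed.

(** Surjectivity of [tri a] solves [gl a b = e]; right inverses in a monoid are two-sided, so the
    choice made by [GL_inv] is a true inverse and not the default [e]. *)
Lemma GL_is_group : is_group gl e S.
Proof.
have glA : associative gl.
  move=> a b c; rewrite {1 3 4}/GL_law post_group_action /GL_law post_groupM.
  exact: group_mulA grp _ _ _.
have gl1 : left_id e gl by move=> a; rewrite /GL_law (group_mul1 grp) post_group_id.
have gle : right_id e gl by move=> a; rewrite /GL_law post_group_fix (group_mule grp).
have glV a : exists b, gl a b = e.
  have [_ bij _ _] := pg; have [g _ gK] := bij a; exists (g (inv a)).
  by rewrite /GL_law gK (group_mulxV grp).
have S_inv a : gl a (S a) = e /\ gl (S a) a = e.
  rewrite /GL_inv; case: xgetP => [b _ //|h].
  have [b ab] := glV a; have [d bd] := glV b.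
  have da : d = a by rewrite -[d]gl1 -ab -glA bd gle.
  by case: (h b); split=> //; rewrite -[in LHS]da.
by split=> // a; have [] := S_inv a.
Qed.

Lemma post_groupVK a c : tri (S a) (tri a c) = c.
Proof. by rewrite -post_group_action (group_mulV GL_is_group) post_group_id. Qed.

Lemma post_group_GL_inv a : tri a (S a) = inv a.
Proof. by apply: (group_inv_unique grp); exact: group_mulxV GL_is_group a. Qed.

End PostGroup.

(** The Grossman-Larson product of [a] and [b] for the new action is the [tri1]-product of [a] with
    [tri2 (S1 a) b]. Its inverse for that law is a reversed product, and the compatibility condition
    rearranges the resulting actions. *)
Lemma post_group_composite (G : choiceType) (mul : G -> G -> G) (e : G) (inv : G -> G)
    (tri1 tri2 : G -> G -> G) :
  is_post_group mul e inv tri1 -> is_post_group (opp_law mul) e inv tri2 ->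
  let S1 := GL_inv mul e tri1 in
  let S2 := GL_inv (opp_law mul) e tri2 in
  (forall x y z : G,
     tri1 x (tri2 (tri1 (S1 x) y) z) = tri2 y (tri1 (tri2 (S2 y) x) z)) ->
  is_post_group mul e inv (fun x y => tri1 x (tri2 (S1 x) y)).
Proof.
move=> pg1 pg2 S1 S2 H; have grp := post_group_group pg1.
split=> // [b|b x y|a b c].
- by apply: bij_comp; [case: pg1|case: pg2].
- by rewrite [tri2 _ _](post_groupM pg2) (post_groupM pg1).
(* This [x] satisfies [tri2 (S2 y) x = b], so the hypothesis at [x] and [y] moves [tri2 y] past
   [tri1 b]. *)
pose y := S1 a; pose x := tri2 y b; pose w := tri1 (S1 x) y.
have key z : tri1 x (tri2 w z) = tri2 y (tri1 b z).
  by rewrite H /S2 (post_groupVK pg2).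
(* After applying [tri1 x], both sides are the inverse of [x] in the original group. *)
have Sx : tri2 w (S1 b) = S1 x.
  apply: (post_group_inj pg1 (a := x)).
  by rewrite key !(post_group_GL_inv pg1) (post_groupV pg2).
have -> : GL_law mul (fun x y => tri1 x (tri2 (S1 x) y)) a b = GL_law mul tri1 a x by [].
rewrite (post_group_action pg1) /S1 (group_invM (GL_is_group pg1)) -/S1 -/y.
congr (tri1 a _); rewrite -key -(post_group_action pg2); congr (tri1 x (tri2 _ c)).
(* The opposite law in the second post-group matters here: the [tri2]-product of [w] and [S1 b] is
   [mul (S1 x) w], which is also the [tri1]-product of [S1 x] and [y]. *)
by rewrite /GL_law /opp_law Sx.
Qed.

(** * Post-Lie groups in a chart *)

Section NearProduct.
Context {R : realType} {T U : normedModType R} {x : T} {y : U}.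

(** Chart lifts give identities on a neighbourhood in a product, while the local identities quantify
    over nested neighbourhoods. *)
Lemma near_curry (P : T * U -> Prop) :
  (\forall z \near (x, y), P z) -> \forall u \near x, \forall v \near y, P (u, v).
Proof.
move=> /near_normP[r r0 hr].
apply/near_normP; exists r => // u ur; apply/near_normP; exists r => // v vr.
by apply: hr; exact: (@norm_pair_lt _ _ _ (u, v) (x, y)).
Qed.

Lemma near_fst (P : T -> Prop) :
  (\forall u \near x, P u) -> \forall z \near (x, y), P z.1.
Proof.
by move=> h; exact: (@cvg_fst _ _ (nbhs x) (nbhs y) _ [set u | P u] h).
Qed.

Lemma near_snd (P : U -> Prop) :
  (\forall v \near y, P v) -> \forall z \near (x, y), P z.2.
Proof.
by move=> h; exact: (@cvg_snd _ _ (nbhs x) (nbhs y) _ [set u | P u] h).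
Qed.

End NearProduct.

(** * Transfer of identities from the group to the chart *)

Section GroupChart.
Context {R : realType} {n : nat} {G : topologicalType}.
Context {A : set (chart G 'rV[R]_n)} {e : G} {c : chart G 'rV[R]_n}.
Context (atA : is_atlas A) (cA : A c) (ce : cdom c e).
Local Notation E := 'rV[R]_n.
Local Notation smooth_op op := (smooth_map (prod_atlas A A) A (fun p => op p.1 p.2)).
Let p0 := cfun c e.
Let cK := @chartK _ _ _ _ c atA cA.

Lemma smooth_op_comp2 (op f g : G -> G -> G) :
  smooth_op op -> smooth_op f -> smooth_op g ->
  smooth_op (fun a b => op (f a b) (g a b)).
Proof.
move=> sop sf sg; have fE := @finite_coords_rV R n.
have atP := prod_atlas_is_atlas fE fE atA atA.
apply/(smooth_mapP _ atP atA) => q.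
apply: (smooth_at_comp2 (h := op) fE fE atP atA atA atA) => //.
  exact: (smooth_mapP _ atP atA).1 sf q.
exact: (smooth_mapP _ atP atA).1 sg q.
Qed.

Lemma smooth_op_fst (f : G -> G) : smooth_map A A f -> smooth_op (fun a _ => f a).
Proof.
move=> sf; have fE := @finite_coords_rV R n.
have atP := prod_atlas_is_atlas fE fE atA atA.
apply/(smooth_mapP _ atP atA) => q.
apply: (smooth_at_comp (f := fst) (g := f) fE atP atA).
  exact: smooth_at_fst.
exact: (smooth_mapP _ atA atA).1.
Qed.

Lemma smooth_op_id1 : smooth_op (fun a _ => a).
Proof.
by apply: (@smooth_op_fst id); apply/(smooth_mapP _ atA atA) => a; exact: smooth_at_id.
Qed.

Lemma smooth_op_id2 : smooth_op (fun _ b => b).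
Proof.
have fE := @finite_coords_rV R n.
have atP := prod_atlas_is_atlas fE fE atA atA.
by apply/(smooth_mapP _ atP atA) => q; exact: smooth_at_snd.
Qed.

Lemma cinv_local_op (op : G -> G -> G) : smooth_op op -> op e e = e ->
  exists2 r, 0 < r & forall u v : E, `|u - p0| < r -> `|v - p0| < r ->
    cinv c (local_op c op (u, v)) = op (cinv c u) (cinv c v).
Proof.
move=> sop oe; have cee : cdom c (op e e) by rewrite oe.
have [r r0 h] := near_slices (near_local_op atA cA sop ce ce cee).
by exists r => // u v ur vr; have [_ _ h3] := h u v ur vr; rewrite /local_op cK.
Qed.

Lemma local_op0 (op : G -> G -> G) : op e e = e -> local_op c op (p0, p0) = p0.
Proof. by move=> oe; rewrite /local_op /= cK // oe. Qed.

Lemma smooth_local_op0 (op : G -> G -> G) : smooth_op op -> op e e = e ->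
  smooth_near (local_op c op) (p0, p0).
Proof. by move=> sop oe; apply: (smooth_local_op atA) => //; rewrite oe. Qed.

Lemma near_cfunK : \forall u \near p0, cfun c (cinv c u) = u.
Proof.
have ch := atlas_chart atA cA.
by apply: filterS (near_cimg ch ce) => u; exact: chart_invK.
Qed.

Lemma local_left_unit (op : G -> G -> G) : (forall a, op e a = a) ->
  \forall u \near p0, local_op c op (p0, u) = u.
Proof.
by move=> oe; apply: filterS near_cfunK => u uK; rewrite /local_op /= cK // oe.
Qed.

Lemma local_right_unit (op : G -> G -> G) : (forall a, op a e = a) ->
  \forall u \near p0, local_op c op (u, p0) = u.
Proof.
by move=> oe; apply: filterS near_cfunK => u uK; rewrite /local_op /= cK // oe.
Qed.

Lemma local_fix (op : G -> G -> G) : (forall a, op a e = e) ->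
  \forall u \near p0, local_op c op (u, p0) = p0.
Proof.
by move=> oe; apply: filterS near_cfunK => u _; rewrite /local_op /= cK // oe.
Qed.

Lemma local_op_near (op : G -> G -> G) r : smooth_op op -> op e e = e -> 0 < r ->
  \forall q \near (p0, p0), `|local_op c op q - p0| < r.
Proof.
move=> sop oe r0.
apply: (near_preimage (P := fun v => `|v - p0| < r)
  (smooth_near_continuous (smooth_local_op0 sop oe))).
by rewrite local_op0 //; apply/near_normP; exists r.
Qed.

(* [gg] is the coordinate expression near [x0] of [g], which maps [x0] to [e]. *)
Definition chart_lift (T : normedModType R) (x0 : T) (gg : T -> E) (g : T -> G) : Prop :=
  (forall r, 0 < r -> \forall x \near x0, `|gg x - p0| < r) /\
  \forall x \near x0, cinv c (gg x) = g x.

Lemma chart_lift_id : chart_lift p0 id (cinv c).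
Proof.
split=> [r r0|]; first by apply/near_normP; exists r.
by apply: filterS near_cfunK.
Qed.

Lemma chart_lift_fst (T U : normedModType R) (x0 : T) (y0 : U) gg g :
  chart_lift x0 gg g -> chart_lift (x0, y0) (fun z : T * U => gg z.1) (fun z => g z.1).
Proof. by move=> [h1 h2]; split=> [r r0|]; [exact: near_fst (h1 r r0)|exact: near_fst h2]. Qed.

Lemma chart_lift_snd (T U : normedModType R) (x0 : T) (y0 : U) gg g :
  chart_lift y0 gg g -> chart_lift (x0, y0) (fun z : T * U => gg z.2) (fun z => g z.2).
Proof. by move=> [h1 h2]; split=> [r r0|]; [exact: near_snd (h1 r r0)|exact: near_snd h2]. Qed.

(** Lifts compose, so the coordinate expression of a word in smooth operations fixing [e] represents
    that word near the unit. Lifting both sides of a group identity turns it into an identity of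
    germs. *)
Lemma chart_lift_op (T : normedModType R) (x0 : T) gg g hh h (op : G -> G -> G) :
  smooth_op op -> op e e = e -> chart_lift x0 gg g -> chart_lift x0 hh h ->
  chart_lift x0 (fun x => local_op c op (gg x, hh x)) (fun x => op (g x) (h x)).
Proof.
move=> sop oe [g1 g2] [h1 h2]; split.
  move=> r r0; have [s s0 hs] := near_slices (local_op_near sop oe r0).
  by apply: filterS2 (g1 s s0) (h1 s s0) => x; exact: hs.
have [r r0 hr] := cinv_local_op sop oe.
have n1 : \forall x \near x0, `|gg x - p0| < r /\ `|hh x - p0| < r.
  by apply: filterS2 (g1 r r0) (h1 r r0).
apply: filterS3 n1 g2 h2 => x [gr hr'] gx hx.
by rewrite hr // gx hx.
Qed.

Lemma chart_lift_map (T : normedModType R) (x0 : T) gg g (f : G -> G) :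
  smooth_map A A f -> f e = e -> chart_lift x0 gg g ->
  chart_lift x0 (fun x => chart_inv (inv := f) c (gg x)) (fun x => f (g x)).
Proof.
move=> sf fe hg.
exact: (chart_lift_op (op := fun a _ => f a) (smooth_op_fst sf) fe hg hg).
Qed.

Lemma local_op_lift (T : normedModType R) (x0 : T) gg g hh h (op : G -> G -> G) :
  chart_lift x0 gg g -> chart_lift x0 hh h ->
  \forall x \near x0, local_op c op (gg x, hh x) = cfun c (op (g x) (h x)).
Proof.
by move=> [_ h1] [_ h2]; apply: filterS2 h1 h2 => x gx hx; rewrite /local_op /= gx hx.
Qed.

End GroupChart.

(** * Lie bracket and post-Lie product as mixed derivatives *)

Section LieProducts.
Context {R : realType} {n : nat} {G : topologicalType}.
Context {A : set (chart G 'rV[R]_n)} {mul : G -> G -> G} {e : G} {inv : G -> G}.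
Context {c : chart G 'rV[R]_n}.
Context (atA : is_atlas A) (grp : is_group mul e inv).
Context (smul : smooth_map (prod_atlas A A) A (fun p => mul p.1 p.2)).
Context (cA : A c) (ce : cdom c e).
Local Notation E := 'rV[R]_n.
Local Notation smooth_op op := (smooth_map (prod_atlas A A) A (fun p => op p.1 p.2)).
Let p0 := cfun c e.
Let cK := @chartK _ _ _ _ c atA cA.
Let m := local_op c mul.
Let sm : smooth_near m (p0, p0). Proof. exact: (smooth_law atA grp). Qed.
Let mul_ee : mul e e = e. Proof. exact: (group_mul1 grp). Qed.
Let mr : \forall u \near p0, m (u, p0) = u.
Proof. by apply: (local_right_unit atA) => // a; exact: (group_mule grp). Qed.
Let ml : \forall u \near p0, m (p0, u) = u.
Proof. by apply: (local_left_unit atA) => // a; exact: (group_mul1 grp). Qed.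

Lemma left_inv_fieldE x : \forall u \near p0, left_inv_field c mul e x u = partial2 p0 m x u.
Proof.
have [r r0 hr] := smooth_near_slices sm.
apply: (near_of_norm r0) => u ur; have su := hr u p0 ur (norm_self_lt p0 r0).
apply: etrans (deriveE _ (smooth_near_differentiable (smooth_right su))) _.
exact: diff_right.
Qed.

Lemma derive_left_inv_field x y :
  'D_x (left_inv_field c mul e y) p0 = mixed p0 m x y.
Proof.
have h : \forall u \near p0, partial2 p0 m y u = left_inv_field c mul e y u.
  by apply: filterS (left_inv_fieldE y) => u ->.
have [d1 e1] := near_eq_diff h (smooth_near_differentiable (smooth_partial2 y sm)).
by apply: etrans (deriveE _ d1) _; exact: (congr1 (@^~ x) e1).
Qed.

(** At [p0] the left-invariant fields take the values [x] and [y], so each derivative in their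
    bracket is a mixed derivative of the law. *)
Lemma lie_bracketE x y : lie_bracket c mul e x y = commutator p0 m x y.
Proof.
have X0 z : left_inv_field c mul e z p0 = z.
  by rewrite (nbhs_singleton (left_inv_fieldE z)); exact: partial2_left_unit.
by rewrite /lie_bracket /field_bracket !X0 !derive_left_inv_field.
Qed.

Lemma local_mulA : \forall q \near (p0, p0), \forall w \near p0,
  m (m q, w) = m (q.1, m (q.2, w)).
Proof.
apply: (near_curry (P := fun z : (E * E) * E => m (m z.1, z.2) = m (z.1.1, m (z.1.2, z.2)))).
have l0 := chart_lift_id atA cA ce.
have l1 := chart_lift_fst p0 (chart_lift_fst p0 l0).
have l2 := chart_lift_fst p0 (chart_lift_snd p0 l0).
have l3 := chart_lift_snd (p0, p0) l0.
have l12 := chart_lift_op atA cA ce smul mul_ee l1 l2.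
have l23 := chart_lift_op atA cA ce smul mul_ee l2 l3.
have := local_op_lift mul l1 l23; have := local_op_lift mul l12 l3.
apply: filterS2 => -[[a b] w] /= h1 h2.
apply: etrans h1 _; apply: etrans _ (esym h2).
by rewrite (group_mulA grp).
Qed.

Lemma one_param_coords (g : R^o -> G) : one_param_subgroup A mul g ->
  [/\ cfun c (g 0) = p0, smooth_near (cfun c \o g) 0 &
      \forall t \near (0 : R^o), cinv c (cfun c (g t)) = g t].
Proof.
move=> [sg gM]; have g0 : g 0 = e by exact: (hom0 grp).
have [cg hg] := (smooth_mapP _ (@line_atlas_is_atlas R) atA).1 sg 0.
split; first by rewrite g0.
  by apply: (hg (Chart setT id id) c) => //; rewrite g0.
have nd : \forall a \near g 0, cdom c a by rewrite g0; exact: near_cdom (atlas_chart atA cA) ce.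
have : \forall t \near (0 : R^o), cdom c (g t) by exact: (cg [set a | cdom c a] nd).
by apply: filterS => t; exact: cK.
Qed.

Lemma derive1_along (w h : R^o -> E) (F : E -> E) : smooth_near w 0 ->
  smooth_near F (w 0) -> (\forall t \near (0 : R^o), h t = F (w t)) ->
  derive1 h 0 = 'd F (w 0) (derive1 w 0).
Proof.
move=> sw sF hF; have dw := smooth_near_differentiable sw.
have dF := smooth_near_differentiable sF.
have dc : differentiable (fun t : R^o => F (w t)) 0.
  exact: (@differentiable_comp _ _ _ _ w F _ dw dF).
have hF' : \forall t \near (0 : R^o), F (w t) = h t by apply: filterS hF => t ->.
have [dh eh] := near_eq_diff hF' dc.
rewrite (derive1E' dh) (derive1E' dw); apply: etrans (congr1 (@^~ 1) eh) _.
exact: (@diff_compE _ _ _ _ w F _ 1 dw dF).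
Qed.

(** The exponentials run along one-parameter subgroups of which the chain rule only sees the
    velocities [x] and [y]. The inner derivative is computed for all small [t], since it is
    differentiated again. *)
Lemma post_lie_productE (tri : G -> G -> G) x y : smooth_op tri -> (forall a, tri a e = e) ->
  post_lie_product A c mul e tri x y = mixed p0 (local_op c tri) x y.
Proof.
move=> stri te; pose tau := local_op c tri.
have stau : smooth_near tau (p0, p0) by exact: (smooth_local_op0 atA cA ce stri).
have [gx ox [ex hx]] := lie_exp_curve atA grp smul cA ce x.
have [gy oy [ey hy]] := lie_exp_curve atA grp smul cA ce y.
have [x0 sx nx] := one_param_coords ox; have [y0 sy ny] := one_param_coords oy.
have [r r0 hr] := smooth_near_slices stau.
have nxr : \forall t \near (0 : R^o), `|cfun c (gx t) - p0| < r.
  apply: (near_preimage (P := fun v => `|v - p0| < r) (smooth_near_continuous sx)).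
  by rewrite /= x0; apply/near_normP; exists r.
have inner : \forall t \near (0 : R^o),
    derive1 (fun s : R => cfun c (tri (lie_exp A c mul e (t *: x))
                                      (lie_exp A c mul e (s *: y)))) 0 =
    partial2 p0 tau y ((cfun c \o gx) t).
  apply: filterS2 nx nxr => t tK tr.
  have st : smooth_near tau (cfun c (gx t), p0) by exact: hr tr (norm_self_lt p0 r0).
  apply: etrans (@derive1_along (cfun c \o gy) _ (fun v => tau (cfun c (gx t), v)) sy _ _) _.
  - by rewrite /= y0; exact: smooth_right.
  - by apply: filterS ny => s sK; rewrite hx hy /tau /local_op /= tK sK.
  by rewrite /= y0 ey; exact: diff_right.
rewrite /post_lie_product.
apply: etrans (@derive1_along (cfun c \o gx) _ (partial2 p0 tau y) sx _ inner) _.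
  by rewrite /= x0; exact: smooth_partial2.
by rewrite /= x0 ex.
Qed.

Lemma lie_bracket_is_lie_algebra : is_lie_algebra (lie_bracket c mul e).
Proof.
have -> : lie_bracket c mul e = commutator p0 m.
  by apply/funext => x; apply/funext => y; exact: lie_bracketE.
split; first exact: commutator_bilinear.
  by move=> x; rewrite /commutator subrr.
exact: jacobi sm mr ml local_mulA.
Qed.

Context {tri : G -> G -> G} (pg : is_post_group mul e inv tri) (stri : smooth_op tri).
Let tau := local_op c tri.
Let st : smooth_near tau (p0, p0).
Proof. exact: (smooth_local_op0 atA cA ce stri (post_group_fix pg e)). Qed.
Let tr : \forall u \near p0, tau (u, p0) = p0.
Proof. by apply: (local_fix atA) => // a; exact: (post_group_fix pg). Qed.
Let tl : \forall u \near p0, tau (p0, u) = u.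
Proof. by apply: (local_left_unit atA) => // a; exact: (post_group_id pg). Qed.

Lemma local_automorphism : \forall w \near p0, \forall q \near (p0, p0),
  tau (w, m q) = m (tau (w, q.1), tau (w, q.2)).
Proof.
apply: (near_curry (P := fun z : E * (E * E) =>
  tau (z.1, m z.2) = m (tau (z.1, z.2.1), tau (z.1, z.2.2)))).
have tee := post_group_fix pg e.
have l0 := chart_lift_id atA cA ce.
have l1 := chart_lift_fst (p0, p0) l0.
have l2 := chart_lift_snd p0 (chart_lift_fst p0 l0).
have l3 := chart_lift_snd p0 (chart_lift_snd p0 l0).
have l23 := chart_lift_op atA cA ce smul mul_ee l2 l3.
have l12 := chart_lift_op atA cA ce stri tee l1 l2.
have l13 := chart_lift_op atA cA ce stri tee l1 l3.
have := local_op_lift tri l1 l23; have := local_op_lift mul l12 l13.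
apply: filterS2 => -[w [a b]] /= h1 h2.
apply: etrans h2 _; apply: etrans _ (esym h1).
by rewrite (post_groupM pg).
Qed.

Lemma local_action : \forall q \near (p0, p0), \forall w \near p0,
  tau (m (q.1, tau q), w) = tau (q.1, tau (q.2, w)).
Proof.
apply: (near_curry (P := fun z : (E * E) * E =>
  tau (m (z.1.1, tau z.1), z.2) = tau (z.1.1, tau (z.1.2, z.2)))).
have tee := post_group_fix pg e.
have l0 := chart_lift_id atA cA ce.
have l1 := chart_lift_fst p0 (chart_lift_fst p0 l0).
have l2 := chart_lift_fst p0 (chart_lift_snd p0 l0).
have l3 := chart_lift_snd (p0, p0) l0.
have l12 := chart_lift_op atA cA ce stri tee l1 l2.
have l112 := chart_lift_op atA cA ce smul mul_ee l1 l12.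
have l23 := chart_lift_op atA cA ce stri tee l2 l3.
have := local_op_lift tri l1 l23; have := local_op_lift tri l112 l3.
apply: filterS2 => -[[a b] w] /= h1 h2.
apply: etrans h1 _; apply: etrans _ (esym h2).
by rewrite -(post_group_action pg).
Qed.

(** Holds for every smooth post-group action; it is applied to [tri3] to obtain the axioms of
    [prd3]. *)
Lemma post_lie_algebra_of_group :
  is_post_lie_algebra (lie_bracket c mul e) (post_lie_product A c mul e tri).
Proof.
split; first exact: lie_bracket_is_lie_algebra.
all: have -> : post_lie_product A c mul e tri = mixed p0 tau
  by apply/funext => x; apply/funext => y; apply: post_lie_productE => // a;
     exact: (post_group_fix pg).
- exact: mixed_bilinear.
- move=> x y z; rewrite !lie_bracketE.
  exact (derivation_bracket sm mr ml st tr tl x y z local_automorphism).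
- move=> x y z; rewrite lie_bracketE.
  exact (curvature sm mr ml st tr tl x y z local_action).
Qed.

End LieProducts.

Theorem proposition4p16 (R : realType) (n : nat) (G : topologicalType)
    (A : set (chart G 'rV[R]_n)) (mul : G -> G -> G) (e : G) (inv : G -> G)
    (tri1 tri2 : G -> G -> G)
    (c : chart G 'rV[R]_n)
    (br prd1 prd2 : 'rV[R]_n -> 'rV[R]_n -> 'rV[R]_n) :
  is_post_lie_group A mul e inv tri1 ->
  is_post_lie_group A (opp_law mul) e inv tri2 ->
  let S1 := GL_inv mul e tri1 in
  let S2 := GL_inv (opp_law mul) e tri2 in
  (forall x y z : G,
     tri1 x (tri2 (tri1 (S1 x) y) z) = tri2 y (tri1 (tri2 (S2 y) x) z)) ->
  A c -> cdom c e ->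
  associated_post_lie_algebra A c mul e tri1 br prd1 ->
  associated_post_lie_algebra A c (opp_law mul) e tri2
    (fun x y => - br x y) (fun x y => - prd2 x y) ->
  let prd3 := fun x y => prd1 x y + prd2 x y in
  let tri3 := fun x y => tri1 x (tri2 (S1 x) y) in
  [/\ forall x y z,
        prd1 x (prd2 y z) - prd2 (prd1 x y) z =
        prd2 y (prd1 x z) - prd1 (prd2 y x) z,
      is_post_lie_algebra br prd3,
      is_post_lie_group A mul e inv tri3 &
      associated_post_lie_algebra A c mul e tri3 br prd3].
Proof.
move=> [lie1 pg1 stri1] [lie2 pg2 stri2] S1 S2 H cA ce [brE prd1E] [_ prd2E] prd3 tri3.
have [[_ _ atA] grp1 smul1 _] := lie1; have [_ grp2 smul2 _] := lie2.
have id1 := smooth_op_id1 atA; have id2 := smooth_op_id2 atA.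
have gl1 := smooth_op_comp2 (op := mul) (f := fun a _ => a) (g := tri1) atA smul1 id1 stri1.
have gl2 := smooth_op_comp2 (op := opp_law mul) (f := fun a _ => a) (g := tri2) atA smul2 id1 stri2.
have grpS1 := GL_is_group pg1; have grpS2 := GL_is_group pg2.
(* [S1] and [S2] are the inversions of the two Grossman-Larson groups, whose laws are smooth, so the
   general result on inversion applies to them. *)
have sS1 := smooth_inv atA grpS1 gl1 cA ce; have sS2 := smooth_inv atA grpS2 gl2 cA ce.
have fix1 := post_group_fix pg1; have fix2 := post_group_fix pg2.
have S1e : S1 e = e := group_inv1 grpS1; have S2e : S2 e = e := group_inv1 grpS2.
have stri3 := smooth_op_comp2 (op := tri1) (f := fun a _ => a) (g := fun a b => tri2 (S1 a) b)
  atA stri1 id1 (smooth_op_comp2 (op := tri2) (f := fun a _ => S1 a) (g := fun _ b => b)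
    atA stri2 (smooth_op_fst atA sS1) id2).
have pg3 := post_group_composite pg1 pg2 H.
pose p0 := cfun c e; pose t1 := local_op c tri1; pose t2 := local_op c tri2.
pose s1 := chart_inv (inv := S1) c; pose s2 := chart_inv (inv := S2) c.
have st1 : smooth_near t1 (p0, p0) := smooth_local_op0 atA cA ce stri1 (fix1 e).
have st2 : smooth_near t2 (p0, p0) := smooth_local_op0 atA cA ce stri2 (fix2 e).
have tr1 := local_fix atA cA ce fix1; have tr2 := local_fix atA cA ce fix2.
have tl1 := local_left_unit atA cA ce (post_group_id pg1).
have tl2 := local_left_unit atA cA ce (post_group_id pg2).
have ss1 := smooth_chart_inv atA grpS1 gl1 cA ce.
have ss2 := smooth_chart_inv atA grpS2 gl2 cA ce.
have s10 := chart_inv0 atA grpS1 cA ce; have s20 := chart_inv0 atA grpS2 cA ce.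
have [_ ds1] := chart_inv_diff0 atA grpS1 gl1 cA ce.
have [_ ds2] := chart_inv_diff0 atA grpS2 gl2 cA ce.
have P1E x y : prd1 x y = mixed p0 t1 x y.
  by rewrite prd1E; exact: (post_lie_productE atA grp1 smul1 cA ce x y stri1 fix1).
(* The associated product of the second post-group is [- prd2]. This sign meets the one from the
   differential of [S1], so that [tri3] yields a sum. *)
have P2E x y : prd2 x y = - mixed p0 t2 x y.
  rewrite -[LHS]opprK prd2E; congr (- _).
  exact: (post_lie_productE atA grp2 smul2 cA ce x y stri2 fix2).
have l0 := chart_lift_id atA cA ce.
have compat : \forall q \near (p0, p0), \forall v \near p0,
    t1 (q.1, t2 (t1 (s1 q.1, q.2), v)) = t2 (q.2, t1 (t2 (s2 q.2, q.1), v)).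
  apply: (near_curry (P := fun z : ('rV[R]_n * 'rV[R]_n) * 'rV[R]_n =>
    t1 (z.1.1, t2 (t1 (s1 z.1.1, z.1.2), z.2)) = t2 (z.1.2, t1 (t2 (s2 z.1.2, z.1.1), z.2)))).
  have la := chart_lift_fst p0 (chart_lift_fst p0 l0).
  have lb := chart_lift_fst p0 (chart_lift_snd p0 l0).
  have lv := chart_lift_snd (p0, p0) l0.
  have lx := chart_lift_op atA cA ce stri1 (fix1 e) (chart_lift_map atA cA ce sS1 S1e la) lb.
  have ly := chart_lift_op atA cA ce stri2 (fix2 e) (chart_lift_map atA cA ce sS2 S2e lb) la.
  have := local_op_lift tri1 la (chart_lift_op atA cA ce stri2 (fix2 e) lx lv).
  have := local_op_lift tri2 lb (chart_lift_op atA cA ce stri1 (fix1 e) ly lv).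
  apply: filterS2 => -[[a b] v] /= h2 h1.
  by apply: etrans h1 _; apply: etrans _ (esym h2); rewrite H.
have fix3 a : tri3 a e = e by rewrite /tri3 fix2 fix1.
have P3E x y : prd3 x y = post_lie_product A c mul e tri3 x y.
  apply: esym; apply: etrans (post_lie_productE atA grp1 smul1 cA ce x y stri3 fix3) _.
  rewrite /prd3 P1E P2E.
  apply: etrans _ (mixed_composite st1 st2 tr2 tl1 tl2 ss1 s10 ds1 x y).
  apply: mixed_near_eq; first exact: (smooth_local_op0 atA cA ce stri3 (fix3 e)).
  have la := chart_lift_fst p0 l0; have lb := chart_lift_snd p0 l0.
  have ls := chart_lift_map atA cA ce sS1 S1e la.
  have := local_op_lift tri1 la (chart_lift_op atA cA ce stri2 (fix2 e) ls lb).
  by apply: filterS => -[a b] /= h; exact: esym h.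
have brF : br = lie_bracket c mul e.
  by apply/funext => x; apply/funext => y; exact: brE.
have prd3F : prd3 = post_lie_product A c mul e tri3.
  by apply/funext => x; apply/funext => y; exact: P3E.
split.
(* Every term contains exactly one factor [prd2], so the identity is the negative of the one between
   mixed derivatives. *)
- move=> x y z; rewrite !P1E !P2E mixedNl mixedNr // !opprK.
  apply: oppr_inj; rewrite !opprD !opprK.
  exact: mixed_commute st1 st2 tr1 tr2 tl1 tl2 ss1 s10 ds1 ss2 s20 ds2 compat x y z.
- by rewrite brF prd3F; exact: (post_lie_algebra_of_group atA grp1 smul1 cA ce pg3 stri3).
- by split.
- by split.
Qed.
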